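(* Let $m>n+2$, $n\ge1$, $\mathfrak g=\mathfrak{osp}(2m|2n)$ with the data below, and let $\Lambda\in\hat{\mathfrak h}^*$ have level $k\ne0$ and satisfy $(\Lambda|T)=0$ (resp. $(\Lambda|T')=0$). Then $L(\Lambda)$ is integrable if and only if $\Lambda=k\Lambda_0-\sum_{i=1}^nk_i\beta_i+\sum_{i=n+1}^mk_i\epsilon_i+c\delta$ (resp. the same expression with $\beta_1$ replaced by $\beta_1'$) for some $c\in\mathbb{C}$ and numbers $k_i$ with $k\in\mathbb{Z}_{>0}$, $k_1\in\frac12\mathbb{Z}$, $k_i-k_1\in\mathbb{Z}$ ($2\le i\le m$), $k_m\ge\dots\ge k_2\ge|k_1|$, $k\ge k_m+k_{m-1}$, and such that $k_2=-k_1$ implies $k_1=k_2=0$.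
   Context: Affine setting: $\mathfrak g$ is a basic Lie superalgebra with nondegenerate invariant supersymmetric form $(\cdot|\cdot)$ and Cartan subalgebra $\mathfrak h\subset\mathfrak g_{\bar0}$, identified with $\mathfrak h^*$. $\hat{\mathfrak g}=\mathfrak g[t,t^{-1}]\oplus\mathbb{C}K\oplus\mathbb{C}d$, $[at^r,bt^s]=[a,b]t^{r+s}+r\delta_{r,-s}(a|b)K$, $K$ central, $[d,at^r]=rat^r$; $\hat{\mathfrak h}=\mathfrak h\oplus\mathbb{C}K\oplus\mathbb{C}d$, form extended by $(\mathfrak h|\mathbb{C}K+\mathbb{C}d)=0$, $(K|K)=(d|d)=0$, $(K|d)=1$; $\delta,\Lambda_0$ correspond to $K,d$. With simple roots $\Pi$, highest root $\theta$ of $\mathfrak g$, positive roots of $\hat{\mathfrak g}$: positive roots of $\mathfrak g$ and $\alpha+r\delta$ ($\alpha$ a root or 0, $r>0$); simple roots $\{\delta-\theta\}\cup\Pi$. $L(\Lambda)$ is the irreducible highest weight module, level $\Lambda(K)$. $L(\Lambda)$ is $\gamma$-integrable if $\hat{\mathfrak g}_{-\gamma}$ acts locally nilpotently; integrable if $\gamma$-integrable for all positive $\gamma\in\Delta^\#_{\bar0}$ and all $\alpha+r\delta$, $\alpha\in\Delta^\#_{\bar0}$, $r\in\mathbb{Z}_{>0}$, $\Delta^\#_{\bar0}$ the root set of $\mathfrak g^\#_{\bar0}$. Data: orthogonal basis $\epsilon_1,\dots,\epsilon_m,\delta_1,\dots,\delta_n$ of $\mathfrak h^*$, $(\epsilon_i|\epsilon_i)=1$,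 $(\delta_j|\delta_j)=-1$. Even roots $\epsilon_i-\epsilon_j,\pm(\epsilon_i+\epsilon_j)$ ($i\ne j$), $\delta_i-\delta_j,\pm(\delta_i+\delta_j),\pm2\delta_i$; odd roots $\pm(\epsilon_i\pm\delta_j)$. $\mathfrak g^\#_{\bar0}=\mathfrak{so}(2m)$ (roots in the $\epsilon$'s). Simple roots: $\epsilon_{m-i+1}-\epsilon_{m-i}$ ($1\le i\le m-n-1$), then $\epsilon_{n+1}-\delta_n,\ \delta_n-\epsilon_n,\ \epsilon_n-\delta_{n-1},\ \delta_{n-1}-\epsilon_{n-1},\dots,\ \epsilon_2-\delta_1,\ \delta_1-\epsilon_1,\ \delta_1+\epsilon_1$; $\theta=\epsilon_m+\epsilon_{m-1}$. $T=\{\beta_i=\delta_i-\epsilon_i: 1\le i\le n\}$. $\sigma_0$ is the linear map with $\sigma_0(\epsilon_1)=-\epsilon_1$, $\sigma_0(\epsilon_{n+1})=-\epsilon_{n+1}$, fixing the other $\epsilon_i$, all $\delta_j$, $\delta$ and $\Lambda_0$; $T'=\sigma_0(T)$, so $\beta_1'=\sigma_0(\beta_1)=\delta_1+\epsilon_1$ and $\beta'_i=\beta_i$ for $i\ge2$. *)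

(* Defs.v *)
From HB Require Import structures.
From mathcomp Require Import all_boot all_order all_algebra.
Set Implicit Arguments. Unset Strict Implicit. Unset Printing Implicit Defensive.
Import Order.TTheory GRing.Theory Num.Theory.
Local Open Scope ring_scope.

(* Basis ordering: e_1..e_m, e_{-1}..e_{-m} (even), f_1..f_n, f_{-1}..f_{-n} (odd). *)
Definition Nd (m n : nat) : nat := (m + m + (n + n))%N.

Definition ep (m n : nat) (i : 'I_m) : 'I_(Nd m n) := lshift (n + n) (lshift m i).
Definition em (m n : nat) (i : 'I_m) : 'I_(Nd m n) := lshift (n + n) (rshift m i).
Definition fp (m n : nat) (j : 'I_n) : 'I_(Nd m n) := rshift (m + m) (lshift n j).
Definition fm (m n : nat) (j : 'I_n) : 'I_(Nd m n) := rshift (m + m) (rshift n j).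

(* parity of a basis index: true = odd *)
Definition par (m n : nat) (a : 'I_(Nd m n)) : bool := (m + m <= a)%N.

(* Gram matrix of the even supersymmetric form B:
   B(e_i,e_{-i}) = B(e_{-i},e_i) = 1, B(f_j,f_{-j}) = 1 = -B(f_{-j},f_j). *)
Definition Jform (C : numClosedFieldType) (m n : nat) : 'M[C]_(Nd m n) :=
  \matrix_(a, b)
    (if [exists i : 'I_m, (a == ep n i) && (b == em n i)]
        || [exists i : 'I_m, (a == em n i) && (b == ep n i)]
        || [exists j : 'I_n, (a == fp m j) && (b == fm m j)] then 1
     else if [exists j : 'I_n, (a == fm m j) && (b == fp m j)] then -1 else 0).

Definition is_hom (C : numClosedFieldType) (m n : nat) (p : bool)
    (X : 'M[C]_(Nd m n)) : Prop :=
  forall a b : 'I_(Nd m n), (par a (+) par b) != p -> X a b = 0.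

Definition even_part (C : numClosedFieldType) (m n : nat) (X : 'M[C]_(Nd m n))
  : 'M[C]_(Nd m n) := \matrix_(a, b) (if par a == par b then X a b else 0).
Definition odd_part (C : numClosedFieldType) (m n : nat) (X : 'M[C]_(Nd m n))
  : 'M[C]_(Nd m n) := \matrix_(a, b) (if par a == par b then 0 else X a b).

(* homogeneous X of parity p preserves B:
   B(X u, v) + (-1)^{p |u|} B(u, X v) = 0 on basis vectors *)
Definition osp_hom (C : numClosedFieldType) (m n : nat) (p : bool)
    (X : 'M[C]_(Nd m n)) : Prop :=
  forall a b : 'I_(Nd m n),
    \sum_c X c a * Jform C m n c b
    + (-1) ^+ (p && par a) * \sum_c Jform C m n a c * X c b = 0.

Definition osp (C : numClosedFieldType) (m n : nat) (X : 'M[C]_(Nd m n)) : Prop :=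
  osp_hom false (even_part X) /\ osp_hom true (odd_part X).

Definition sbr (C : numClosedFieldType) (m n : nat) (p q : bool)
    (X Y : 'M[C]_(Nd m n)) : 'M[C]_(Nd m n) :=
  X *m Y - (-1) ^+ (p && q) *: (Y *m X).

(* invariant supersymmetric form (X|Y) = 1/2 str(XY); it induces
   (eps_i|eps_i) = 1, (delta_j|delta_j) = -1 on h^* *)
Definition mform (C : numClosedFieldType) (m n : nat) (X Y : 'M[C]_(Nd m n)) : C :=
  2^-1 * (\sum_(a | ~~ par a) (X *m Y) a a - \sum_(a | par a) (X *m Y) a a).

Definition hmat (C : numClosedFieldType) (m n : nat) (H : 'M[C]_(Nd m n)) : Prop :=
  osp H /\ forall a b, a != b -> H a b = 0.

(* ---------- weights: hhat^* with coordinates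
   (eps_1..eps_m, delta_1..delta_n, Lambda_0, delta) ---------- *)
Definition hw (C : numClosedFieldType) (m n : nat) := 'rV[C]_((m + n).+2).

Definition wc (C : numClosedFieldType) (m n : nat) (L : hw C m n) (k : nat) : C :=
  L 0 (inord k).

(* 1-based, as in the paper *)
Definition epsw (C : numClosedFieldType) (m n : nat) (i : nat) : hw C m n :=
  \row_(x < (m + n).+2) (if (0 < i <= m)%N && (x == i.-1 :> nat) then 1 else 0).
Definition dltw (C : numClosedFieldType) (m n : nat) (j : nat) : hw C m n :=
  \row_(x < (m + n).+2) (if (0 < j <= n)%N && (x == m + j.-1 :> nat)%N then 1 else 0).
Definition L0w (C : numClosedFieldType) (m n : nat) : hw C m n :=
  \row_(x < (m + n).+2) (if x == (m + n)%N :> nat then 1 else 0).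
Definition deltaw (C : numClosedFieldType) (m n : nat) : hw C m n :=
  \row_(x < (m + n).+2) (if x == (m + n).+1 :> nat then 1 else 0).

Definition level (C : numClosedFieldType) (m n : nat) (L : hw C m n) : C :=
  wc L (m + n).

Definition wform (C : numClosedFieldType) (m n : nat) (mu nu : hw C m n) : C :=
  \sum_(i < m) wc mu i * wc nu i - \sum_(j < n) wc mu (m + j) * wc nu (m + j)
  + wc mu (m + n) * wc nu (m + n).+1 + wc mu (m + n).+1 * wc nu (m + n).

Definition lamH (C : numClosedFieldType) (m n : nat) (al : hw C m n)
    (H : 'M[C]_(Nd m n)) : C :=
  \sum_(i < m) wc al i * H (ep n i) (ep n i)
  + \sum_(j < n) wc al (m + j) * H (fp m j) (fp m j).

Definition rootspace (C : numClosedFieldType) (m n : nat) (al : hw C m n)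
    (X : 'M[C]_(Nd m n)) : Prop :=
  osp X /\ forall H, hmat H -> H *m X - X *m H = lamH al H *: X.

Definition finw (C : numClosedFieldType) (m n : nat) (al : hw C m n) : Prop :=
  wc al (m + n) = 0 /\ wc al (m + n).+1 = 0.

Definition isroot (C : numClosedFieldType) (m n : nat) (al : hw C m n) : Prop :=
  finw al /\ al <> 0 /\ exists X, rootspace al X /\ X <> 0.

Definition simple_roots (C : numClosedFieldType) (m n : nat) : seq (hw C m n) :=
  [seq epsw C m n i.+1 - epsw C m n i | i <- iota n.+1 (m - n - 1)]
  ++ [:: epsw C m n n.+1 - dltw C m n n]
  ++ [seq dltw C m n j - epsw C m n j | j <- iota 1 n]
  ++ [seq epsw C m n j.+1 - dltw C m n j | j <- iota 1 (n - 1)]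
  ++ [:: dltw C m n 1 + epsw C m n 1].

Definition inQplus (C : numClosedFieldType) (m n : nat) (al : hw C m n) : Prop :=
  exists c : nat -> nat,
    al = \sum_(i < size (simple_roots C m n)) (c i)%:R *: (simple_roots C m n)`_i.

Definition posroot (C : numClosedFieldType) (m n : nat) (al : hw C m n) : Prop :=
  isroot al /\ inQplus al.

Definition so0root (C : numClosedFieldType) (m n : nat) (g : hw C m n) : Prop :=
  exists i j : nat, (1 <= i <= m)%N /\ (1 <= j <= m)%N /\ i <> j /\
    (g = epsw C m n i - epsw C m n j \/ g = epsw C m n i + epsw C m n j
     \/ g = - (epsw C m n i + epsw C m n j)).

(* ---------- representations of hat g ----------
   rpi r X = action of X t^r, rK = action of K, rD = action of d *)
Record hrep (C : numClosedFieldType) (m n : nat) (V : lmodType C) := HRep {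
  rpi : int -> 'M[C]_(Nd m n) -> V -> V;
  rK : V -> V;
  rD : V -> V }.

Definition is_rep (C : numClosedFieldType) (m n : nat) (V : lmodType C)
    (rho : hrep m n V) : Prop :=
  (forall r X (a : C) (w1 w2 : V),
      rpi rho r X (a *: w1 + w2) = a *: rpi rho r X w1 + rpi rho r X w2) /\
  (forall r X Y (a : C) (w : V), osp X -> osp Y ->
      rpi rho r (a *: X + Y) w = a *: rpi rho r X w + rpi rho r Y w) /\
  (forall (a : C) (w1 w2 : V), rK rho (a *: w1 + w2) = a *: rK rho w1 + rK rho w2) /\
  (forall (a : C) (w1 w2 : V), rD rho (a *: w1 + w2) = a *: rD rho w1 + rD rho w2) /\
  (forall (p q : bool) X Y (r s : int) (w : V),
      is_hom p X -> is_hom q Y -> osp X -> osp Y ->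
      rpi rho r X (rpi rho s Y w) - (-1) ^+ (p && q) *: rpi rho s Y (rpi rho r X w)
      = rpi rho (r + s) (sbr p q X Y) w
        + ((r%:~R * mform X Y) *+ (r + s == 0)) *: rK rho w) /\
  (forall r X (w : V), osp X -> rK rho (rpi rho r X w) = rpi rho r X (rK rho w)) /\
  (forall w : V, rK rho (rD rho w) = rD rho (rK rho w)) /\
  (forall r X (w : V), osp X ->
      rD rho (rpi rho r X w) - rpi rho r X (rD rho w) = r%:~R *: rpi rho r X w).

Definition submodule (C : numClosedFieldType) (m n : nat) (V : lmodType C)
    (rho : hrep m n V) (W : V -> Prop) : Prop :=
  W 0 /\ (forall u w, W u -> W w -> W (u + w)) /\ (forall (a : C) w, W w -> W (a *: w)) /\
  (forall r X w, osp X -> W w -> W (rpi rho r X w)) /\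
  (forall w, W w -> W (rK rho w)) /\ (forall w, W w -> W (rD rho w)).

Definition irreducible (C : numClosedFieldType) (m n : nat) (V : lmodType C)
    (rho : hrep m n V) : Prop :=
  (exists w : V, w <> 0) /\
  forall W : V -> Prop, submodule rho W -> (forall w, W w -> w = 0) \/ (forall w, W w).

Definition hwvec (C : numClosedFieldType) (m n : nat) (V : lmodType C)
    (rho : hrep m n V) (L : hw C m n) (v : V) : Prop :=
  v <> 0 /\
  (forall H, hmat H -> rpi rho 0 H v = lamH L H *: v) /\
  rK rho v = wc L (m + n) *: v /\
  rD rho v = wc L (m + n).+1 *: v /\
  (forall al X, posroot al -> rootspace al X -> rpi rho 0 X v = 0) /\
  (forall (r : int) X, (0 < r)%R -> osp X -> rpi rho r X v = 0).

Definition is_L (C : numClosedFieldType) (m n : nat) (V : lmodType C)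
    (rho : hrep m n V) (L : hw C m n) : Prop :=
  is_rep rho /\ irreducible rho /\ exists v, hwvec rho L v.

(* hat g_{beta + r delta} = g_beta t^r acts locally nilpotently *)
Definition locnil (C : numClosedFieldType) (m n : nat) (V : lmodType C)
    (rho : hrep m n V) (r : int) (be : hw C m n) : Prop :=
  forall X, rootspace be X -> forall w : V, exists N : nat, iter N (rpi rho r X) w = 0.

Definition integrable (C : numClosedFieldType) (m n : nat) (V : lmodType C)
    (rho : hrep m n V) : Prop :=
  (forall g : hw C m n, so0root g -> posroot g -> locnil rho 0 (- g)) /\
  (forall (al : hw C m n) (r : nat), so0root al -> (0 < r)%N ->
      locnil rho (- (r%:Z)) (- al)).

Definition L_integrable (C : numClosedFieldType) (m n : nat) (L : hw C m n) : Prop :=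
  forall (V : lmodType C) (rho : hrep m n V), is_L rho L -> integrable rho.

Definition betaP (C : numClosedFieldType) (m n : nat) (primed : bool) (i : nat)
  : hw C m n :=
  if primed && (i == 1)%N then dltw C m n 1 + epsw C m n 1
  else dltw C m n i - epsw C m n i.

Definition orthoT (C : numClosedFieldType) (m n : nat) (primed : bool)
    (L : hw C m n) : Prop :=
  forall i : nat, (1 <= i <= n)%N -> wform L (betaP C m n primed i) = 0.

Definition isIntC (C : numClosedFieldType) (x : C) : Prop :=
  exists z : int, x = z%:~R.

Definition int_form (C : numClosedFieldType) (m n : nat) (primed : bool) (k : C)
    (L : hw C m n) : Prop :=
  exists (c : C) (kk : nat -> C),
    L = k *: L0w C m n
        - \sum_(1 <= i < n.+1) kk i *: betaP C m n primed i
        + \sum_(n.+1 <= i < m.+1) kk i *: epsw C m n i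
        + c *: deltaw C m n
    /\ isIntC k /\ 0 < k
    /\ (exists z : int, kk 1%N = z%:~R / 2)
    /\ (forall i : nat, (2 <= i <= m)%N -> isIntC (kk i - kk 1%N))
    /\ (forall i : nat, (2 <= i < m)%N -> kk i <= kk i.+1)
    /\ `|kk 1%N| <= kk 2%N
    /\ kk m + kk m.-1 <= k
    /\ (kk 2%N = - kk 1%N -> kk 1%N = 0 /\ kk 2%N = 0).

(* Main.v *)
(* Integrability of L(Lambda) only has to be tested on the simple roots of the
   affine algebra of so(2m).  Such a root gamma either is simple for the given
   base of the affine superalgebra, or becomes simple after one odd reflection:
   in delta_i - eps_i for gamma = eps_(i+1) - eps_i with i <= n, and in
   delta_1 + eps_1 for gamma = eps_2 + eps_1.  An odd reflection in beta keeps the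
   highest weight if (Lambda|beta) = 0 and shifts it by -beta otherwise.  All the
   odd roots involved are orthogonal to Lambda, except the one among
   delta_1 -+ eps_1 that is not in T (resp. T') when k_1 <> 0; there the shift
   replaces k_2 + k_1 >= 0 by k_2 + k_1 >= 1.  If f_gamma acts nilpotently on the
   highest weight vector obtained in this way, it acts locally nilpotently, and
   the set of weights is stable under the reflection in gamma.  It is then stable
   under the reflections in all real roots of the affine so(2m); as the heights of
   the weights are bounded above, all negative root vectors act locally nilpotently.

   The module L(Lambda), needed to read the conditions off integrability, is
   constructed without a PBW theorem.  The vacuum expectation of a word in the
   affine superalgebra is defined by recursion on its length: a first letter
   a = a_+ + a_0 + a_- contributes Lambda(a_0) times the value of the rest, plus the
   (signed) sum of the values of the words in which a letter b of the rest is
   replaced by [a_+, b].  This functional respects the brackets, and L(Lambda) is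
   the span of its right translates. *)
From HB Require Import structures.
From mathcomp Require Import boolp functions.
From mathcomp Require Import all_boot all_order all_algebra.
Require Import Defs.
From mathcomp Require Import ring zify.
Set Implicit Arguments. Unset Strict Implicit. Unset Printing Implicit Defensive.
Import Order.TTheory GRing.Theory Num.Theory.
Local Open Scope ring_scope.

(** * The Lie superalgebra osp(2m|2n) *)

(** [L_integrable] quantifies over all models of L(Lambda) and would hold vacuously if there were
    none; this is why one direction needs an explicit model. The danger in such a construction is
    that the highest weight vector collapses to zero; here the vacuum expectation takes the value 1
    at the empty word. Irreducibility is then within reach: a nonzero functional is nonzero at some
    word, and the letters of that word carry it to a vector with nonzero vacuum component.

    Bases are not handled as sets of roots. An odd integer is attached to each basis vector of the
    natural module, the height of a root is a difference of two of them plus a multiple of the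
    height of delta, and an odd reflection exchanges two adjacent integers. Root combinatorics thus
    becomes integer arithmetic.

    Products of factors [height_op - c] annihilate what lies strictly below a singular vector; this
    suffices both to bound the heights of weights and to project onto the highest weight vector. *)

Section Index.
Variables (m n : nat).
Local Notation I := 'I_(Nd m n).

Variant idx_spec : I -> Type :=
| IdxEp i : idx_spec (ep n i)
| IdxEm i : idx_spec (em n i)
| IdxFp j : idx_spec (fp m j)
| IdxFm j : idx_spec (fm m j).

Lemma idxP (a : I) : idx_spec a.
Proof.
rewrite -[a](@splitK (m + m) (n + n)); case: (@split (m + m) (n + n) a) => x.
  by rewrite -[x]splitK; case: (split x) => i /=; [exact: IdxEp|exact: IdxEm].
rewrite -[x]splitK; case: (split x) => i /=; [exact: IdxFp|exact: IdxFm].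
Qed.

Definition idx_rect_def T (u v : 'I_m -> T) (x y : 'I_n -> T) (a : I) : T :=
  match @split (m + m) (n + n) a with
  | inl b => match split b with inl i => u i | inr i => v i end
  | inr b => match split b with inl j => x j | inr j => y j end
  end.

Lemma idx_ep T u v x y i : @idx_rect_def T u v x y (ep n i) = u i.
Proof. by rewrite /idx_rect_def /ep !(unsplitK (inl _)). Qed.
Lemma idx_em T u v x y i : @idx_rect_def T u v x y (em n i) = v i.
Proof. by rewrite /idx_rect_def /em (unsplitK (inl _)) (unsplitK (inr _)). Qed.
Lemma idx_fp T u v x y i : @idx_rect_def T u v x y (fp m i) = x i.
Proof. by rewrite /idx_rect_def /fp (unsplitK (inr _)) (unsplitK (inl _)). Qed.
Lemma idx_fm T u v x y i : @idx_rect_def T u v x y (fm m i) = y i.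
Proof. by rewrite /idx_rect_def /fm !(unsplitK (inr _)). Qed.
Definition idxE := (idx_ep, idx_em, idx_fp, idx_fm).

Definition dual : I -> I := idx_rect_def (@em m n) (@ep m n) (@fm m n) (@fp m n).

Lemma dualK : involutive dual.
Proof. by move=> a; case: (idxP a) => i; rewrite /dual !idxE. Qed.
Lemma dual_inj : injective dual. Proof. exact: can_inj dualK. Qed.

Lemma par_ep i : par (ep n i : I) = false.
Proof. by rewrite /par /= leqNgt ltn_addr. Qed.
Lemma par_em i : par (em n i : I) = false.
Proof. by rewrite /par /= leqNgt ltn_add2l ltn_ord. Qed.
Lemma par_fp i : par (fp m i : I) = true.
Proof. by rewrite /par /= leq_addr. Qed.
Lemma par_fm i : par (fm m i : I) = true.
Proof. by rewrite /par /= leq_addr. Qed.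
Definition parE := (par_ep, par_em, par_fp, par_fm).

Lemma par_dual a : par (dual a) = par a.
Proof. by case: (idxP a) => i; rewrite /dual idxE !parE. Qed.

(* [isfp a] says that [a] is some [f_j]: the only indices with B(e_(dual a), e_a) = -1. *)
Definition isfp : I -> bool := idx_rect_def xpred0 xpred0 xpredT xpred0.

Lemma isfp_dual a : isfp (dual a) = par a (+) isfp a.
Proof. by case: (idxP a) => i; rewrite /isfp /dual !idxE parE. Qed.

Lemma ep_inj : injective (@ep m n). Proof. by move=> i j [/val_inj]. Qed.
Lemma em_inj : injective (@em m n).
Proof. by move=> i j /lshift_inj /rshift_inj. Qed.
Lemma fp_inj : injective (@fp m n).
Proof. by move=> i j /rshift_inj /lshift_inj. Qed.
Lemma fm_inj : injective (@fm m n).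
Proof. by move=> i j /rshift_inj /rshift_inj. Qed.

Lemma ep_em i j : (ep n i == em n j :> I) = false.
Proof. by apply/eqP => /(congr1 (idx_rect_def xpredT xpred0 xpred0 xpred0)); rewrite !idxE. Qed.
Lemma ep_fp i j : (ep n i == fp m j :> I) = false.
Proof. by apply/eqP => /(congr1 (idx_rect_def xpredT xpred0 xpred0 xpred0)); rewrite !idxE. Qed.
Lemma ep_fm i j : (ep n i == fm m j :> I) = false.
Proof. by apply/eqP => /(congr1 (idx_rect_def xpredT xpred0 xpred0 xpred0)); rewrite !idxE. Qed.
Lemma em_fp i j : (em n i == fp m j :> I) = false.
Proof. by apply/eqP => /(congr1 (idx_rect_def xpred0 xpredT xpred0 xpred0)); rewrite !idxE. Qed.
Lemma em_fm i j : (em n i == fm m j :> I) = false.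
Proof. by apply/eqP => /(congr1 (idx_rect_def xpred0 xpredT xpred0 xpred0)); rewrite !idxE. Qed.
Lemma fp_fm i j : (fp m i == fm m j :> I) = false.
Proof. by apply/eqP => /(congr1 (idx_rect_def xpred0 xpred0 xpredT xpred0)); rewrite !idxE. Qed.
Definition idx_neq := (ep_em, ep_fp, ep_fm, em_fp, em_fm, fp_fm).

Lemma dual_neq a : (dual a == a) = false.
Proof.
by case: (idxP a) => i; rewrite /dual idxE ?idx_neq // eq_sym idx_neq.
Qed.

End Index.

Section Matrices.
Variables (C : numClosedFieldType) (m n : nat).
Local Notation I := 'I_(Nd m n).
Local Notation Mat := 'M[C]_(Nd m n).

Definition J_sgn (a : I) : C := (-1) ^+ isfp (dual a).

Lemma JformE (a b : I) : Jform C m n a b = if b == dual a then J_sgn a else 0.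
Proof.
rewrite mxE /J_sgn /isfp; case: (idxP a) => i; rewrite /dual !idxE.
- have -> : [exists j, (ep n i == ep n j :> I) && (b == em n j)] = (b == em n i).
    by apply/existsP/idP => [[j /andP[/eqP /ep_inj -> //]]|h]; exists i; rewrite eqxx.
  case: eqP => //= _; case: existsP => [[j]|_]; first by rewrite idx_neq.
  case: existsP => [[j]|_]; first by rewrite idx_neq.
  by case: existsP => [[j]|_] //; rewrite idx_neq.
- case: existsP => [[j]|_] /=; first by rewrite eq_sym idx_neq.
  have -> : [exists j, (em n i == em n j :> I) && (b == ep n j)] = (b == ep n i).
    by apply/existsP/idP => [[j /andP[/eqP /em_inj -> //]]|h]; exists i; rewrite eqxx.
  case: eqP => //= _; case: existsP => [[j]|_]; first by rewrite idx_neq.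
  by case: existsP => [[j]|_] //; rewrite idx_neq.
- case: existsP => [[j]|_] /=; first by rewrite eq_sym idx_neq.
  case: existsP => [[j]|_] /=; first by rewrite eq_sym idx_neq.
  have -> : [exists j, (fp m i == fp m j :> I) && (b == fm m j)] = (b == fm m i).
    by apply/existsP/idP => [[j /andP[/eqP /fp_inj -> //]]|h]; exists i; rewrite eqxx.
  case: eqP => //= _.
  by case: existsP => [[j]|_] //; rewrite idx_neq.
- case: existsP => [[j]|_] /=; first by rewrite eq_sym idx_neq.
  case: existsP => [[j]|_] /=; first by rewrite eq_sym idx_neq.
  case: existsP => [[j]|_] /=; first by rewrite eq_sym idx_neq.
  have -> : [exists j, (fm m i == fm m j :> I) && (b == fp m j)] = (b == fp m i).
    by apply/existsP/idP => [[j /andP[/eqP /fm_inj -> //]]|h]; exists i; rewrite eqxx.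
  by case: eqP.
Qed.

Lemma J_sgn2 a : J_sgn a * J_sgn a = 1.
Proof. by rewrite -signr_addb addbb. Qed.

Lemma sum_J1 (X : Mat) a b : \sum_c X c a * Jform C m n c b = J_sgn (dual b) * X (dual b) a.
Proof.
rewrite (bigD1 (dual b)) //= big1 ?addr0; last first.
  move=> c nc; rewrite JformE; case: eqP => [e|_]; last by rewrite mulr0.
  by rewrite e dualK eqxx in nc.
by rewrite JformE dualK eqxx mulrC.
Qed.

Lemma sum_J2 (X : Mat) a b : \sum_c Jform C m n a c * X c b = J_sgn a * X (dual a) b.
Proof.
rewrite (bigD1 (dual a)) //= big1 ?addr0; last first.
  by move=> c /negPf nc; rewrite JformE nc mul0r.
by rewrite JformE eqxx.
Qed.

(** The first two summands are the exponent [p && par a] of the osp condition for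
    [p = par a (+) par b]; the last two come from the Gram matrix. *)
Definition dsignb (a b : I) : bool := par a (+) (par a && par b) (+) isfp a (+) isfp b.
Definition dsign (a b : I) : C := (-1) ^+ dsignb a b.

Lemma dsign2 a b : dsign a b * dsign a b = 1.
Proof. by rewrite -signr_addb addbb. Qed.

Lemma dsign_dual a b : dsign (dual b) (dual a) = dsign a b.
Proof.
rewrite /dsign /dsignb !par_dual !isfp_dual; congr (_ ^+ nat_of_bool _).
by case: (par a) (par b) (isfp a) (isfp b) => [] [] [] [].
Qed.

Definition osym (X : Mat) := forall a b, X a b = - dsign a b * X (dual b) (dual a).

Lemma osp_homP p (X : Mat) : is_hom p X -> osp_hom p X <-> osym X.
Proof.
move=> hX.
have E a b : (par a (+) par b) = p ->
    (-1) ^+ (p && par a) * (J_sgn (dual a) * J_sgn (dual b)) = dsign a b.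
  move=> <-; rewrite /J_sgn !dualK -!signr_addb /dsign /dsignb.
  by congr (_ ^+ nat_of_bool _); case: (par a) (par b) (isfp a) (isfp b) => [] [] [] [].
have s1 (q : bool) : (-1) ^+ q * (-1) ^+ q = 1 :> C by rewrite -signr_addb addbb.
split=> H a b.
  have [hp|hp] := eqVneq (par a (+) par b) p; last first.
    by rewrite !hX ?mulr0 // !par_dual addbC.
  have := H (dual a) b; rewrite sum_J1 sum_J2 dualK par_dual -(E _ _ hp) => {}E.
  set t := _ ^+ _ in E *.
  rewrite -[LHS]mul1r -(s1 (p && par a)) -/t -[_ * X a b]mulr1 -(J_sgn2 (dual a)).
  have -> : t * t * X a b * (J_sgn (dual a) * J_sgn (dual a)) =
     t * J_sgn (dual a) * (t * (J_sgn (dual a) * X a b)) by ring.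
  move/eqP: E; rewrite addrC addr_eq0 => /eqP ->; ring.
rewrite sum_J1 sum_J2.
have [hp|hp] := eqVneq (par a (+) par b) p; last first.
  by rewrite !hX ?mulr0 ?addr0 // ?par_dual // addbC.
rewrite (H (dual a)) dualK -(E (dual a) b) ?par_dual // dualK.
have := s1 (p && par a); have := J_sgn2 a; have := J_sgn2 (dual b) => e1 e2 e3.
ring: e1 e2 e3.
Qed.

Lemma even_hom (X : Mat) : is_hom false (even_part X).
Proof. by move=> a b; rewrite mxE; case: (par a) (par b) => [] []. Qed.
Lemma odd_hom (X : Mat) : is_hom true (odd_part X).
Proof. by move=> a b; rewrite mxE; case: (par a) (par b) => [] []. Qed.

Lemma ospP (X : Mat) : osp X <-> osym X.
Proof.
rewrite /osp (osp_homP (even_hom X)) (osp_homP (odd_hom X)); split.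
  case=> H1 H2 a b; have := H1 a b; have := H2 a b; rewrite !mxE !par_dual.
  by rewrite [par b == _]eq_sym; case: eqP.
move=> H; split=> a b; rewrite !mxE !par_dual [par b == _]eq_sym; case: eqP => _ //.
  by rewrite mulr0.
by rewrite mulr0.
Qed.

(* Up to a factor these are the projections of the elementary matrices to osp, so
   they span it; [rootmx a a] is in the Cartan subalgebra and [rootmx a b] with
   [a != b] is 0 or a root vector of weight [idx_wt a - idx_wt b]. *)
Definition rootmx (a b : I) : Mat := delta_mx a b - dsign a b *: delta_mx (dual b) (dual a).

Lemma rootmxE a b c d : rootmx a b c d = ((c == a) && (d == b))%:R - dsign a b * ((c == dual b) && (d == dual a))%:R.
Proof. by rewrite !mxE. Qed.

Lemma rootmx_dual a b : rootmx (dual b) (dual a) = - dsign a b *: rootmx a b.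
Proof.
rewrite /rootmx !dualK dsign_dual scalerBr scalerA mulNr dsign2 scaleN1r opprK scaleNr addrC.
by [].
Qed.

Lemma rootmx_osym a b : osym (rootmx a b).
Proof.
move=> c d; rewrite !rootmxE !(inj_eq (@dual_inj m n)) !(inv_eq (@dualK m n)).
rewrite [(d == b) && _]andbC [(d == dual a) && _]andbC.
set P := (c == a) && _; set Q := (c == dual b) && _.
have eP : P -> dsign c d = dsign a b by case/andP => /eqP -> /eqP ->.
have eQ : Q -> dsign c d = dsign a b by case/andP => /eqP -> /eqP ->; rewrite dsign_dual.
have z2 := dsign2 a b.
case: P eP => eP; [rewrite (eP isT)|case: Q eQ => eQ; first rewrite (eQ isT)]; rewrite /=; ring: z2.
Qed.

Lemma rootmx_osp a b : osp (rootmx a b). Proof. exact/ospP/rootmx_osym. Qed.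

Lemma rootmx_hom a b : is_hom (par a (+) par b) (rootmx a b).
Proof.
move=> c d; rewrite rootmxE; case: andP => [[/eqP -> /eqP ->]|_]; first by rewrite eqxx.
case: andP => [[/eqP -> /eqP ->]|_]; last by rewrite mulr0 subr0.
by rewrite !par_dual addbC eqxx.
Qed.

(** A matrix in osp is the mean of itself and its image under the involution that defines osp. Each
    root vector therefore occurs twice in the sum, at [(a, b)] and at [(dual b, dual a)], whence the
    1/2. *)
Lemma osp_expand (X : Mat) : osp X -> X = \sum_a \sum_b (X a b / 2) *: rootmx a b.
Proof.
move=> /ospP oX; have two : (2 : C) != 0 by rewrite pnatr_eq0.
apply/matrixP => c d; rewrite summxE.
under eq_bigr => a _.
  rewrite summxE; under eq_bigr => b _ do rewrite mxE rootmxE mulrBr.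
  rewrite sumrB; over.
rewrite sumrB /=.
rewrite (bigD1 c) //= [X in _ + X - _]big1 ?addr0; last first.
  by move=> a na; rewrite big1 // => b _; rewrite eq_sym (negPf na) mulr0.
rewrite (bigD1 d) //= big1 ?addr0; last first.
  by move=> b nb; rewrite [d == b]eq_sym (negPf nb) andbF mulr0.
rewrite (bigD1 (dual d)) //= [X in _ - (_ + X)]big1 ?addr0; last first.
  move=> a na; rewrite big1 // => b _.
  by rewrite -[d == _](inv_eq (@dualK m n)) [dual d == _]eq_sym (negPf na) andbF !mulr0.
rewrite (bigD1 (dual c)) //= big1 ?addr0; last first.
  move=> b nb.
  by rewrite -[c == _](inv_eq (@dualK m n)) [dual c == _]eq_sym (negPf nb) !mulr0.
rewrite !dualK !eqxx /= !mulr1 (oX (dual d)) !dualK dsign_dual.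
have z2 := dsign2 c d.
rewrite -[LHS](mulfK two) mulrC.
have -> : - dsign c d * X c d / 2 * dsign c d = - X c d / 2 by ring: z2.
by field.
Qed.

Lemma osp_lin (c : C) (X Y : Mat) : osp X -> osp Y -> osp (c *: X + Y).
Proof. by move=> /ospP oX /ospP oY; apply/ospP => a b; rewrite !mxE oX oY; ring. Qed.

Lemma osp0 : osp (0 : Mat). Proof. by apply/ospP => a b; rewrite !mxE mulr0. Qed.

Lemma osp_sum (T : Type) (s : seq T) (f : T -> Mat) :
  (forall t, osp (f t)) -> osp (\sum_(t <- s) f t).
Proof.
move=> H; elim: s => [|t s IH]; first by rewrite big_nil; apply: osp0.
by rewrite big_cons -[f t]scale1r; apply: osp_lin.
Qed.

Lemma osp_sbr p q (X Y : Mat) : is_hom p X -> is_hom q Y -> osp X -> osp Y ->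
  osp (sbr p q X Y).
Proof.
move=> hX hY /ospP oX /ospP oY; apply/ospP => a b; rewrite !mxE.
(* The involution reverses products up to the super sign, and the minus signs of the two factors
   cancel. *)
have E p' q' (X' Y' : Mat) : is_hom p' X' -> is_hom q' Y' -> osym X' -> osym Y' ->
   \sum_c X' a c * Y' c b = dsign a b * (-1) ^+ (p' && q') * \sum_c Y' (dual b) c * X' c (dual a).
  move=> hX' hY' oX' oY'; rewrite [in RHS](reindex_inj (@dual_inj m n)) mulr_sumr.
  apply: eq_bigr => c _.
  have [e1|ne] := eqVneq (par a (+) par c) p'; last first.
    by rewrite [X' a c]hX' // [X' (dual c) _]hX' ?(mulr0, mul0r) ?par_dual // 1?addbC.
  have [e2|ne] := eqVneq (par c (+) par b) q'; last first.
    by rewrite [Y' c b]hY' // [Y' _ (dual c)]hY' ?(mulr0, mul0r) ?par_dual // 1?addbC.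
  rewrite (oX' a) (oY' c).
  have -> : - dsign a c * X' (dual c) (dual a) * (- dsign c b * Y' (dual b) (dual c)) =
    dsign a c * dsign c b * (Y' (dual b) (dual c) * X' (dual c) (dual a)) by ring.
  congr (_ * _); rewrite -e1 -e2 /dsign -!signr_addb /dsignb; congr (_ ^+ nat_of_bool _).
  by case: (par a) (par b) (par c) (isfp a) (isfp b) (isfp c) => [] [] [] [] [] [].
rewrite (E p q) // (E q p) //.
have s2 : (-1) ^+ (p && q) * (-1) ^+ (p && q) = 1 :> C by rewrite -signr_addb addbb.
rewrite [q && p]andbC; ring: s2.
Qed.

Lemma sbr_hom p q (X Y : Mat) : is_hom p X -> is_hom q Y -> is_hom (p (+) q) (sbr p q X Y).
Proof.
move=> hX hY a b ne; rewrite !mxE !big1 ?mulr0 ?subr0 // => c _.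
  have [e|n1] := eqVneq (par a (+) par c) q; last by rewrite hY // mul0r.
  rewrite [X c b]hX ?mulr0 //; apply: contra ne => /eqP <-; rewrite -e.
  by case: (par a) (par b) (par c) => [] [] [].
have [e|n1] := eqVneq (par a (+) par c) p; last by rewrite hX // mul0r.
rewrite [Y c b]hY ?mulr0 //; apply: contra ne => /eqP <-; rewrite -e.
by case: (par a) (par b) (par c) => [] [] [].
Qed.

Lemma sbr_jacobi p q r (X Y Z : Mat) :
  sbr p (q (+) r) X (sbr q r Y Z) =
  sbr (p (+) q) r (sbr p q X Y) Z + (-1) ^+ (p && q) *: sbr q (p (+) r) Y (sbr p r X Z).
Proof.
rewrite /sbr andb_addl !andb_addr !signr_addb ?[q && p]andbC ?[r && _]andbC.
have s2 : (-1) ^+ (p && q) * (-1) ^+ (p && q) = 1 :> C by rewrite -signr_addb addbb.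
rewrite !(mulmxBl, mulmxBr) -!(scalemxAl, scalemxAr) !mulmxA.
apply/matrixP => a b; rewrite ![in LHS]mxE ![in RHS]mxE.
ring: s2.
Qed.

Lemma sbr_linl p q c (X Y Z : Mat) : sbr p q (c *: X + Y) Z = c *: sbr p q X Z + sbr p q Y Z.
Proof.
rewrite /sbr mulmxDl mulmxDr -scalemxAl -scalemxAr.
by apply/matrixP => a b; rewrite ![in LHS]mxE ![in RHS]mxE; ring.
Qed.
Lemma sbr_linr p q c (X Y Z : Mat) : sbr p q Z (c *: X + Y) = c *: sbr p q Z X + sbr p q Z Y.
Proof.
rewrite /sbr mulmxDl mulmxDr -scalemxAl -scalemxAr.
by apply/matrixP => a b; rewrite ![in LHS]mxE ![in RHS]mxE; ring.
Qed.
Lemma sbrC p q (X Y : Mat) : sbr p q X Y = - (-1) ^+ (p && q) *: sbr q p Y X.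
Proof.
have s2 : (-1) ^+ (p && q) * (-1) ^+ (p && q) = 1 :> C by rewrite -signr_addb addbb.
rewrite /sbr [q && p]andbC.
by apply/matrixP => a b; rewrite ![in LHS]mxE ![in RHS]mxE; ring: s2.
Qed.

Definition str (X : Mat) : C := \sum_a (-1) ^+ par a * X a a.

Lemma mformE (X Y : Mat) : mform X Y = 2^-1 * str (X *m Y).
Proof.
rewrite /mform /str; congr (_ * _); rewrite [in RHS](bigID (fun a => par a)) /= addrC.
congr (_ + _); last first.
  by rewrite -sumrN; apply: eq_bigr => a ->; rewrite expr1 mulN1r.
by apply: eq_bigr => a /negPf ->; rewrite expr0 mul1r.
Qed.

Lemma strC p q (X Y : Mat) : is_hom p X -> is_hom q Y ->
  str (X *m Y) = (-1) ^+ (p && q) * str (Y *m X).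
Proof.
move=> hX hY; rewrite /str.
under eq_bigr => a _ do rewrite mxE mulr_sumr.
rewrite exchange_big mulr_sumr; apply: eq_bigr => b _; rewrite mxE !mulr_sumr.
apply: eq_bigr => a _.
have [e1|ne] := eqVneq (par a (+) par b) p; last by rewrite [X a b]hX // !(mulr0, mul0r).
have [e2|ne] := eqVneq (par b (+) par a) q; last by rewrite [Y b a]hY // !(mulr0, mul0r).
rewrite -e1 -e2.
by case: (par a) (par b) => [] [] /=; ring.
Qed.

Lemma str_lin c (X Y : Mat) : str (c *: X + Y) = c * str X + str Y.
Proof.
rewrite /str mulr_sumr -big_split; apply: eq_bigr => a _; rewrite !mxE /=; ring.
Qed.

Lemma mformC p q (X Y : Mat) : is_hom p X -> is_hom q Y ->
  mform X Y = (-1) ^+ (p && q) * mform Y X.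
Proof. by move=> hX hY; rewrite !mformE (strC hX hY); ring. Qed.

Lemma mulmx_hom p q (X Y : Mat) : is_hom p X -> is_hom q Y -> is_hom (p (+) q) (X *m Y).
Proof.
move=> hX hY a b ne; rewrite !mxE !big1 // => c _.
have [e|n1] := eqVneq (par a (+) par c) p; last by rewrite hX // mul0r.
rewrite [Y c b]hY ?mulr0 //; apply: contra ne => /eqP <-; rewrite -e.
by case: (par a) (par b) (par c) => [] [] [].
Qed.

(** The product [X Y Z] is common to both sides; the remaining terms agree by cyclicity of the
    supertrace. *)
Lemma mform_inv p q r (X Y Z : Mat) : is_hom p X -> is_hom q Y -> is_hom r Z ->
  mform X (sbr q r Y Z) = mform (sbr p q X Y) Z.
Proof.
move=> hX hY hZ; rewrite !mformE /sbr mulmxBr mulmxBl -scalemxAr -scalemxAl !mulmxA.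
congr (_ * _).
rewrite -!scaleNr ![_ + _ *: _]addrC !str_lin; congr (_ + _); rewrite !mulNr; congr (- _).
rewrite (strC (mulmx_hom hX hZ) hY) mulmxA mulrA; congr (_ * _).
by rewrite -signr_addb; congr (_ ^+ nat_of_bool _); case: p q r {hX hY hZ} => [] [] [].
Qed.

Lemma mform_linl c (X Y Z : Mat) : mform (c *: X + Y) Z = c * mform X Z + mform Y Z.
Proof. by rewrite !mformE mulmxDl -scalemxAl str_lin; ring. Qed.
Lemma mform_linr c (X Y Z : Mat) : mform Z (c *: X + Y) = c * mform Z X + mform Z Y.
Proof. by rewrite !mformE mulmxDr -scalemxAr str_lin; ring. Qed.

Lemma mform_odd p q (X Y : Mat) : is_hom p X -> is_hom q Y -> p (+) q -> mform X Y = 0.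
Proof.
move=> hX hY pq; rewrite mformE /str big1 ?mulr0 // => a _.
by rewrite (mulmx_hom hX hY) ?mulr0 // pq addbb.
Qed.
End Matrices.

(** * Weights *)

Section Weights.
Variables (C : numClosedFieldType) (m n : nat).
Local Notation I := 'I_(Nd m n).
Local Notation Mat := 'M[C]_(Nd m n).
Local Notation hw := (hw C m n).

Lemma wc_lin c (mu nu : hw) k : wc (c *: mu + nu) k = c * wc mu k + wc nu k.
Proof. by rewrite /wc !mxE. Qed.
Lemma wcD (mu nu : hw) k : wc (mu + nu) k = wc mu k + wc nu k.
Proof. by rewrite /wc !mxE. Qed.
Lemma wcN (mu : hw) k : wc (- mu) k = - wc mu k.
Proof. by rewrite /wc !mxE. Qed.
Lemma wcB (mu nu : hw) k : wc (mu - nu) k = wc mu k - wc nu k.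
Proof. by rewrite wcD wcN. Qed.
Lemma wcZ c (mu : hw) k : wc (c *: mu) k = c * wc mu k.
Proof. by rewrite /wc !mxE. Qed.
Lemma wc0 k : wc (0 : hw) k = 0.
Proof. by rewrite /wc mxE. Qed.

Lemma wc_ext (mu nu : hw) : (forall k, (k < (m + n).+2)%N -> wc mu k = wc nu k) -> mu = nu.
Proof.
move=> H; apply/rowP => x; have := H x (ltn_ord x).
by rewrite /wc inord_val.
Qed.

Lemma wc_eps i k : (i < m)%N -> (k < (m + n).+2)%N -> wc (epsw C m n i.+1) k = (k == i)%:R.
Proof. by move=> im kn; rewrite /wc mxE inordK //= im /=; case: eqP. Qed.
Lemma wc_dlt j k : (j < n)%N -> (k < (m + n).+2)%N -> wc (dltw C m n j.+1) k = (k == m + j)%N%:R.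
Proof. by move=> im kn; rewrite /wc mxE inordK //= im /=; case: eqP. Qed.
Lemma wc_L0 k : (k < (m + n).+2)%N -> wc (L0w C m n) k = (k == m + n)%N%:R.
Proof. by move=> kn; rewrite /wc mxE inordK //=; case: eqP. Qed.
Lemma wc_del k : (k < (m + n).+2)%N -> wc (deltaw C m n) k = (k == (m + n).+1)%N%:R.
Proof. by move=> kn; rewrite /wc mxE inordK //=; case: eqP. Qed.

(* The weight of the basis vector [a] in the natural representation, and the
   coordinate of [mu] along it. *)
Definition idx_wt : I -> hw :=
  idx_rect_def (fun i : 'I_m => epsw C m n i.+1) (fun i : 'I_m => - epsw C m n i.+1)
               (fun j : 'I_n => dltw C m n j.+1) (fun j : 'I_n => - dltw C m n j.+1).

Definition idx_coord (mu : hw) : I -> C :=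
  idx_rect_def (fun i : 'I_m => wc mu i) (fun i : 'I_m => - wc mu i)
               (fun j : 'I_n => wc mu (m + j)) (fun j : 'I_n => - wc mu (m + j)).

Lemma idx_wt_dual a : idx_wt (dual a) = - idx_wt a.
Proof. by case: (idxP a) => i; rewrite /dual /idx_wt !idxE ?opprK. Qed.
Lemma idx_coord_dual mu a : idx_coord mu (dual a) = - idx_coord mu a.
Proof. by case: (idxP a) => i; rewrite /dual /idx_coord !idxE ?opprK. Qed.

Lemma idx_coord_lin c mu nu a : idx_coord (c *: mu + nu) a = c * idx_coord mu a + idx_coord nu a.
Proof. by case: (idxP a) => i; rewrite /idx_coord !idxE wc_lin; ring. Qed.

Lemma idx_wt_lev a : wc (idx_wt a) (m + n) = 0.
Proof.
have kn : ((m + n) < (m + n).+2)%N by [].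
case: (idxP a) => i; rewrite /idx_wt !idxE ?wcN ?wc_eps ?wc_dlt //; have := ltn_ord i => ?;
  by rewrite (_ : (_ == _) = false) ?oppr0 //; lia.
Qed.
Lemma idx_wt_del a : wc (idx_wt a) (m + n).+1 = 0.
Proof.
have kn : ((m + n).+1 < (m + n).+2)%N by [].
case: (idxP a) => i; rewrite /idx_wt !idxE ?wcN ?wc_eps ?wc_dlt //; have := ltn_ord i => ?;
  by rewrite (_ : (_ == _) = false) ?oppr0 //; lia.
Qed.

Lemma lamH_lin c (mu nu : hw) (H : Mat) : lamH (c *: mu + nu) H = c * lamH mu H + lamH nu H.
Proof.
rewrite /lamH mulrDr !mulr_sumr addrACA -!big_split; congr (_ + _).
  by apply: eq_bigr => i _; rewrite wc_lin /=; ring.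
by apply: eq_bigr => i _; rewrite wc_lin /=; ring.
Qed.

Lemma lamH_linr c (mu : hw) (H K : Mat) : lamH mu (c *: H + K) = c * lamH mu H + lamH mu K.
Proof.
rewrite /lamH mulrDr !mulr_sumr addrACA -!big_split; congr (_ + _).
  by apply: eq_bigr => i _; rewrite !mxE /=; ring.
by apply: eq_bigr => i _; rewrite !mxE /=; ring.
Qed.

Lemma sum_pick (k : nat) (i : 'I_k) (f : 'I_k -> C) : \sum_j f j * (j == i)%:R = f i.
Proof.
rewrite (bigD1 i) //= eqxx mulr1 big1 ?addr0 // => j /negPf ->; by rewrite mulr0.
Qed.
Lemma sum_pickl (k : nat) (i : 'I_k) (f : 'I_k -> C) : \sum_j (j == i)%:R * f j = f i.
Proof. by rewrite -(sum_pick i f); apply: eq_bigr => j _; rewrite mulrC. Qed.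

Lemma hmat_dual (H : Mat) a : hmat H -> H (dual a) (dual a) = - H a a.
Proof.
case=> /ospP oH _; rewrite [H a a]oH /dsign /dsignb.
by case: (par a) (isfp a) => [] [] /=; rewrite ?expr1 ?expr0; ring.
Qed.

Lemma lamH_idx_wt (H : Mat) a : hmat H -> lamH (idx_wt a) H = H a a.
Proof.
move=> hH; rewrite /lamH.
have E (i : 'I_m) : lamH (epsw C m n i.+1) H = H (ep n i) (ep n i).
  rewrite /lamH [X in _ + X]big1 ?addr0; last first.
    move=> j _; rewrite wc_eps //; last by have := ltn_ord j; lia.
    by case: eqP => [e|]; [have := ltn_ord i; lia | rewrite mul0r].
  rewrite -[RHS](sum_pickl i (fun j => H (ep n j) (ep n j))); apply: eq_bigr => j _.
  by rewrite wc_eps //; have := ltn_ord j; lia.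
have G (i : 'I_n) : lamH (dltw C m n i.+1) H = H (fp m i) (fp m i).
  rewrite /lamH [X in X + _]big1 ?add0r; last first.
    move=> j _; rewrite wc_dlt //; last by have := ltn_ord j; lia.
    by case: eqP => [e|]; [have := ltn_ord j; lia | rewrite mul0r].
  rewrite -[RHS](sum_pickl i (fun j => H (fp m j) (fp m j))); apply: eq_bigr => j _.
  by rewrite wc_dlt ?eqn_add2l //; have := ltn_ord j; lia.
have N mu : lamH (- mu) H = - lamH mu H.
  have := lamH_lin (-1) mu 0 H; rewrite scaleN1r addr0 => ->.
  have := lamH_lin (-1) 0 0 H; rewrite scaler0 addr0 => e.
  by rewrite mulN1r; move/eqP: e; rewrite mulN1r addNr => /eqP ->; rewrite addr0.
rewrite -/(lamH (idx_wt a) H); case: (idxP a) => i; rewrite /idx_wt !idxE ?N ?E ?G //.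
  by rewrite -(hmat_dual _ hH) /dual !idxE.
by rewrite -(hmat_dual _ hH) /dual !idxE.
Qed.

Lemma dsign_diag a : dsign C (a : I) a = 1.
Proof. by rewrite /dsign /dsignb; case: (par a) (isfp a) => [] []. Qed.

Lemma lamH_rootmx (mu : hw) a : lamH mu (rootmx C (a : I) a) = idx_coord mu a.
Proof.
rewrite /lamH.
under eq_bigr => i _ do rewrite rootmxE !andbb dsign_diag mul1r.
under [X in _ + X]eq_bigr => i _ do rewrite rootmxE !andbb dsign_diag mul1r.
case: (idxP a) => i; rewrite /idx_coord /dual !idxE.
- under eq_bigr => j _ do rewrite (inj_eq (@ep_inj m n)) idx_neq subr0.
  under [X in _ + X]eq_bigr => j _ do rewrite ![fp m j == _]eq_sym !idx_neq subr0 mulr0.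
  by rewrite sum_pick big1 ?addr0.
- under eq_bigr => j _ do rewrite idx_neq (inj_eq (@ep_inj m n)) sub0r mulrN.
  under [X in _ + X]eq_bigr => j _ do rewrite ![fp m j == _]eq_sym !idx_neq subr0 mulr0.
  by rewrite sumrN sum_pick big1 ?addr0.
- under eq_bigr => j _ do rewrite !idx_neq subr0 mulr0.
  under [X in _ + X]eq_bigr => j _ do rewrite (inj_eq (@fp_inj m n)) idx_neq subr0.
  by rewrite big1 // add0r (sum_pick i (fun j => wc mu (m + j))).
- under eq_bigr => j _ do rewrite !idx_neq subr0 mulr0.
  under [X in _ + X]eq_bigr => j _ do rewrite (inj_eq (@fp_inj m n)) idx_neq sub0r mulrN.
  by rewrite big1 // add0r sumrN (sum_pick i (fun j => wc mu (m + j))).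
Qed.

Lemma rootmx_diag_hmat a : hmat (rootmx C (a : I) a).
Proof.
split; first exact: rootmx_osp.
move=> c d ne; rewrite rootmxE.
case: andP => [[/eqP e1 /eqP e2]|_]; first by rewrite e1 e2 eqxx in ne.
case: andP => [[/eqP e1 /eqP e2]|_]; last by rewrite mulr0 subr0.
by rewrite e1 e2 eqxx in ne.
Qed.

Lemma diag_hom (H : Mat) : (forall a b, a != b -> H a b = 0) -> is_hom false H.
Proof. by move=> dH a b; case: (eqVneq a b) => [->|/dH //]; rewrite addbb. Qed.

Lemma wform_lin c (mu nu la : hw) : wform la (c *: mu + nu) = c * wform la mu + wform la nu.
Proof.
rewrite /wform !wc_lin.
have -> : \sum_(i < m) wc la i * wc (c *: mu + nu) i =
   c * \sum_(i < m) wc la i * wc mu i + \sum_(i < m) wc la i * wc nu i.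
  by rewrite mulr_sumr -big_split; apply: eq_bigr => i _; rewrite wc_lin /=; ring.
have -> : \sum_(i < n) wc la (m + i) * wc (c *: mu + nu) (m + i) =
   c * \sum_(i < n) wc la (m + i) * wc mu (m + i) + \sum_(i < n) wc la (m + i) * wc nu (m + i).
  by rewrite mulr_sumr -big_split; apply: eq_bigr => i _; rewrite wc_lin /=; ring.
ring.
Qed.

Lemma wformC (mu nu : hw) : wform mu nu = wform nu mu.
Proof.
rewrite /wform.
under eq_bigr => i _ do rewrite mulrC.
under [X in _ - X + _ + _]eq_bigr => i _ do rewrite mulrC.
ring.
Qed.

Lemma wform_idx_wt (mu : hw) a : wform mu (idx_wt a) = (-1) ^+ par a * idx_coord mu a.
Proof.
rewrite /wform idx_wt_lev idx_wt_del !mulr0 !addr0.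
have N (nu : hw) : (\sum_(i < m) wc mu i * wc (- nu) i - \sum_(j < n) wc mu (m + j) * wc (- nu) (m + j)
   = - (\sum_(i < m) wc mu i * wc nu i - \sum_(j < n) wc mu (m + j) * wc nu (m + j))).
  rewrite opprB addrC -!sumrN; congr (_ + _); apply: eq_bigr => i _; rewrite wcN; ring.
have E (i : 'I_m) : \sum_(j < m) wc mu j * wc (epsw C m n i.+1) j
   - \sum_(j < n) wc mu (m + j) * wc (epsw C m n i.+1) (m + j) = wc mu i.
  rewrite [X in _ - X]big1 ?subr0; last first.
    move=> j _; rewrite wc_eps //; last by have := ltn_ord j; lia.
    by case: eqP => [e|]; [have := ltn_ord i; lia | rewrite mulr0].
  rewrite -[RHS](sum_pick i (fun j : 'I_m => wc mu j)); apply: eq_bigr => j _.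
  by rewrite wc_eps //; have := ltn_ord j; lia.
have G (i : 'I_n) : \sum_(j < m) wc mu j * wc (dltw C m n i.+1) j
   - \sum_(j < n) wc mu (m + j) * wc (dltw C m n i.+1) (m + j) = - wc mu (m + i).
  rewrite [X in X - _]big1 ?sub0r; last first.
    move=> j _; rewrite wc_dlt //; last by have := ltn_ord j; lia.
    by case: eqP => [e|]; [have := ltn_ord j; lia | rewrite mulr0].
  congr (- _).
  rewrite -[RHS](sum_pick i (fun j : 'I_n => wc mu (m + j))); apply: eq_bigr => j _.
  by rewrite wc_dlt ?eqn_add2l //; have := ltn_ord j; lia.
case: (idxP a) => i; rewrite /idx_coord /idx_wt !idxE parE ?N ?E ?G ?expr0 ?expr1; ring.
Qed.

Lemma wform_del (mu : hw) : wform mu (deltaw C m n) = wc mu (m + n).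
Proof.
rewrite /wform !wc_del // eqxx (ltn_eqF (ltnSn _)) mulr0 mulr1 addr0.
rewrite !big1 ?subrr ?add0r // => j _; rewrite wc_del ?mulr0 //; try by have := ltn_ord j; lia.
  by case: eqP => [e|]; [have := ltn_ord j; lia | rewrite mulr0].
by case: eqP => [e|]; [have := ltn_ord j; lia | rewrite mulr0].
Qed.
End Weights.

(** * Heights and highest weight vectors *)

Section Representations.
Variables (C : numClosedFieldType) (m n : nat).
Local Notation I := 'I_(Nd m n).
Local Notation Mat := 'M[C]_(Nd m n).
Local Notation hw := (hw C m n).
Local Notation rtmx := (@rootmx C m n).

(* [rootmx a (dual a)] vanishes for even [a]: [2 eps_i] is not a root. *)
Definition root_pair (a b : I) := (b != dual a) || par a.

Lemma rootmx_zero a b : ~~ root_pair a b -> rtmx a b = 0.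
Proof.
rewrite negb_or negbK => /andP[/eqP -> /negPf pa].
apply/matrixP => c d; rewrite rootmxE dualK mxE.
have -> : dsign C a (dual a) = 1.
  by rewrite /dsign /dsignb !par_dual isfp_dual pa; case: (isfp a).
ring.
Qed.

(* Odd numbers [h a], attached to the basis vectors, and the height [h0] of delta
   encode a system of positive affine roots: [rootmx a b] t^r has the even height
   [h a - h b + r * h0], so that positive roots of height 2 are simple. *)
Definition is_height (h : I -> int) (h0 : int) :=
  [/\ forall a, h (dual a) = - h a, injective h, forall a, exists k, h a = 2 * k + 1,
      (exists k, h0 = 2 * k) & 0 < h0 /\ forall a b, root_pair a b -> h a - h b < h0].

Variables (V : lmodType C) (rho : hrep m n V).
Hypothesis R : is_rep rho.

Definition rootop r (a b : I) (v : V) : V := rpi rho r (rtmx a b) v.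

Lemma rep_lin r X a w1 w2 : rpi rho r X (a *: w1 + w2) = a *: rpi rho r X w1 + rpi rho r X w2.
Proof. by case: R => H _; apply: H. Qed.
Lemma rep_linX r X Y a w : osp X -> osp Y ->
  rpi rho r (a *: X + Y) w = a *: rpi rho r X w + rpi rho r Y w.
Proof. by case: R => _ [H _]; apply: H. Qed.
Lemma rep_Klin a w1 w2 : rK rho (a *: w1 + w2) = a *: rK rho w1 + rK rho w2.
Proof. by case: R => _ [_ [H _]]; apply: H. Qed.
Lemma rep_Dlin a w1 w2 : rD rho (a *: w1 + w2) = a *: rD rho w1 + rD rho w2.
Proof. by case: R => _ [_ [_ [H _]]]; apply: H. Qed.
Lemma rep_br p q X Y r s w : is_hom p X -> is_hom q Y -> osp X -> osp Y ->
  rpi rho r X (rpi rho s Y w) = (-1) ^+ (p && q) *: rpi rho s Y (rpi rho r X w)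
      + (rpi rho (r + s) (sbr p q X Y) w
        + ((r%:~R * mform X Y) *+ (r + s == 0)) *: rK rho w).
Proof.
case: R => _ [_ [_ [_ [H _]]]] hX hY oX oY.
by rewrite -(H p q) // addrC subrK.
Qed.
Lemma rep_KX r X w : osp X -> rK rho (rpi rho r X w) = rpi rho r X (rK rho w).
Proof. by case: R => _ [_ [_ [_ [_ [H _]]]]]; apply: H. Qed.
Lemma rep_DX r X w : osp X ->
  rD rho (rpi rho r X w) = r%:~R *: rpi rho r X w + rpi rho r X (rD rho w).
Proof. by case: R => _ [_ [_ [_ [_ [_ [_ H]]]]]] oX; rewrite -H // subrK. Qed.

Lemma lin0 (f : V -> V) : (forall a x y, f (a *: x + y) = a *: f x + f y) -> f 0 = 0.
Proof. by move=> fl; have := fl (-1) 0 0; rewrite scaler0 addr0 scaleN1r addNr. Qed.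
Lemma linZ (f : V -> V) : (forall a x y, f (a *: x + y) = a *: f x + f y) ->
  forall a x, f (a *: x) = a *: f x.
Proof. by move=> fl a x; have := fl a x 0; rewrite (lin0 fl) !addr0. Qed.
Lemma linD (f : V -> V) : (forall a x y, f (a *: x + y) = a *: f x + f y) ->
  forall x y, f (x + y) = f x + f y.
Proof. by move=> fl x y; have := fl 1 x y; rewrite !scale1r. Qed.

Lemma rep_0 r X : rpi rho r X 0 = 0. Proof. exact: (lin0 (rep_lin r X)). Qed.
Lemma rep_Z r X a w : rpi rho r X (a *: w) = a *: rpi rho r X w.
Proof. exact: (linZ (rep_lin r X)). Qed.
Lemma rep_X0 r w : rpi rho r 0 w = 0.
Proof.
have := @rep_linX r 0 0 (-1) w (osp0 _ _ _) (osp0 _ _ _).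
by rewrite scaler0 addr0 scaleN1r addNr.
Qed.
Lemma rep_XZ r c X w : osp X -> rpi rho r (c *: X) w = c *: rpi rho r X w.
Proof.
by move=> oX; have := @rep_linX r X 0 c w oX (osp0 _ _ _); rewrite rep_X0 !addr0.
Qed.

Lemma rep_Xsum (T : Type) (s : seq T) (f : T -> Mat) r w : (forall t, osp (f t)) ->
  rpi rho r (\sum_(t <- s) f t) w = \sum_(t <- s) rpi rho r (f t) w.
Proof.
move=> of_; elim: s => [|t s IH]; first by rewrite !big_nil rep_X0.
rewrite !big_cons -IH -[f t]scale1r rep_linX ?scale1r //.
exact: osp_sum.
Qed.

Lemma osp_Z c (X : Mat) : osp X -> osp (c *: X).
Proof. by move=> oX; rewrite -[_ *: _]addr0; apply: osp_lin => //; apply: osp0. Qed.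

Lemma rep_expand r X w : osp X ->
  rpi rho r X w = \sum_a \sum_b (X a b / 2) *: rootop r a b w.
Proof.
move=> oX; rewrite {1}(osp_expand oX) rep_Xsum; last first.
  by move=> a; apply: osp_sum => b; apply/osp_Z/rootmx_osp.
apply: eq_bigr => a _; rewrite rep_Xsum; last by move=> b; apply/osp_Z/rootmx_osp.
by apply: eq_bigr => b _; rewrite rep_XZ //; apply: rootmx_osp.
Qed.

Lemma rootop_dual r a b w : rootop r (dual b) (dual a) w = - dsign C a b *: rootop r a b w.
Proof. by rewrite /rootop rootmx_dual rep_XZ //; apply: rootmx_osp. Qed.

Lemma rootop_zero r a b w : ~~ root_pair a b -> rootop r a b w = 0.
Proof. by move=> /rootmx_zero fz; rewrite /rootop fz rep_X0. Qed.

Definition weight_vec (mu : hw) (w : V) :=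
  [/\ forall H, hmat H -> rpi rho 0 H w = lamH mu H *: w,
      rK rho w = wc mu (m + n) *: w & rD rho w = wc mu (m + n).+1 *: w].

Lemma rep_HX H X p r w : hmat H -> is_hom p X -> osp X ->
  rpi rho 0 H (rpi rho r X w) = rpi rho r X (rpi rho 0 H w) + rpi rho r (H *m X - X *m H) w.
Proof.
move=> [oH dH] hX oX; have hH := diag_hom dH.
rewrite (rep_br 0 r w hH hX oH oX) /= scale1r mul0r mul0rn scale0r addr0 add0r.
by rewrite /sbr /= scale1r.
Qed.

Lemma wvec_X mu w p r X al : finw al -> is_hom p X -> rootspace al X -> weight_vec mu w ->
  weight_vec (mu + (al + r%:~R *: deltaw C m n)) (rpi rho r X w).
Proof.
move=> [al1 al2] hX [oX eX] [eH eK eD]; split.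
- move=> H hH; rewrite (rep_HX _ _ hH hX oX) eH // rep_Z eX // rep_XZ // -scalerDl.
  congr (_ *: _); rewrite -[mu]scale1r lamH_lin mul1r scale1r; congr (_ + _).
  rewrite [al + _]addrC lamH_lin -[LHS]add0r; congr (_ + _).
  rewrite /lamH !big1 ?addr0 ?mulr0 // => j _; rewrite wc_del ?ltn_eqF ?mul0r //;
     have := ltn_ord j; lia.
- rewrite rep_KX // eK rep_Z wcD wcD wcZ wc_del // al1 ltn_eqF //; congr (_ *: _); rewrite mulr0n; ring.
- rewrite rep_DX // eD rep_Z -scalerDl !wcD wcZ wc_del // al2 eqxx; congr (_ *: _); rewrite mulr1n; ring.
Qed.

Lemma lamH_idx_wtB (H : Mat) a b : hmat H -> lamH (idx_wt C a - idx_wt C b) H = H a a - H b b.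
Proof.
move=> hH; rewrite addrC -[- idx_wt _ _]scaleN1r lamH_lin !lamH_idx_wt //; ring.
Qed.

Lemma rootmx_root a b : rootspace (idx_wt C a - idx_wt C b) (rtmx a b).
Proof.
split; first exact: rootmx_osp.
move=> H hH; apply/matrixP => c d.
have dm (X Y : Mat) : (forall x y, x != y -> X x y = 0) -> (X *m Y) c d = X c c * Y c d.
  move=> dX; rewrite mxE (bigD1 c) //= big1 ?addr0 // => x nx.
  by rewrite dX ?mul0r // eq_sym.
have md (X Y : Mat) : (forall x y, x != y -> X x y = 0) -> (Y *m X) c d = X d d * Y c d.
  move=> dX; rewrite mxE (bigD1 d) //= big1 ?addr0 1?mulrC // => x nx.
  by rewrite dX ?mulr0.
have dH : forall x y, x != y -> H x y = 0 by case: hH.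
rewrite [LHS]mxE (dm H) // [X in _ + X]mxE (md H) // [RHS]mxE lamH_idx_wtB //.
rewrite rootmxE; case: andP => [[/eqP -> /eqP ->]|_]; first by move: (true%:R - _) => t; ring.
case: andP => [[/eqP -> /eqP ->]|_]; last (rewrite mulr0n; ring).
by rewrite !(hmat_dual _ hH) mulr0n mulr1n; ring.
Qed.

Lemma idx_wtB_finw a b : finw (idx_wt C (a : I) - idx_wt C b).
Proof. by split; rewrite wcB ?idx_wt_lev ?idx_wt_del subr0. Qed.

Definition aff_root r (a b : I) : hw := idx_wt C a - idx_wt C b + r%:~R *: deltaw C m n.

Lemma wvec_rootop mu w r a b : weight_vec mu w -> weight_vec (mu + aff_root r a b) (rootop r a b w).
Proof. exact: (wvec_X r (idx_wtB_finw a b) (@rootmx_hom C m n a b) (rootmx_root a b)). Qed.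

(** * The gradation by height and modules generated by a singular vector *)

Section Height.
Variables (h : I -> int) (h0 : int).
Hypothesis Hh : is_height h h0.

Let h_dual a : h (dual a) = - h a. Proof. by case: Hh. Qed.
Let h_inj : injective h. Proof. by case: Hh. Qed.

Definition aff_height r (a b : I) : int := h a - h b + r * h0.

Lemma aff_height_even r a b : exists k, aff_height r a b = 2 * k.
Proof.
case: Hh => _ _ od [k ek] _; case: (od a) => x ex; case: (od b) => y ey.
by exists (x - y + r * k); rewrite /aff_height ex ey ek; ring.
Qed.

(** Roots of the finite superalgebra are shorter than delta, so the height of [alpha + r delta] has
    the sign of [r] as soon as [r] is nonzero. The lower bound is the upper bound at the negative
    root, which is the pair of duals. *)
Lemma h_bound a b : root_pair a b -> - h0 < h a - h b < h0.
Proof.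
case: Hh => _ _ _ _ [_ hb] nz; have := hb _ _ nz.
have : h (dual a) - h (dual b) < h0.
  apply: hb; rewrite /root_pair dualK par_dual; move: nz; rewrite /root_pair.
  case: (par a); rewrite ?orbT // !orbF => nz.
  by rewrite eq_sym (inv_eq (@dualK m n)) eq_sym in nz *.
rewrite !h_dual; lia.
Qed.

Lemma h0_gt0 : 0 < h0. Proof. by case: Hh => _ _ _ _ []. Qed.

(** Separates the Cartan letters from the root vectors: injectivity of [h] rules out any other
    letter of height zero. *)
Lemma aff_height_zero r a b : root_pair a b -> aff_height r a b = 0 -> r = 0 /\ a = b.
Proof.
move=> nz e; have [b1 b2] := andP (h_bound nz); have hp := h0_gt0.
have r0 : r = 0 by rewrite /aff_height in e; nia.
by split=> //; apply: h_inj; move/eqP: e; rewrite /aff_height r0 mul0r addr0 subr_eq0 => /eqP.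
Qed.

Definition hsingular (u : V) := forall r a b, root_pair a b -> 0 < aff_height r a b -> rootop r a b u = 0.

(** This is U(n_-)u, written as a closure under lowering operators so that no enveloping algebra is
    needed. *)
Inductive lower_span (u : V) : V -> Prop :=
| lower_span_base : lower_span u u
| lower_span_lin c x y : lower_span u x -> lower_span u y -> lower_span u (c *: x + y)
| lower_span_neg r a b x : aff_height r a b < 0 -> lower_span u x -> lower_span u (rootop r a b x).

Lemma lower_span_0 u : lower_span u 0.
Proof.
have := lower_span_lin (-1) (lower_span_base u) (lower_span_base u); by rewrite scaleN1r addNr.
Qed.
Lemma lower_span_Z u c x : lower_span u x -> lower_span u (c *: x).
Proof. by move=> gx; rewrite -[_ *: _]addr0; apply: lower_span_lin => //; apply: lower_span_0. Qed.
Lemma lower_span_D u x y : lower_span u x -> lower_span u y -> lower_span u (x + y).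
Proof. by move=> gx gy; rewrite -[x]scale1r; apply: lower_span_lin. Qed.
Lemma lower_span_sum u (T : Type) (s : seq T) (f : T -> V) :
  (forall t, lower_span u (f t)) -> lower_span u (\sum_(t <- s) f t).
Proof.
move=> H; elim: s => [|t s IH]; first by rewrite big_nil; apply: lower_span_0.
by rewrite big_cons; apply: lower_span_D.
Qed.

Lemma lower_span_K mu u x : weight_vec mu u -> lower_span u x -> rK rho x = wc mu (m + n) *: x.
Proof.
case=> _ eK _; elim=> {x} [|c x y _ IHx _ IHy|r a b x _ _ IH] //.
  by rewrite rep_Klin IHx IHy scalerDr !scalerA mulrC.
by rewrite /rootop rep_KX ?IH ?rep_Z //; apply: rootmx_osp.
Qed.

Lemma lower_span_D_closed mu u x : weight_vec mu u -> lower_span u x -> lower_span u (rD rho x).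
Proof.
case=> _ _ eD; elim=> {x} [|c x y _ IHx _ IHy|r a b x dn gx IH].
- by rewrite eD; apply/lower_span_Z/lower_span_base.
- by rewrite rep_Dlin; apply: lower_span_lin.
- rewrite /rootop rep_DX; last exact: rootmx_osp.
  by apply: lower_span_lin; apply: lower_span_neg => //.
Qed.

(** An operator is moved past the outermost lowering operator. The bracket is again a combination of
    root operators, so the induction hypothesis must hold for all of them at once. *)
Lemma lower_span_rootop mu u x : hsingular u -> weight_vec mu u -> lower_span u x ->
  forall r a b, lower_span u (rootop r a b x).
Proof.
move=> su wu; elim=> {x} [|c x y _ IHx _ IHy|s c d x dn gx IH] r a b.
- have [nz|/(rootop_zero r u) ->] := boolP (root_pair a b); last exact: lower_span_0.
  case: (ltrgtP (aff_height r a b) 0) => dg.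
  + by apply: lower_span_neg => //; apply: lower_span_base.
  + by rewrite su //; apply: lower_span_0.
  + have [-> ->] := aff_height_zero nz dg.
    case: wu => eH _ _; rewrite /rootop eH; last exact: rootmx_diag_hmat.
    exact/lower_span_Z/lower_span_base.
- by rewrite /rootop rep_lin; apply: lower_span_lin; [exact: IHx|exact: IHy].
- rewrite /rootop (rep_br _ _ _ (@rootmx_hom C m n a b) (@rootmx_hom C m n c d)); try exact: rootmx_osp.
  apply: lower_span_lin; first by apply: lower_span_neg => //; apply: IH.
  apply: lower_span_D; last by rewrite (lower_span_K wu gx); apply/lower_span_Z/lower_span_Z.
  rewrite rep_expand; last by apply: osp_sbr; (exact: rootmx_osp || exact: rootmx_hom).
  by apply: lower_span_sum => y; apply: lower_span_sum => z; apply: lower_span_Z; apply: IH.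
Qed.

Lemma lower_span_submodule mu u : hsingular u -> weight_vec mu u -> submodule rho (lower_span u).
Proof.
move=> su wu; split; first exact: lower_span_0.
split; first by move=> *; apply: lower_span_D.
split; first by move=> *; apply: lower_span_Z.
split.
  move=> r X x oX gx; rewrite rep_expand //.
  by apply: lower_span_sum => y; apply: lower_span_sum => z; apply: lower_span_Z; apply: (lower_span_rootop su wu).
split; first by move=> w gw; rewrite (lower_span_K wu gw); apply: lower_span_Z.
by move=> w; apply: (lower_span_D_closed wu).
Qed.

Lemma lower_span_all mu u : irreducible rho -> hsingular u -> weight_vec mu u -> u <> 0 -> forall x, lower_span u x.
Proof.
move=> [_ irr] su wu nz; case: (irr _ (lower_span_submodule su wu)) => // H.
by case: nz; apply: H; apply: lower_span_base.
Qed.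

(** Together with [h0] times d, this is the Cartan element whose adjoint action multiplies a root
    vector by its height. *)
Definition height_mx : Mat := \matrix_(a, b) ((h a)%:~R *+ (a == b)).

Lemma height_mx_hmat : hmat height_mx.
Proof.
split; last by move=> a b /negPf ne; rewrite mxE ne.
apply/ospP => a b; rewrite !mxE (inj_eq (@dual_inj m n)) eq_sym.
case: eqP => [->|_]; last by rewrite mulr0.
by rewrite dsign_diag h_dual mulr1n rmorphN /=; ring.
Qed.

Definition height_op (x : V) : V := rpi rho 0 height_mx x + h0%:~R *: rD rho x.
Definition height_wt (mu : hw) : C := lamH mu height_mx + h0%:~R * wc mu (m + n).+1.

Lemma height_op_lin a x y : height_op (a *: x + y) = a *: height_op x + height_op y.
Proof.
by rewrite /height_op rep_lin rep_Dlin !scalerDr addrACA !scalerA mulrC.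
Qed.

Lemma height_op_w mu u : weight_vec mu u -> height_op u = height_wt mu *: u.
Proof. by case=> eH _ eD; rewrite /height_op eH ?eD ?scalerA ?scalerDl //; apply: height_mx_hmat. Qed.

Lemma height_op_rootop r a b x : height_op (rootop r a b x) = rootop r a b (height_op x) + (aff_height r a b)%:~R
  *: rootop r a b x.
Proof.
rewrite /height_op /rootop (rep_HX _ _ height_mx_hmat (@rootmx_hom C m n a b)) ?rep_DX; try exact: rootmx_osp.
rewrite (linD (rep_lin r _)) rep_Z scalerDr scalerA.
have [_ -> //] := rootmx_root a b; last exact: height_mx_hmat.
rewrite rep_XZ; last exact: rootmx_osp.
rewrite lamH_idx_wtB ?mxE ?eqxx; last exact: height_mx_hmat.
rewrite -!addrA; congr (_ + _); rewrite addrA -scalerDl addrC; congr (_ + _ *: _).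
by rewrite !mulr1n /aff_height !rmorphD rmorphN rmorphM /=; ring.
Qed.

(* [\prod_(j <- s) (height_op - (c - j))] applied to [x]: annihilators of this form
   replace the weight decomposition of the module. *)
Fixpoint height_poly (c : C) (s : seq nat) (x : V) : V :=
  if s is j :: s' then height_poly c s' (height_op x - (c - j%:R) *: x) else x.

Lemma height_poly_lin c s a x y : height_poly c s (a *: x + y) = a *: height_poly c s x + height_poly c s y.
Proof.
elim: s x y => //= j s IH x y; rewrite -IH; congr (height_poly _ _ _).
rewrite height_op_lin [(c - _) *: (_ + _)]scalerDr opprD addrACA; congr (_ + _).
by rewrite scalerBr !scalerA [_ * a]mulrC.
Qed.
Lemma height_poly_0 c s : height_poly c s 0 = 0.
Proof. exact: (lin0 (height_poly_lin c s)). Qed.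
Lemma height_poly_Z c s a x : height_poly c s (a *: x) = a *: height_poly c s x.
Proof. exact: (linZ (height_poly_lin c s)). Qed.

Lemma height_poly_cat c s t x : height_poly c (s ++ t) x = height_poly c t (height_poly c s x).
Proof. by elim: s x => //= j s IH x. Qed.

Lemma height_poly_T c s x : height_poly c s (height_op x) = height_op (height_poly c s x).
Proof.
elim: s x => //= j s IH x; rewrite -IH; congr (height_poly _ _ _).
rewrite -scaleNr addrC -height_op_lin addrC; congr height_op; rewrite scaleNr.
by rewrite addrC.
Qed.

Lemma height_poly_catC c s t x : height_poly c (s ++ t) x = height_poly c (t ++ s) x.
Proof.
rewrite !height_poly_cat; elim: s x => //= j s IH x; rewrite IH; congr (height_poly _ _ _).
by rewrite -scaleNr addrC height_poly_lin height_poly_T addrC scaleNr.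
Qed.

Lemma height_poly_rootop c s r a b p x : aff_height r a b = - p%:Z ->
  height_poly c (map (addn p) s) (rootop r a b x) = rootop r a b (height_poly c s x).
Proof.
move=> dp; elim: s x => //= j s IH x; rewrite -IH; congr (height_poly _ _ _).
rewrite height_op_rootop dp natrD -scaleNr addrC.
have -> : rootop r a b (height_op x - (c - j%:R) *: x) = rootop r a b (height_op x) - (c - j%:R) *: rootop r a b x.
  by rewrite /rootop addrC -scaleNr rep_lin scaleNr addrC.
rewrite addrC -addrA; congr (_ + _); rewrite -scalerDl -scaleNr; congr (_ *: _).
by rewrite rmorphN /=; ring.
Qed.

(** The vector [a *: u] is the top component of [x], and the factors [j] in [s] list the heights,
    [j] below that of [u], where the rest may live. That all of them are at least 1 is what later
    keeps the top component from being annihilated. *)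
Lemma lower_span_poly mu u x : weight_vec mu u -> lower_span u x ->
  exists s a, all (leq 1) s /\ height_poly (height_wt mu) s (x - a *: u) = 0.
Proof.
move=> wu; elim=> {x} [|c x y _ [s [a [ps es]]] _ [t [b [pt et]]]|r a b x dn _ [s [c [ps es]]]].
- by exists [::], 1; rewrite scale1r subrr.
- exists (s ++ t), (c * a + b); rewrite all_cat ps pt; split=> //.
  have -> : c *: x + y - (c * a + b) *: u = c *: (x - a *: u) + (y - b *: u).
    by rewrite scalerBr scalerDl scalerA opprD addrACA.
  rewrite height_poly_lin [in X in _ + X]height_poly_catC !height_poly_cat es et !height_poly_0 scaler0 addr0.
  by [].
- have [p ep] : exists p : nat, aff_height r a b = - p%:Z by exists `|aff_height r a b|%N; lia.
  have pp : (0 < p)%N by move: dn; rewrite ep; lia.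
  (* A lowering operator of height [- p] shifts every factor by [p]. The additional factor 0 kills
     the top component [c *: u] of [x]; after the shift it is the factor [p], still at least 1. *)
  exists (map (addn p) (0%N :: s)), 0; split.
    by apply/allP => j /mapP [k _ ->]; rewrite addn_gt0 pp.
  rewrite scale0r subr0 height_poly_rootop // -[0%N :: s]/([:: 0%N] ++ s).
  have K : height_poly (height_wt mu) [:: 0%N] (c *: u) = 0.
    by rewrite /= (linZ height_op_lin) (height_op_w wu) subr0 !scalerA mulrC subrr.
  rewrite -[x](subrK (c *: u)) (linD (height_poly_lin _ _)) [X in X + _]height_poly_catC.
  by rewrite !height_poly_cat es K !height_poly_0 addr0 /rootop rep_0.
Qed.

Lemma height_poly_w c s nu w : weight_vec nu w -> height_poly c s w = (\prod_(j <- s) (height_wt nu - c + j%:R)) *: w.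
Proof.
move=> ww; elim: s => [|j s IH] /=; first by rewrite big_nil scale1r.
rewrite (height_op_w ww) -scalerBl height_poly_Z IH scalerA big_cons; congr (_ *: _); ring.
Qed.

(** On a weight vector an annihilating product of factors acts by a product of scalars, one of which
    must vanish. The factor 0 is added so that the multiple of [u] is annihilated too. *)
Lemma lower_span_height mu u nu w : weight_vec mu u -> lower_span u w -> weight_vec nu w -> w <> 0 ->
  exists j : nat, height_wt nu = height_wt mu - j%:R.
Proof.
move=> wu gw ww wn; have [s [a [_ es]]] := lower_span_poly wu gw.
have : height_poly (height_wt mu) (0%N :: s) w = 0.
  rewrite -[0%N :: s]/([:: 0%N] ++ s) -[w](subrK (a *: u)) (linD (height_poly_lin _ _)).
  rewrite [X in X + _]height_poly_catC !height_poly_cat es height_poly_0 add0r /= (linZ height_op_lin) (height_op_w wu).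
  by rewrite subr0 !scalerA mulrC subrr height_poly_0.
rewrite (height_poly_w _ _ ww) => /eqP; rewrite scaler_eq0 prodf_seq_eq0.
case/orP=> [/hasP [j _ /andP[_ /eqP ej]]|/eqP //]; exists j.
by rewrite -[RHS]add0r -ej; ring.
Qed.

Lemma hw_height_wt mu u nu w : irreducible rho -> hsingular u -> weight_vec mu u -> u <> 0 ->
  weight_vec nu w -> w <> 0 -> exists j : nat, height_wt nu = height_wt mu - j%:R.
Proof.
move=> irr su wu un ww wn; exact: (lower_span_height wu (lower_span_all irr su wu un w) ww wn).
Qed.

Lemma height_wt_lin c mu nu : height_wt (c *: mu + nu) = c * height_wt mu + height_wt nu.
Proof. by rewrite /height_wt lamH_lin wc_lin; ring. Qed.

Lemma height_wt_aff_root r a b : height_wt (aff_root r a b) = (aff_height r a b)%:~R.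
Proof.
rewrite /aff_root addrC height_wt_lin /height_wt lamH_idx_wtB; last exact: height_mx_hmat.
rewrite !mxE !eqxx !mulr1n wcB !idx_wt_del wc_del // eqxx.
rewrite /lamH !big1 ?addr0; last first.
- by move=> j _; rewrite wc_del ?ltn_eqF ?mul0r //; have := ltn_ord j; lia.
- by move=> j _; rewrite wc_del ?ltn_eqF ?mul0r //; have := ltn_ord j; lia.
rewrite /aff_height !rmorphD rmorphN rmorphM /=; ring.
Qed.

End Height.
End Representations.

(** * Root vectors and sl(2) *)

Section RootVectors.
Variables (C : numClosedFieldType) (m n : nat).
Local Notation I := 'I_(Nd m n).
Local Notation Mat := 'M[C]_(Nd m n).
Local Notation hw := (hw C m n).
Local Notation rtmx := (@rootmx C m n).

Lemma rootmx_supp (a b x y : I) : rtmx a b x y != 0 ->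
  (x = a /\ y = b) \/ (x = dual b /\ y = dual a).
Proof.
rewrite rootmxE; case: andP => [[/eqP -> /eqP ->]|_]; first by left.
case: andP => [[/eqP -> /eqP ->]|_]; first by right.
by rewrite mulr0n mulr0 subr0 eqxx.
Qed.

Lemma rootmx_grade (h : I -> int) (hd : forall a, h (dual a) = - h a) (a b x y : I) :
  rtmx a b x y != 0 -> h x - h y = h a - h b.
Proof. by case/rootmx_supp => -[-> ->] //; rewrite !hd opprK addrC. Qed.

Lemma sbr_nz p q (X Y : Mat) x y : sbr p q X Y x y != 0 ->
  exists z, (X x z != 0 /\ Y z y != 0) \/ (Y x z != 0 /\ X z y != 0).
Proof.
rewrite !mxE => nz.
have [/existsP [z /orP[/andP[]|/andP[]]]|/existsPn H] :=
  boolP [exists z, ((X x z != 0) && (Y z y != 0)) || ((Y x z != 0) && (X z y != 0))].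
- by exists z; left.
- by exists z; right.
- move: nz; rewrite !big1 ?mulr0 ?subr0 ?eqxx // => z _.
    by move: (H z); rewrite negb_or !negb_and !negbK => /andP[_ /orP[] /eqP ->]; rewrite (mul0r, mulr0).
  by move: (H z); rewrite negb_or !negb_and !negbK => /andP[/orP[] /eqP -> _]; rewrite (mul0r, mulr0).
Qed.

Lemma sbr_rootmx_grade (h : I -> int) (hd : forall a, h (dual a) = - h a) p q (a b c d x y : I) :
  sbr p q (rtmx a b) (rtmx c d) x y != 0 -> h x - h y = (h a - h b) + (h c - h d).
Proof.
case/sbr_nz => z [] [] /(rootmx_grade hd) e1 /(rootmx_grade hd) e2; first by rewrite -e1 -e2; lia.
by rewrite -e1 -e2; lia.
Qed.

Lemma sbr_rootmx_diag p q (a b c d x : I) : ~ (c = a /\ d = b) -> ~ (c = dual b /\ d = dual a) ->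
  sbr p q (rtmx c d) (rtmx b a) x x = 0.
Proof.
move=> n1 n2; apply/eqP; apply: contraT => /sbr_nz [z].
have nd := inv_eq (@dualK m n).
by case=> -[/rootmx_supp [] [-> ->] /rootmx_supp [] [e1 e2]]; exfalso;
  first [by apply: n1; split; rewrite -?e1 -?e2 ?e1 ?e2 ?dualK | by apply: n2; split; rewrite -?e1 -?e2 ?dualK
  |by apply: n1; split; apply: (@dual_inj m n)|by apply: n2; split; apply: (@dual_inj m n); rewrite dualK].
Qed.

(** With alpha the root of [rtmx a b], a component along alpha could only come from a root vector of
    weight 2 alpha. On the level of entries, [rtmx b a] has no nonzero entry in column [b] or in row
    [a]. *)
Lemma sbr_rootmx_simple p q (a b c d : I) : a != b -> sbr p q (rtmx c d) (rtmx b a) a b = 0.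
Proof.
move=> ab; apply/eqP; apply: contraT => /sbr_nz [z].
case=> -[].
  move=> _ /rootmx_supp [] [_ e]; first by rewrite e eqxx in ab.
  by have := dual_neq b; rewrite -e eqxx.
move=> /rootmx_supp [] [e _]; first by rewrite e eqxx in ab.
by have := dual_neq a; rewrite -e eqxx.
Qed.

Lemma mul_rootmx (a b : I) : a != b -> b != dual a ->
  rtmx a b *m rtmx b a = delta_mx a a + (-1) ^+ (par a (+) par b) *: delta_mx (dual b) (dual b).
Proof.
move=> ab bda; rewrite /rootmx mulmxBl !mulmxBr -!scalemxAl -!scalemxAr scalerA !mul_delta_mx.
have dd : b != dual a by [].
rewrite [delta_mx a b *m delta_mx _ _]mul_delta_mx_0 //.
rewrite [delta_mx (dual b) _ *m delta_mx b _]mul_delta_mx_0 1?eq_sym //.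
rewrite !scaler0 subr0 sub0r opprK; congr (_ + _ *: _).
rewrite /dsign -signr_addb /dsignb; congr (_ ^+ nat_of_bool _).
by case: (par a) (par b) (isfp a) (isfp b) => [] [] [] [].
Qed.

Lemma rootmx_sq (a b : I) : a != b -> rtmx a b *m rtmx a b = 0.
Proof.
move=> ab; rewrite /rootmx mulmxBl !mulmxBr -!scalemxAl -!scalemxAr scalerA.
by rewrite !mul_delta_mx_0 ?scaler0 ?subrr //
  ?(inj_eq (@dual_inj m n)) ?dual_neq // eq_sym ?dual_neq.
Qed.

Lemma sbr_rootmx (a b : I) : a != b -> b != dual a -> let p := par a (+) par b in
  sbr p p (rtmx a b) (rtmx b a) = rtmx a a - (-1) ^+ p *: rtmx b b.
Proof.
move=> ab bda p; have adb : a != dual b by rewrite eq_sym (inv_eq (@dualK m n)).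
rewrite /sbr !mul_rootmx // ?andbb; last by rewrite eq_sym.
rewrite -/p addbC -/p /rootmx !dsign_diag !scale1r scalerDr scalerA -signr_addb addbb scale1r.
by rewrite scalerBr opprB opprD !addrA addrAC -!addrA; congr (_ + _); rewrite addrCA; congr (_ + _); rewrite addrC.
Qed.

Lemma mform_rootmx (a b : I) : a != b -> b != dual a -> mform (rtmx a b) (rtmx b a) = (-1) ^+ par a.
Proof.
move=> ab bda; rewrite mformE mul_rootmx // addrC str_lin.
have E x : str (delta_mx x x : Mat) = (-1) ^+ par x.
  rewrite /str (bigD1 x) //= big1 ?addr0 ?mxE ?eqxx ?mulr1 // => y /negPf ny.
  by rewrite mxE ny mulr0.
rewrite !E par_dual; have := pnatr_eq0 C 2 => two.
case: (par a) (par b) => [] [] /=; rewrite ?expr0 ?expr1; field; by rewrite ?two.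
Qed.

Lemma mform_rootmx0 (a b c d : I) : ~ (c = a /\ d = b) -> ~ (c = dual b /\ d = dual a) ->
  mform (rtmx c d) (rtmx b a) = 0.
Proof.
move=> n1 n2; rewrite mformE /str big1 ?mulr0 // => x _; rewrite mxE big1 ?mulr0 // => z _.
apply/eqP; apply: contraT; rewrite mulf_eq0 negb_or => /andP[].
by move=> /rootmx_supp [] [-> ->] /rootmx_supp [] [e1 e2]; exfalso;
  first [by apply: n1; split; rewrite -?e1 -?e2 ?e1 ?e2 ?dualK | by apply: n2; split; rewrite -?e1 -?e2 ?dualK
  |by apply: n1; split; apply: (@dual_inj m n)|by apply: n2; split; apply: (@dual_inj m n); rewrite dualK].
Qed.

Lemma idx_coord_wt (a b : I) : idx_coord (idx_wt C a) b = (a == b)%:R - (a == dual b)%:R.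
Proof.
rewrite -lamH_rootmx lamH_idx_wt; last exact: rootmx_diag_hmat.
by rewrite rootmxE !andbb dsign_diag mul1r.
Qed.

Lemma idx_coord_aff_root r (a b c : I) : idx_coord (aff_root C r a b) c =
  (a == c)%:R - (a == dual c)%:R - ((b == c)%:R - (b == dual c)%:R).
Proof.
rewrite /aff_root addrC idx_coord_lin -[idx_wt C a - _]addrC -scaleN1r idx_coord_lin !idx_coord_wt.
have -> : idx_coord (deltaw C m n) c = 0; last by ring.
by case: (idxP c) => i; have := ltn_ord i => ?; rewrite /idx_coord !idxE wc_del; try lia;
  rewrite (_ : (_ == _) = false) ?oppr0 //; lia.
Qed.

Lemma aff_root_lev r (a b : I) : wc (aff_root C r a b) (m + n) = 0.
Proof. by rewrite /aff_root wcD wcB !idx_wt_lev wcZ wc_del // ltn_eqF // mulr0n mulr0 subr0 addr0. Qed.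

Lemma aff_rootN r (a b : I) : aff_root C (- r) b a = - aff_root C r a b.
Proof. by rewrite /aff_root opprD opprB rmorphN scaleNr. Qed.

(** The scalar by which the superbracket of [rootmx a b] t^r and [rootmx b a] t^(-r) acts on a
    vector of weight [mu]. For an even root it is the value of [mu] on the coroot. *)
Definition coroot (mu : hw) r (a b : I) : C :=
  idx_coord mu a - (-1) ^+ (par a (+) par b) * idx_coord mu b + r%:~R * (-1) ^+ par a * wc mu (m + n).

Lemma coroot_lin c mu nu r a b : coroot (c *: mu + nu) r a b = c * coroot mu r a b + coroot nu r a b.
Proof. by rewrite /coroot !idx_coord_lin wc_lin; ring. Qed.

Lemma coroot_wform mu r a b : coroot mu r a b = (-1) ^+ par a * wform mu (aff_root C r a b).
Proof.
rewrite /aff_root [X in wform _ X]addrC wform_lin wform_del [idx_wt C a - _]addrC -scaleN1r.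
rewrite wform_lin !wform_idx_wt /coroot.
have s2 : (-1) ^+ par a * (-1) ^+ par a = 1 :> C by rewrite -signr_addb addbb.
rewrite signr_addb; ring: s2.
Qed.

Lemma coroot_aff_root r a b : a != b -> b != dual a -> ~~ par a -> ~~ par b -> coroot (aff_root C r a b) r a b = 2.
Proof.
move=> ab bda pa pb; rewrite /coroot !idx_coord_aff_root aff_root_lev (negPf pa) (negPf pb) !eqxx.
have -> : (a == dual b) = false by rewrite eq_sym (inv_eq (@dualK m n)); apply: negPf.
rewrite (negPf bda) [b == a]eq_sym (negPf ab) ![_ == dual _]eq_sym !dual_neq /= !expr0 !(mulr0n, mulr1n).
ring.
Qed.
End RootVectors.

(** * Strings of an sl(2) pair *)

Section SL2.
Variables (K : numFieldType) (V : lmodType K) (e f : V -> V).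
Hypothesis elin : forall a x y, e (a *: x + y) = a *: e x + e y.
Hypothesis flin : forall a x y, f (a *: x + y) = a *: f x + f y.

Lemma sl2_raise c u : e u = 0 ->
  (forall j, e (f (iter j f u)) = f (e (iter j f u)) + (c - 2 * j%:R) *: iter j f u) ->
  forall j, e (iter j.+1 f u) = (j.+1%:R * (c - j%:R)) *: iter j f u.
Proof.
move=> eu H; have f0 : f 0 = 0 by have := flin (-1) 0 0; rewrite scaler0 addr0 scaleN1r addNr.
have fZ a x : f (a *: x) = a *: f x by have := flin a x 0; rewrite f0 !addr0.
elim=> [|j IH]; first by rewrite /= (H 0%N) /= eu f0 add0r mulr0; congr (_ *: _); ring.
rewrite [iter j.+2 f u]iterS H IH fZ -iterS -scalerDl; congr (_ *: _).
rewrite -!natr1; ring.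
Qed.

Lemma sl2_nat c u N : u <> 0 ->
  (forall j, e (iter j.+1 f u) = (j.+1%:R * (c - j%:R)) *: iter j f u) ->
  iter N f u = 0 -> exists p : nat, c = p%:R.
Proof.
move=> un H; have e0 : e 0 = 0 by have := elin (-1) 0 0; rewrite scaler0 addr0 scaleN1r addNr.
elim: N => [//|N IH] fN.
have := H N; rewrite fN e0 => /esym/eqP; rewrite scaler_eq0 mulf_eq0 pnatr_eq0 /=.
by case/orP => [|/eqP/IH //]; rewrite subr_eq0 => /eqP ->; exists N.
Qed.

Lemma sl2_nz p u j : u <> 0 ->
  (forall j, e (iter j.+1 f u) = (j.+1%:R * (p%:R - j%:R)) *: iter j f u) ->
  (j <= p)%N -> iter j f u <> 0.
Proof.
move=> un H; have e0 : e 0 = 0 by have := elin (-1) 0 0; rewrite scaler0 addr0 scaleN1r addNr.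
elim: j => [//|j IH] jp fj; apply: (IH (ltnW jp)).
have := H j; rewrite fj e0 => /esym/eqP; rewrite scaler_eq0 mulf_eq0 pnatr_eq0 /=.
by case/orP => [|/eqP //]; rewrite subr_eq0 eqr_nat gtn_eqF.
Qed.

Lemma iter_last x N : x <> 0 -> iter N e x = 0 -> exists k, iter k e x <> 0 /\ e (iter k e x) = 0.
Proof.
move=> xn; elim: N => [//|N IH] eN; have [/IH //|/eqP nz] := eqVneq (iter N e x) 0.
by exists N.
Qed.
End SL2.

(** * Strings and local nilpotency in representations of the affine superalgebra *)

Section Representations.
Variables (C : numClosedFieldType) (m n : nat).
Local Notation I := 'I_(Nd m n).
Local Notation rtmx := (@rootmx C m n).
Variables (V : lmodType C) (rho : hrep m n V).
Hypothesis R : is_rep rho.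
Local Notation opF := (rootop rho).
Local Notation wvec := (weight_vec rho).

Lemma rootop_lin r a b c x y : opF r a b (c *: x + y) = c *: opF r a b x + opF r a b y.
Proof. exact: (rep_lin R). Qed.

Lemma rootop0 r a b : opF r a b 0 = 0. Proof. exact: (rep_0 R). Qed.

Lemma raise_lower mu w r a b : a != b -> b != dual a -> wvec mu w ->
  opF r a b (opF (- r) b a w) = (-1) ^+ (par a (+) par b) *: opF (- r) b a (opF r a b w)
    + coroot mu r a b *: w.
Proof.
move=> ab bda [eH eK _]; rewrite /rootop.
rewrite (rep_br R _ _ _ (@rootmx_hom C m n a b) (@rootmx_hom C m n b a)); try exact: rootmx_osp.
rewrite [par b (+) _]addbC andbb; congr (_ + _).
rewrite sbr_rootmx // subrr eqxx mulr1n mform_rootmx // eK scalerA.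
rewrite [rtmx a a - _]addrC -scaleNr (rep_linX R); try exact: rootmx_diag_hmat.
2: by case: (@rootmx_diag_hmat C m n b).
2: by case: (@rootmx_diag_hmat C m n a).
rewrite !eH; try exact: rootmx_diag_hmat.
rewrite !lamH_rootmx scalerA -!scalerDl; congr (_ *: _); rewrite /coroot; ring.
Qed.

Lemma wvec_iter mu w r a b j : wvec mu w -> wvec (mu + j%:R *: aff_root C r a b) (iter j (opF r a b) w).
Proof.
move=> ww; elim: j => [|j IH]; first by rewrite scale0r addr0.
rewrite iterS -natr1 scalerDl scale1r addrA.
exact: (wvec_rootop R r a b IH).
Qed.

Section EvenPair.
Variables (r : int) (a b : I).
Hypotheses (ab : a != b) (bda : b != dual a) (pa : ~~ par a) (pb : ~~ par b).

Lemma raise_lower_iter mu u j : wvec mu u ->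
  opF r a b (opF (- r) b a (iter j (opF (- r) b a) u)) =
  opF (- r) b a (opF r a b (iter j (opF (- r) b a) u)) +
     (coroot mu r a b - 2 * j%:R) *: iter j (opF (- r) b a) u.
Proof.
move=> wu; rewrite (raise_lower _ ab bda (wvec_iter (- r) b a j wu)).
rewrite (negPf pa) (negPf pb) /= expr0 scale1r; congr (_ + _ *: _).
rewrite aff_rootN scalerN -scaleNr addrC coroot_lin coroot_aff_root //; ring.
Qed.

Lemma sl2_rootop mu u : wvec mu u -> opF r a b u = 0 -> forall j,
  opF r a b (iter j.+1 (opF (- r) b a) u) =
  (j.+1%:R * (coroot mu r a b - j%:R)) *: iter j (opF (- r) b a) u.
Proof.
move=> wu eu; apply: sl2_raise => // [c x y|j]; first exact: rootop_lin.
exact: raise_lower_iter.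
Qed.

Lemma coroot_nat mu u N : wvec mu u -> u <> 0 -> opF r a b u = 0 ->
  iter N (opF (- r) b a) u = 0 -> exists p : nat, coroot mu r a b = p%:R.
Proof.
move=> wu un eu; apply: (@sl2_nat _ _ (opF r a b)) => //; last exact: sl2_rootop.
by move=> *; exact: rootop_lin.
Qed.

(** Raise [w] as far as possible, to a vector [u] that is [k] steps up and has sl(2)-weight [p].
    Lowering [u] by [p - k] steps reaches the reflected weight, and this is possible when
    [k <= p]. *)
Lemma half_refl mu w : wvec mu w -> w <> 0 -> (exists N, iter N (opF r a b) w = 0) ->
  (forall x, exists N, iter N (opF (- r) b a) x = 0) ->
  exists p k : nat, coroot mu r a b = p%:R - 2 * k%:R /\
    ((k <= p)%N -> exists w', w' <> 0 /\ wvec (mu - coroot mu r a b *: aff_root C r a b) w').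
Proof.
move=> ww wn [N eN] fnil.
have [k [un eu]] := iter_last wn eN.
have wu := wvec_iter r a b k ww; set u := iter k _ w in un eu wu.
have [M fM] := fnil u.
have [p ep] := coroot_nat wu un eu fM.
have e1 : coroot mu r a b = p%:R - 2 * k%:R.
  by have := coroot_lin k%:R (aff_root C r a b) mu r a b; rewrite addrC ep coroot_aff_root // => ->; ring.
exists p, k; split=> // kp.
exists (iter (p - k) (opF (- r) b a) u); split.
  apply: (@sl2_nz _ _ (opF r a b) _ _ p) => //; last exact: leq_subr.
    by move=> *; exact: rootop_lin.
  by rewrite -ep; apply: sl2_rootop.
have := wvec_iter (- r) b a (p - k) wu.
rewrite aff_rootN scalerN -addrA -scalerBl natrB // e1.
by rewrite -scaleNr; congr (wvec (_ + _ *: _) _); ring.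
Qed.
End EvenPair.

Lemma refl_weight r a b mu w : a != b -> b != dual a -> ~~ par a -> ~~ par b ->
  wvec mu w -> w <> 0 ->
  (forall x, exists N, iter N (opF (- r) b a) x = 0) ->
  (forall x, exists N, iter N (opF r a b) x = 0) ->
  exists w', w' <> 0 /\ wvec (mu - coroot mu r a b *: aff_root C r a b) w'.
Proof.
move=> ab bda pa pb ww wn fnil enil.
have [p [k [e1 H1]]] := half_refl ab bda pa pb ww wn (enil w) fnil.
(* If [k > p], the roles of the raising and lowering operators are exchanged. The two sl(2)-weights
   [p - 2k] and [p' - 2k'] are opposite, so [k > p] and [k' > p'] cannot hold together. *)
have [/H1 //|pk] := leqP k p.
have adb : a != dual b by rewrite eq_sym (inv_eq (@dualK m n)).
have ba : b != a by rewrite eq_sym.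
have [|p' [k' [e2 H2]]] := half_refl (r := - r) ba adb pb pa ww wn (fnil w).
  by rewrite opprK.
have e3 : coroot mu (- r) b a = - coroot mu r a b.
  by rewrite /coroot (negPf pa) (negPf pb) /= rmorphN /=; ring.
have [|w' [wn' ww']] := H2; last first.
  by exists w'; split=> //; move: ww'; rewrite e3 aff_rootN scalerN scaleNr !opprK.
have : (p' + p)%:R = (2 * k + 2 * k')%N%:R :> C.
  rewrite natrD [RHS]natrD !natrM -[p'%:R](subrK (2 * k'%:R)) -e2 e3 e1; ring.
by move/eqP; rewrite eqr_nat => /eqP; lia.
Qed.

Section Irr.
Hypothesis irr : irreducible rho.

Definition loc_nil (f : V -> V) (w : V) := exists N, iter N f w = 0.

Section LocallyNilpotent.
Variable f : V -> V.
Hypothesis flin : forall a x y, f (a *: x + y) = a *: f x + f y.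

Lemma iter_lin N a x y : iter N f (a *: x + y) = a *: iter N f x + iter N f y.
Proof. by elim: N => //= N ->; rewrite flin. Qed.

Lemma iter_le N M x : (N <= M)%N -> iter N f x = 0 -> iter M f x = 0.
Proof.
move=> NM e; rewrite -(subnK NM) iterD e.
exact: (lin0 (iter_lin _)).
Qed.

Lemma loc_nil_lin a x y : loc_nil f x -> loc_nil f y -> loc_nil f (a *: x + y).
Proof.
move=> [N eN] [M eM]; exists (maxn N M).
by rewrite iter_lin (iter_le (leq_maxl _ _) eN) (iter_le (leq_maxr _ _) eM) scaler0 addr0.
Qed.

Lemma loc_nil0 : loc_nil f 0. Proof. by exists 0%N. Qed.
Lemma loc_nilZ a x : loc_nil f x -> loc_nil f (a *: x).
Proof. by move=> lx; rewrite -[_ *: _]addr0; apply: loc_nil_lin => //; apply: loc_nil0. Qed.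
Lemma loc_nilD x y : loc_nil f x -> loc_nil f y -> loc_nil f (x + y).
Proof. by move=> lx ly; rewrite -[x]scale1r; apply: loc_nil_lin. Qed.

(** Induction on the nilpotency exponent of [w]: in [f (y w) = y (f w) + y' w] the vector [f w] has
    a smaller exponent. *)
Lemma loc_nil_step (y y' : V -> V) : y 0 = 0 -> (forall w, f (y w) = y (f w) + y' w) ->
  (forall w, loc_nil f w -> loc_nil f (y' w)) -> forall w, loc_nil f w -> loc_nil f (y w).
Proof.
move=> y0 fy H w [N]; elim: N w => [|N IH] w /=; first by move=> ->; rewrite y0; apply: loc_nil0.
rewrite -iterS iterSr => eN.
have [M eM] : loc_nil f (f (y w)).
  by rewrite fy; apply: loc_nilD; [apply: IH | apply: H; exists N.+1; rewrite iterSr].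
by exists M.+1; rewrite iterSr.
Qed.
End LocallyNilpotent.

(* [X ^ 2 = 0] gives [(ad X) ^ 3 = 0], so the locally [X]-nilpotent vectors form a
   submodule. *)
Lemma loc_nil_all r X x : osp X -> is_hom false X -> X *m X = 0 -> x <> 0 -> loc_nil (rpi rho r X) x ->
  forall w, loc_nil (rpi rho r X) w.
Proof.
move=> oX hX X2 xn lx; set f := rpi rho r X in lx *.
have fl a u w : f (a *: u + w) = a *: f u + f w by apply: (rep_lin R).
have LK w : loc_nil f w -> loc_nil f (rK rho w).
  case=> N eN; exists N; have -> : iter N f (rK rho w) = rK rho (iter N f w).
    by elim: N {eN} => //= N ->; rewrite /f (rep_KX R).
  by rewrite eN; apply: (lin0 (rep_Klin R)).
have fX s q Y w : is_hom q Y -> osp Y ->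
    f (rpi rho s Y w) = rpi rho s Y (f w) + (rpi rho (r + s) (sbr false q X Y) w
       + ((r%:~R * mform X Y) *+ (r + s == 0)) *: rK rho w).
  by move=> hY oY; rewrite /f (rep_br R _ _ _ hX hY) //= expr0 scale1r.
have D3 q Y : sbr false q X (sbr false q X (sbr false q X Y)) = 0.
  rewrite /sbr /= expr0 !scale1r !(mulmxBl, mulmxBr) !mulmxA X2 !mul0mx.
  by rewrite -!(mulmxA _ X X) X2 ?(mulmx0, mul0mx) ?(subr0, sub0r, oppr0, addr0, add0r).
have S s q Y : is_hom q Y -> osp Y ->
   (forall s' w, loc_nil f w -> loc_nil f (rpi rho s' (sbr false q X Y) w)) ->
   forall w, loc_nil f w -> loc_nil f (rpi rho s Y w).
  move=> hY oY H; apply: (@loc_nil_step f fl (rpi rho s Y) (fun w => rpi rho (r + s) (sbr false q X Y) w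
       + ((r%:~R * mform X Y) *+ (r + s == 0)) *: rK rho w)) => //.
  - exact: (rep_0 R).
  - by move=> w; apply: fX.
  - by move=> w lw; apply: loc_nilD => //; [exact: H | apply: loc_nilZ => //; exact: LK].
have LX s q Y : is_hom q Y -> osp Y -> forall w, loc_nil f w -> loc_nil f (rpi rho s Y w).
  move=> hY oY.
  have h1 := sbr_hom hX hY; have o1 := osp_sbr hX hY oX oY.
  have h2 := sbr_hom hX h1; have o2 := osp_sbr hX h1 oX o1.
  apply: (S s q Y) => // s1; apply: (S s1 _ _ h1) => // s2; apply: (S s2 _ _ h2) => // s3 w lw.
  by rewrite D3 (rep_X0 R); apply: loc_nil0.
have [_ ir] := irr; case: (ir (loc_nil f)) => [|H|//]; last by case: xn; apply: H.
split; first exact: loc_nil0.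
split; first by move=> *; apply: loc_nilD.
split; first by move=> *; apply: loc_nilZ.
split.
  move=> s Y w oY lw; rewrite (rep_expand R) //.
  have LS (T : Type) (t : seq T) (g : T -> V) : (forall i, loc_nil f (g i)) -> loc_nil f (\sum_(i <- t) g i).
    move=> H; elim: t => [|i t IH]; first by rewrite big_nil; apply: loc_nil0.
    by rewrite big_cons; apply: loc_nilD.
  apply: (LS) => a; apply: (LS) => b; apply: loc_nilZ => //.
  by apply: (LX s _ _ (@rootmx_hom C m n a b)) => //; apply: rootmx_osp.
split=> // w lw.
apply: (@loc_nil_step f fl (rD rho) (fun w => (- r%:~R) *: f w)) => //.
- exact: (lin0 (rep_Dlin R)).
- by move=> u; rewrite /f (rep_DX R) // addrC scaleNr addKr.
- by move=> u [N eN]; apply: loc_nilZ => //; exists N; rewrite -iterSr iterS eN; apply: (rep_0 R).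
Qed.
End Irr.
End Representations.

(** * Simple roots and odd reflections *)

Section Simple.
Variables (C : numClosedFieldType) (m n : nat).
Local Notation I := 'I_(Nd m n).
Local Notation rtmx := (@rootmx C m n).
Variables (V : lmodType C) (rho : hrep m n V).
Hypothesis R : is_rep rho.
Hypothesis irr : irreducible rho.
Local Notation opF := (rootop rho).
Local Notation wvec := (weight_vec rho).
Variables (h : I -> int) (h0 : int).
Hypothesis Hh : is_height h h0.
Local Notation deg := (aff_height h h0).
Local Notation singular := (hsingular rho h h0).

Variables (r : int) (a b : I).
Hypotheses (ab : a != b) (bda : b != dual a) (d2 : deg r a b = 2).
Let h_dual x : h (dual x) = - h x. Proof. by case: Hh. Qed.
Local Notation f := (opF (- r) b a).

(* The two names, by [rootop_dual], of the root vector of the simple root under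
   consideration. *)
Definition is_pair (s : int) (c d : I) := s = r /\ ((c = a /\ d = b) \/ (c = dual b /\ d = dual a)).

(** Subtracting a simple root from another positive root never leads to a negative root. Bracketing
    with [f] lowers the height by 2, and heights are even, so the result has height at least 0.
    Height 0 would need a diagonal entry, excluded by [sbr_rootmx_diag]; in positive height the
    induction applies unless the simple root vector itself appears, excluded by
    [sbr_rootmx_simple]. *)
Lemma simple_kill u j s c d : singular u -> root_pair c d -> 0 < deg s c d -> ~ is_pair s c d ->
  opF s c d (iter j f u) = 0.
Proof.
move=> su; elim: j s c d => [|j IH] s c d nz pos np /=; first exact: su.
rewrite /rootop; set z := iter j _ u.
have oY := osp_sbr (@rootmx_hom C m n c d) (@rootmx_hom C m n b a) (rootmx_osp C c d) (rootmx_osp C b a).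
rewrite (rep_br R _ _ _ (@rootmx_hom C m n c d) (@rootmx_hom C m n b a)); try exact: rootmx_osp.
rewrite -/(opF s c d z) IH // (rep_0 R) scaler0 add0r.
have no : s = r -> ~ (c = a /\ d = b) /\ ~ (c = dual b /\ d = dual a).
  by move=> sr; split=> H; apply: np; split=> //; [left|right].
have -> : ((s%:~R * mform (rtmx c d) (rtmx b a)) *+ (s - r == 0)) *: rK rho z = 0.
  have [/eqP|_] := eqVneq (s - r) 0; last by rewrite mulr0n scale0r.
  by rewrite subr_eq0 => /eqP/no[n1 n2]; rewrite mform_rootmx0 // mulr0 mul0rn scale0r.
rewrite addr0 (rep_expand R) // big1 // => x _; rewrite big1 // => y _.
set Y := sbr _ _ _ _ in oY *.
have [->|Yn] := eqVneq (Y x y) 0; first by rewrite mul0r scale0r.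
have [nzx|/(rootop_zero R (s - r) z) ->] := boolP (root_pair x y); last by rewrite scaler0.
have gr := sbr_rootmx_grade h_dual Yn.
have dg : deg (s - r) x y = deg s c d - 2 by rewrite -d2 /aff_height gr; ring.
have [k ek] := aff_height_even Hh s c d.
have ge0 : 0 <= deg (s - r) x y by lia.
case: (ltrgtP 0 (deg (s - r) x y)) ge0 => // dp _.
  rewrite IH ?scaler0 // => -[_ [[ex ey]|[ex ey]]]; case/eqP: Yn.
    by rewrite ex ey sbr_rootmx_simple.
  have /ospP -> := oY; rewrite ex ey !dualK sbr_rootmx_simple ?mulr0 //.
have [/eqP] := aff_height_zero Hh nzx (esym dp); rewrite subr_eq0 => /eqP/no [n1 n2] exy.
by case/eqP: Yn; rewrite exy sbr_rootmx_diag.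
Qed.

Lemma singular_iter u j : singular u -> opF r a b (iter j f u) = 0 -> singular (iter j f u).
Proof.
move=> su e0 s c d nz pos.
have [sr|ns] := eqVneq s r; last by apply: simple_kill => // -[/eqP]; rewrite (negPf ns).
have [/andP[/eqP -> /eqP ->]|n1] := boolP ((c == a) && (d == b)); first by rewrite sr.
have [/andP[/eqP -> /eqP ->]|n2] := boolP ((c == dual b) && (d == dual a)).
  by rewrite sr (rootop_dual R) e0 scaler0.
apply: simple_kill => // -[_ [[ec ed]|[ec ed]]].
  by rewrite ec ed !eqxx in n1.
by rewrite ec ed !eqxx in n2.
Qed.

(** If nonzero, the vector would be singular and hence generate the module, so the height of [u]
    could not exceed its own. But it lies [2 * j] below [u]. *)
Lemma singular_low mu u j : wvec mu u -> singular u -> u <> 0 -> (0 < j)%N ->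
  opF r a b (iter j f u) = 0 -> iter j f u = 0.
Proof.
move=> wu su un j0 e0; have s2 := singular_iter su e0.
have w2 := wvec_iter R (- r) b a j wu; set w := iter j f u in s2 w2 *.
apply/eqP; apply: contraT => /eqP wn.
have [k] := hw_height_wt R Hh irr s2 w2 wn wu un.
rewrite [X in height_wt _ _ X - _]addrC height_wt_lin height_wt_aff_root //.
have -> : deg (- r) b a = - 2 by rewrite -d2 /aff_height; ring.
move/eqP; rewrite -subr_eq0.
have -> : height_wt h h0 mu - (j%:R * (- 2)%:~R + height_wt h h0 mu - k%:R) = (2 * j + k)%:R :> C.
  by rewrite natrD natrM rmorphN /=; ring.
by rewrite pnatr_eq0; lia.
Qed.

Lemma even_vanish mu u p : ~~ par a -> ~~ par b -> wvec mu u -> singular u -> u <> 0 ->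
  coroot mu r a b = p%:R -> iter p.+1 f u = 0.
Proof.
move=> pa pb wu su un ep; apply: (singular_low wu su un) => //.
rewrite (sl2_rootop R ab bda pa pb wu) ?ep ?subrr ?mulr0 ?scale0r //.
by apply: su; rewrite ?d2 // /root_pair bda.
Qed.

Section Odd.
Hypotheses (r0 : r = 0) (pab : par a (+) par b).

(** For an odd operator the superbracket with itself is twice the square, and it vanishes here
    because the root vector has square zero as a matrix. *)
Lemma odd_sq w : f (f w) = 0.
Proof.
have hF : is_hom true (rtmx b a) by move: (@rootmx_hom C m n b a); rewrite addbC pab.
rewrite /rootop r0 oppr0.
have := rep_br R 0 0 w hF hF (rootmx_osp C b a) (rootmx_osp C b a).
have -> : sbr true true (rtmx b a) (rtmx b a) = 0.
  by rewrite /sbr rootmx_sq 1?eq_sym // scaler0 subr0.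
rewrite (rep_X0 R) mul0r mul0rn scale0r !addr0 /= expr1 scaleN1r => /eqP.
rewrite -subr_eq0 opprK -mulr2n -scaler_nat scaler_eq0 pnatr_eq0 /=.
by move/eqP.
Qed.

Lemma odd_ef mu u : wvec mu u -> singular u -> opF r a b (f u) = coroot mu r a b *: u.
Proof.
move=> wu su; rewrite (raise_lower R r ab bda wu) su ?d2 //; last by rewrite /root_pair bda.
by rewrite rootop0 // scaler0 add0r.
Qed.

Lemma odd_vanish mu u : wvec mu u -> singular u -> u <> 0 -> coroot mu r a b = 0 -> f u = 0.
Proof.
move=> wu su un h0'; apply: (@singular_low mu u 1%N) => //=.
by rewrite (odd_ef wu su) h0' scale0r.
Qed.

Section Reflect.
Variables (h' : I -> int).
Hypothesis Href : forall s c d, root_pair c d -> 0 < aff_height h' h0 s c d ->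
   (0 < deg s c d /\ ~ is_pair s c d) \/ (s = 0 /\ ((c = b /\ d = a) \/ (c = dual a /\ d = dual b))).

(** By [Href] the only new positive root is the negative of the reflected one, and its root vector
    is [f]. *)
Lemma singular_refl u : singular u -> f u = 0 -> hsingular rho h' h0 u.
Proof.
move=> su fu s c d nz /(Href nz) [[pos _]|[-> [[-> ->]|[-> ->]]]]; first exact: su.
  by move: fu; rewrite r0 oppr0.
by rewrite (rootop_dual R) -[X in _ *: opF X _ _ _]oppr0 -r0 fu scaler0.
Qed.

(** The new positive root is handled by [f (f u) = 0], and the old ones other than the reflected
    root by [simple_kill]. *)
Lemma singular_refl_f u : singular u -> hsingular rho h' h0 (f u).
Proof.
move=> su s c d nz /(Href nz) [[pos np]|[-> [[-> ->]|[-> ->]]]].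
- exact: (@simple_kill u 1).
- by move: (odd_sq u); rewrite r0 oppr0.
- by rewrite (rootop_dual R) -[X in _ *: opF X _ _ (opF _ _ _ u)]oppr0 -{1}r0 odd_sq scaler0.
Qed.
End Reflect.
End Odd.

End Simple.

(** * The bases of the affine root system *)

Section Heights.
Variables (C : numClosedFieldType) (m n : nat).
Hypotheses (nm : (n + 2 < m)%N) (n1 : (1 <= n)%N).
Local Notation I := 'I_(Nd m n).
Local Notation Mat := 'M[C]_(Nd m n).
Local Notation hw := (hw C m n).
Local Notation rtmx := (@rootmx C m n).

(* Position of [+-eps_(i+1)] in the chain eps_1 < delta_1 < eps_2 < ... < delta_n <
   eps_(n+1) < eps_(n+2) < ... < eps_m whose successive differences are, together
   with delta_1 + eps_1, the simple roots. *)
Definition eps_rank (i : nat) : nat := if (i < n)%N then (2 * i)%N else (n + i)%N.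
Definition idx_rank : I -> nat :=
  idx_rect_def (fun i : 'I_m => eps_rank i) (fun i : 'I_m => eps_rank i)
    (fun j : 'I_n => (2 * j).+1) (fun j : 'I_n => (2 * j).+1).
Definition idx_pos : I -> bool := idx_rect_def xpredT xpred0 xpredT xpred0.

Lemma idx_rank_dual a : idx_rank (dual a) = idx_rank a.
Proof. by case: (idxP a) => i; rewrite /idx_rank /dual !idxE. Qed.
Lemma idx_pos_dual a : idx_pos (dual a) = ~~ idx_pos a.
Proof. by case: (idxP a) => i; rewrite /idx_pos /dual !idxE. Qed.
Lemma idx_rank_lt a : (idx_rank a < m + n)%N.
Proof.
by case: (idxP a) => i; rewrite /idx_rank !idxE /eps_rank; have := ltn_ord i; try case: ifP; lia.
Qed.
Lemma idx_rank_inj a b : idx_rank a = idx_rank b -> idx_pos a = idx_pos b -> a = b.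
Proof.
case: (idxP a) => i; case: (idxP b) => j; rewrite /idx_rank /idx_pos !idxE /eps_rank => e // _;
  have := ltn_ord i; have := ltn_ord j => hj hi.
- by congr ep; apply/val_inj => /=; move: e; case: ifP; case: ifP; lia.
- by exfalso; move: e; case: ifP; lia.
- by congr em; apply/val_inj => /=; move: e; case: ifP; case: ifP; lia.
- by exfalso; move: e; case: ifP; lia.
- by exfalso; move: e; case: ifP; lia.
- by congr fp; apply/val_inj => /=; move: e; lia.
- by exfalso; move: e; case: ifP; lia.
- by congr fm; apply/val_inj => /=; move: e; lia.
Qed.
Lemma par_rank0 a : idx_rank a = 0%N -> par a = false.
Proof. by case: (idxP a) => i; rewrite /idx_rank !idxE parE. Qed.
Lemma par_rank_max a : idx_rank a = (m + n).-1 -> par a = false.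
Proof.
by case: (idxP a) => i; rewrite /idx_rank !idxE parE //; have := ltn_ord i; lia.
Qed.

(* [s = false] is the given base, in which delta_1 - eps_1 has height 2 and
   delta_1 + eps_1 height 4; [s = true] exchanges the two by eps_1 -> -eps_1, with
   the same positive roots. *)
Definition std_height (s : bool) (a : I) : int :=
  (if idx_pos a then 1 else -1) * (if s && (idx_rank a == 0%N) then -1 else 2 * (idx_rank a)%:Z + 1).
Definition max_height : int := 2 * (m + n)%:Z - 1.
(** The two largest values are [max_height], at eps_m, and [max_height - 2], at eps_(m-1). With this
    height of delta the affine root [delta - eps_m - eps_(m-1)] gets height 2, as a simple root
    should. *)
Definition delta_height : int := 2 * max_height.

Lemma std_height_spec s a : exists x : int, [/\ std_height s a = (if idx_pos a then x else - x),
  (idx_rank a <> 0%N -> x = 2 * (idx_rank a)%:Z + 1) & (idx_rank a = 0%N -> x = if s then -1 else 1)].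
Proof.
rewrite /std_height; exists (if s && (idx_rank a == 0%N) then -1 else 2 * (idx_rank a)%:Z + 1); split.
- by case: idx_pos; rewrite ?mul1r ?mulN1r.
- by move/eqP/negPf ->; rewrite andbF.
- by move=> ->; rewrite eqxx andbT; case: s.
Qed.

Lemma std_height_bd s a : - max_height <= std_height s a <= max_height.
Proof.
have [x [-> e1 e2]] := std_height_spec s a; have := idx_rank_lt a.
rewrite /max_height; case: (eqVneq (idx_rank a) 0%N) => [/e2 ->|/eqP /e1 ->]; last by case: idx_pos; lia.
by case: s {e1 e2}; case: idx_pos; lia.
Qed.

Lemma std_height_dual s a : std_height s (dual a) = - std_height s a.
Proof. by rewrite /std_height idx_pos_dual idx_rank_dual; case: idx_pos; rewrite /= ?mul1r ?mulN1r ?opprK. Qed.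

Lemma std_height_inj s : injective (std_height s).
Proof.
move=> a b; have [x [-> e1 e2]] := std_height_spec s a; have [y [-> e3 e4]] := std_height_spec s b.
move=> e; suff [e5 e6] : idx_rank a = idx_rank b /\ idx_pos a = idx_pos b by apply: idx_rank_inj.
case: (eqVneq (idx_rank a) 0%N) => [/[dup] ra /e2|/eqP /[dup] ra /e1] ex;
  case: (eqVneq (idx_rank b) 0%N) => [/[dup] rb /e4|/eqP /[dup] rb /e3] ey; subst x y;
  move: e; case: (idx_pos a); case: (idx_pos b); case: (s) => e; split=> //; lia.
Qed.

Lemma std_height_odd s a : exists k, std_height s a = 2 * k + 1.
Proof.
have [x [-> e1 e2]] := std_height_spec s a.
have [y ->] : exists y, x = 2 * y + 1.
  case: (eqVneq (idx_rank a) 0%N) => [/e2 ->|/eqP /e1 ->]; last by exists (idx_rank a)%:Z.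
  by case: s {e1 e2}; [exists (-1)|exists 0].
case: idx_pos; first by exists y.
by exists (- y - 1); ring.
Qed.

(** The extreme difference would belong to 2 eps_m, which is not a root. This makes the bound by
    [delta_height] strict. *)
Lemma std_height_max s a b : root_pair a b -> ~ (std_height s a = max_height /\ std_height s b = - max_height).
Proof.
move=> nz [ea eb]; have eba : b = dual a by apply: (@std_height_inj s); rewrite std_height_dual ea.
have [x [ex e1 e2]] := std_height_spec s a.
have ra : idx_rank a = (m + n).-1.
  have := idx_rank_lt a; move: ea; rewrite ex /max_height.
  case: (eqVneq (idx_rank a) 0%N) => [/[dup] ra /e2 ->|/eqP /e1 ->]; last by case: idx_pos; lia.
  by rewrite ra; case: s {e1 e2 eb ex}; case: idx_pos; lia.
by move: nz; rewrite /root_pair eba eqxx (par_rank_max ra).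
Qed.

Lemma std_height_is_height s : is_height (std_height s) delta_height.
Proof.
split; [exact: std_height_dual|exact: std_height_inj|exact: std_height_odd|by exists max_height|].
split; first by rewrite /delta_height /max_height; lia.
move=> a b nz; have /andP[] := std_height_bd s a; have /andP[] := std_height_bd s b.
have := @std_height_max s _ _ nz; rewrite /delta_height; lia.
Qed.

(* Exchanging the consecutive values [v] and [v + 2] is the reflection in the
   odd simple root that they define. *)
Definition swap_height (v x : int) : int :=
  if x == v then v + 2 else if x == v + 2 then v
  else if x == - v then - (v + 2) else if x == - (v + 2) then - v else x.

Definition refl_height s v a := swap_height v (std_height s a).

(** Since [v + 2 < max_height], the exchange leaves the extreme values in place, so the strict bound
    by [delta_height] survives. *)
Lemma refl_height_is_height s v : 0 < v -> (exists k, v = 2 * k + 1) -> v + 2 < max_height ->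
  is_height (refl_height s v) delta_height.
Proof.
move=> v0 [l vl] vm; split.
- by move=> a; rewrite /refl_height std_height_dual /swap_height; do ! case: eqP; lia.
- move=> a b e; apply: (@std_height_inj s); move: e; rewrite /refl_height /swap_height.
  by do ! case: eqP; lia.
- move=> a; have [k ek] := std_height_odd s a; rewrite /refl_height /swap_height.
  do ! case: eqP => ?.
  + by exists (l + 1); rewrite vl; ring.
  + by exists l.
  + by exists (- l - 2); rewrite vl; ring.
  + by exists (- l - 1); rewrite vl; ring.
  + by exists k.
- by exists max_height.
- split; first by rewrite /delta_height /max_height; lia.
  move=> a b nz; have /andP[] := std_height_bd s a; have /andP[] := std_height_bd s b.
  have := @std_height_max s _ _ nz; rewrite /delta_height /refl_height /swap_height.
  by do ! case: eqP; lia.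
Qed.

(** For [t] nonzero both heights have the sign of [t]. For [t = 0], all values are odd, so [v] and
    [v + 2] are adjacent, and exchanging them reverses the order of this pair and of its negative
    only. *)
Lemma refl_height_pos s v a b : 0 < v -> (exists k, v = 2 * k + 1) -> v + 2 < max_height ->
  std_height s a = v + 2 -> std_height s b = v ->
  forall t c d, root_pair c d -> 0 < aff_height (refl_height s v) delta_height t c d ->
   (0 < aff_height (std_height s) delta_height t c d /\ ~ is_pair 0 a b t c d) \/
   (t = 0 /\ ((c = b /\ d = a) \/ (c = dual a /\ d = dual b))).
Proof.
move=> v0 vo vm ea eb t c d nz.
have /andP[b1 b2] := h_bound (refl_height_is_height s v0 vo vm) nz.
have /andP[b3 b4] := h_bound (std_height_is_height s) nz.
have h0p := h0_gt0 (std_height_is_height s).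
have [tp|tn|t0] := ltrgtP t 0; rewrite /aff_height.
- by move=> pos; exfalso; nia.
- by move=> _; left; split; [nia|case => e; rewrite e in tn].
rewrite t0 !mul0r !addr0 => pos.
have inj x y : std_height s x = std_height s y -> x = y by apply: std_height_inj.
have hd := std_height_dual s.
have [p|np] := boolP (0 < std_height s c - std_height s d).
  left; split=> // -[_ [[ec ed]|[ec ed]]]; move: pos; rewrite ec ed /refl_height ?hd ea eb /swap_height;
  by do ! case: eqP; lia.
right; split=> //.
have [[e1 e2]|[e1 e2]] : (std_height s c = v /\ std_height s d = v + 2) \/ (std_height s c = - (v + 2) /\
  std_height s d = - v).
  have [k1 o1] := std_height_odd s c; have [k2 o2] := std_height_odd s d; case: vo => k3 o3.
  by move: pos np; rewrite /refl_height /swap_height; do ! case: eqP; lia.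
  by left; split; apply: inj; lia.
by right; split; apply: inj; rewrite hd; lia.
Qed.

Local Notation Q := (@inQplus C m n).
Local Notation sr := (simple_roots C m n).

Lemma inQplus0 : Q 0.
Proof. by exists (fun=> 0%N); rewrite big1 // => i _; rewrite scale0r. Qed.
Lemma inQplusD x y : Q x -> Q y -> Q (x + y).
Proof.
move=> [c ->] [d ->]; exists (fun i => (c i + d i)%N); rewrite -big_split.
by apply: eq_bigr => i _; rewrite natrD scalerDl.
Qed.
Lemma inQplus_simple x : x \in sr -> Q x.
Proof.
move=> xs; exists (fun i => nat_of_bool (i == index x sr)).
have lt : (index x sr < size sr)%N by rewrite index_mem.
rewrite (bigD1 (Ordinal lt)) //= big1 ?addr0.
  by rewrite eqxx scale1r nth_index.
by move=> i /eqP ni; case: eqP => [e|_]; rewrite ?scale0r //; case: ni; apply/val_inj.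
Qed.

(* The weight of rank [k] in the chain described at [eps_rank]. *)
Definition ranked_wt (k : nat) : hw :=
  if (k < 2 * n)%N then (if odd k then dltw C m n k./2.+1 else epsw C m n k./2.+1)
  else epsw C m n (k - n).+1.

Lemma idx_wt_ranked a : idx_wt C a = (if idx_pos a then ranked_wt (idx_rank a) else - ranked_wt (idx_rank a)).
Proof.
case: (idxP a) => i; rewrite /idx_wt /idx_pos /idx_rank !idxE /ranked_wt /eps_rank; have li := ltn_ord i.
- case: (ltnP i n) => ni; first by rewrite (_ : (2 * i < 2 * n)%N) ?mul2n ?odd_double ?half_double //; lia.
  by rewrite (_ : (n + i < 2 * n)%N = false) ?addKn //; lia.
- case: (ltnP i n) => ni; first by rewrite (_ : (2 * i < 2 * n)%N) ?mul2n ?odd_double ?half_double //; lia.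
  by rewrite (_ : (n + i < 2 * n)%N = false) ?addKn //; lia.
- by rewrite (_ : ((2 * i).+1 < 2 * n)%N) ?mul2n /= ?odd_double ?uphalf_double //; lia.
- by rewrite (_ : ((2 * i).+1 < 2 * n)%N) ?mul2n /= ?odd_double ?uphalf_double //; lia.
Qed.

Lemma ranked_wt_step k : (k.+1 < m + n)%N -> Q (ranked_wt k.+1 - ranked_wt k).
Proof.
move=> km; apply: inQplus_simple; rewrite /simple_roots !mem_cat /ranked_wt.
have ek := odd_double_half k; set j := k./2 in ek *.
have ej : uphalf k = (j + odd k)%N by rewrite uphalf_half addnC.
have [k2|k2] := ltnP k (2 * n).
  case ok: (odd k) ek ej => ek ej.
    have [k3|k3] := ltnP k.+1 (2 * n).
      rewrite oddS ok /= ej addn1; apply/orP; right; apply/orP; right; apply/orP; right; apply/orP; left.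
      by apply/mapP; exists j.+1 => //; rewrite mem_iota; lia.
    have -> : (k.+1 - n = n)%N by lia.
    have -> : j.+1 = n by lia.
    by apply/orP; right; apply/orP; left; rewrite inE.
  have k3 : (k.+1 < 2 * n)%N by move: ok; lia.
  rewrite k3 oddS ok /= ej addn0.
  apply/orP; right; apply/orP; right; apply/orP; left.
  by apply/mapP; exists j.+1 => //; rewrite mem_iota; lia.
rewrite ltnNge (leqW k2) /=; apply/orP; left.
by apply/mapP; exists (k - n).+1; [rewrite mem_iota; lia|rewrite subSn //; lia].
Qed.

Lemma ranked_wt_le k l : (k <= l)%N -> (l < m + n)%N -> Q (ranked_wt l - ranked_wt k).
Proof.
elim: l => [|l IH] kl lm; first by move: kl; rewrite leqn0 => /eqP ->; rewrite subrr; apply: inQplus0.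
move: kl; rewrite leq_eqVlt => /orP[/eqP ->|kl]; first by rewrite subrr; apply: inQplus0.
have -> : ranked_wt l.+1 - ranked_wt k = (ranked_wt l.+1 - ranked_wt l) + (ranked_wt l - ranked_wt k) by rewrite
  addrA subrK.
by apply: inQplusD; [apply: ranked_wt_step | apply: IH => //; lia].
Qed.

Lemma ranked_wt_fork : Q (ranked_wt 1 + ranked_wt 0).
Proof.
apply: inQplus_simple; rewrite /simple_roots !mem_cat; apply/orP; right; apply/orP; right; apply/orP; right;
  apply/orP; right.
have l0 : (0 < 2 * n)%N by lia.
have l1 : (1 < 2 * n)%N by lia.
by rewrite /ranked_wt l0 l1 inE.
Qed.

Lemma ranked_wt_add k l : (k < m + n)%N -> (l < m + n)%N -> (0 < k)%N -> Q (ranked_wt k + ranked_wt l).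
Proof.
move=> km lm k0.
have -> : ranked_wt k + ranked_wt l = (ranked_wt k - ranked_wt 1) + ((ranked_wt l - ranked_wt 0) + (ranked_wt 1 +
  ranked_wt 0)).
  by rewrite [ranked_wt 1 + _]addrC (addrA (ranked_wt l - _)) subrK [ranked_wt l + _]addrC addrA subrK.
apply: inQplusD; first exact: ranked_wt_le.
by apply: inQplusD; [apply: ranked_wt_le|exact: ranked_wt_fork].
Qed.

(** A positive root is a difference or a sum of two ranked weights. A difference telescopes along
    the chain; a sum telescopes down to [ranked_wt 1 + ranked_wt 0], the simple root delta_1 +
    eps_1. *)
Lemma pos_inQplus s a b : root_pair a b -> std_height s b < std_height s a -> Q (idx_wt C a - idx_wt C b).
Proof.
move=> nz; have [x [-> e1 e2]] := std_height_spec s a; have [y [-> e3 e4]] := std_height_spec s b.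
have la := idx_rank_lt a; have lb := idx_rank_lt b.
rewrite !idx_wt_ranked; case pa : (idx_pos a); case pb : (idx_pos b) => lt.
- apply: ranked_wt_le => //.
  case: (eqVneq (idx_rank a) 0%N) => [/[dup] ra /e2|/eqP /[dup] ra /e1] ex;
  case: (eqVneq (idx_rank b) 0%N) => [/[dup] rb /e4|/eqP /[dup] rb /e3] ey; subst x y;
  move: lt; case: (s); lia.
- rewrite opprK; case: (posnP (idx_rank a)) => ra; last exact: ranked_wt_add.
  case: (posnP (idx_rank b)) => rb; last by rewrite addrC; apply: ranked_wt_add.
  (* Two vectors of rank 0 and opposite sign are dual and even: the weight would be a multiple 2
     eps_1 up to sign, not a root. *)
  have : b = dual a by apply: idx_rank_inj; rewrite ?idx_rank_dual ?idx_pos_dual ?pa ?pb ?ra.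
  by move=> eb; move: nz; rewrite /root_pair eb eqxx par_rank0.
- exfalso.
  case: (eqVneq (idx_rank a) 0%N) => [/[dup] ra /e2|/eqP /[dup] ra /e1] ex;
  case: (eqVneq (idx_rank b) 0%N) => [/[dup] rb /e4|/eqP /[dup] rb /e3] ey; subst x y;
  try by move: lt; case: (s); lia.
  have : b = dual a by apply: idx_rank_inj; rewrite ?idx_rank_dual ?idx_pos_dual ?pa ?pb ?ra.
  by move=> eb; move: nz; rewrite /root_pair eb eqxx par_rank0.
- rewrite opprK addrC; apply: ranked_wt_le => //.
  case: (eqVneq (idx_rank a) 0%N) => [/[dup] ra /e2|/eqP /[dup] ra /e1] ex;
  case: (eqVneq (idx_rank b) 0%N) => [/[dup] rb /e4|/eqP /[dup] rb /e3] ey; subst x y;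
  move: lt; case: (s); lia.
Qed.

Lemma rootmx_nz a b : root_pair a b -> rtmx a b != 0.
Proof.
move=> nz; apply/eqP => /matrixP/(_ a b); rewrite rootmxE !eqxx mxE /=.
case: andP => [[/eqP ea /eqP eb]|_]; last by rewrite mulr0n mulr0 subr0 => /eqP; rewrite oner_eq0.
have pa : par a by move: nz; rewrite /root_pair eb eqxx.
rewrite eb /dsign /dsignb par_dual isfp_dual pa mulr1.
have -> : true (+) true (+) isfp a (+) (true (+) isfp a) = true by case: (isfp a).
by rewrite expr1 opprK => /eqP; rewrite (_ : 1 + 1 = 2%:R) ?pnatr_eq0.
Qed.

Lemma idx_wtB_neq0 (a b : I) : a != b -> idx_wt C a - idx_wt C b <> 0.
Proof.
move=> ab e; have := idx_coord_wt C a a; rewrite eqxx eq_sym dual_neq subr0.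
have -> : idx_wt C a = idx_wt C b by apply/eqP; rewrite -subr_eq0 e.
rewrite idx_coord_wt [b == a]eq_sym (negPf ab) sub0r mulr1n => /esym/eqP.
case: (b == dual a); last by rewrite oppr0 oner_eq0.
by rewrite -subr_eq0 opprK (_ : 1 + 1 = 2%:R) ?pnatr_eq0.
Qed.

Lemma pos_root s a b : root_pair a b -> std_height s b < std_height s a -> posroot (idx_wt C a - idx_wt C b).
Proof.
move=> nz lt; split; last exact: pos_inQplus nz lt.
split; first exact: idx_wtB_finw.
split; last by exists (rtmx a b); split; [exact: rootmx_root|exact/eqP/rootmx_nz].
by apply: idx_wtB_neq0; apply/eqP => e; rewrite e ltxx in lt.
Qed.

Lemma hw_singular s (V : lmodType C) (rho : hrep m n V) L v :
  hwvec rho L v -> hsingular rho (std_height s) delta_height v.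
Proof.
move=> [_ [_ [_ [_ [H0 H1]]]]] r a b nz pos.
have /andP[b1 b2] := h_bound (std_height_is_height s) nz.
have [rn|rp|r0] := ltrgtP r 0.
- by exfalso; move: pos; rewrite /aff_height; nia.
- by apply: H1 => //; apply: rootmx_osp.
- rewrite /rootop r0; apply: H0 (rootmx_root C a b); apply: (@pos_root s) => //.
  by move: pos; rewrite /aff_height r0 mul0r; lia.
Qed.

Lemma hw_wvec (V : lmodType C) (rho : hrep m n V) L v : hwvec rho L v -> weight_vec rho L v.
Proof. by move=> [_ [? [? [? _]]]]. Qed.

Lemma rootspace_supp al (X : Mat) (a b : I) : finw al -> rootspace al X -> X a b != 0 -> idx_wt C a - idx_wt C b = al.
Proof.
move=> [f1 f2] [oX eX] nz.
have E c : idx_coord (idx_wt C a - idx_wt C b) c = idx_coord al c.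
  have hF := @rootmx_diag_hmat C m n c; have deg_fun : forall x y, x != y -> rtmx c c x y = 0 by case: hF.
  have := eX _ hF => /matrixP/(_ a b); rewrite lamH_rootmx !mxE.
  rewrite (bigD1 a) //= big1 ?addr0; last by move=> x nx; rewrite deg_fun ?mul0r // eq_sym.
  rewrite (bigD1 b) //= big1 ?addr0; last by move=> x nx; rewrite deg_fun ?mulr0.
  rewrite [X a b * _]mulrC -mulrBl => /(mulIf nz) <-.
  by rewrite -lamH_rootmx lamH_idx_wtB.
apply: wc_ext => k lk.
have [km|mk] := ltnP k m.
  by have := E (ep n (Ordinal km)); rewrite /idx_coord !idxE.
have [kn|nk] := ltnP k (m + n).
  have kmn : (k - m < n)%N by lia.
  by have := E (fp m (Ordinal kmn)); rewrite /idx_coord !idxE /= subnKC.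
have [g1 g2] := idx_wtB_finw C a b.
have [->|->] : k = (m + n)%N \/ k = (m + n).+1 by lia.
  by rewrite g1 f1.
by rewrite g2 f2.
Qed.

(** The root space is one-dimensional. A nonzero entry [(x, y)] must have the weight of [(a, b)],
    and comparing the coordinates along [a] and [b] determines [(x, y)] up to duality; the symmetry
    of osp relates the two remaining entries. *)
Lemma rootspace_rootmx (X : Mat) (a b : I) : a != b -> b != dual a -> rootspace (idx_wt C a - idx_wt C b) X ->
  X = X a b *: rtmx a b.
Proof.
move=> ab bda rX; have [oX _] := rX.
have adb : (a == dual b) = false by rewrite eq_sym (inv_eq (@dualK m n)); apply: negPf.
have S x y : X x y != 0 -> (x = a /\ y = b) \/ (x = dual b /\ y = dual a).
  move/(rootspace_supp (idx_wtB_finw C a b) rX) => e.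
  have G c : idx_coord (idx_wt C x - idx_wt C y) c = idx_coord (idx_wt C a - idx_wt C b) c by rewrite e.
  have G' c : (x == c)%:R - (x == dual c)%:R - ((y == c)%:R - (y == dual c)%:R) =
      (a == c)%:R - (a == dual c)%:R - ((b == c)%:R - (b == dual c)%:R) :> C.
    by move: (G c); rewrite ![idx_wt _ _ - idx_wt _ _]addrC -!scaleN1r !idx_coord_lin !idx_coord_wt !mulN1r ![- _ +
      _]addrC.
  (* Over the integers the identity is a statement about finitely many booleans. *)
  have {}G' c : (x == c)%:Z - (x == dual c)%:Z - ((y == c)%:Z - (y == dual c)%:Z) =
      (a == c)%:Z - (a == dual c)%:Z - ((b == c)%:Z - (b == dual c)%:Z).
    by apply: (@intr_inj C); rewrite !rmorphB /=; exact: G'.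
  have := G' a; have := G' b; rewrite !eqxx [b == a]eq_sym (negPf ab) (negPf bda) adb.
  rewrite ![_ == dual _]eq_sym !dual_neq ![dual _ == _]eq_sym => e2 e1.
  have : (x == a) || (y == dual a)
    by apply: contra_eqT e1; rewrite negb_or => /andP[/negPf -> /negPf ->]; case: (x == _); case: (y == _).
  have : (y == b) || (x == dual b)
    by apply: contra_eqT e2; rewrite negb_or => /andP[/negPf -> /negPf ->]; case: (x == _); case: (y == _).
  case/orP=> /eqP eb /orP[] /eqP ea; try by [left | right].
    by rewrite eb in ea; case/eqP: bda.
  by rewrite -ea eb eqxx in adb.
apply/matrixP => x y; rewrite !mxE -/(rootmx C a b x y).
have [xy0|/S [] [-> ->]] := eqVneq (X x y) 0; last 2 first.
- by rewrite !eqxx (negPf bda) andbF mulr0 subr0 mulr1.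
- have /ospP -> := oX; rewrite !dualK dsign_dual !eqxx eq_sym adb /= mulr0n mulr1n; ring.
rewrite xy0; case: andP => [[/eqP e1 /eqP e2]|_].
  by rewrite -e1 -e2 xy0 mul0r.
case: andP => [[/eqP e1 /eqP e2]|_]; last by rewrite mulr0 subr0 mulr0.
have /ospP := oX => /(_ a b); rewrite -e1 -e2 xy0 mulr0 => ->; by rewrite mul0r.
Qed.

Lemma ranked_wt_idx k : (k < m + n)%N -> exists2 a, idx_pos a & idx_rank a = k.
Proof.
move=> km; have [k2|k2] := ltnP k (2 * n).
  have ek := odd_double_half k; case ok : (odd k) ek => ek.
    have l : (k./2 < n)%N by lia.
    by exists (fp m (Ordinal l)); rewrite /idx_pos /idx_rank !idxE //=; lia.
  have l : (k./2 < m)%N by lia.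
  exists (ep n (Ordinal l)); rewrite /idx_pos /idx_rank !idxE //= /eps_rank.
  by case: ifP; lia.
have l : (k - n < m)%N by lia.
exists (ep n (Ordinal l)); rewrite /idx_pos /idx_rank !idxE //= /eps_rank.
by case: ifP; lia.
Qed.

Local Notation hgt s := (height_wt (std_height s) delta_height).

Lemma height_wt_idx_wt s (a : I) : hgt s (idx_wt C a) = (std_height s a)%:~R.
Proof.
rewrite /height_wt lamH_idx_wt; last exact: (height_mx_hmat _ (std_height_is_height s)).
by rewrite mxE eqxx idx_wt_del mulr0 addr0.
Qed.

Lemma height_wt_ranked s k : (k < m + n)%N -> exists x : int, hgt s (ranked_wt k) = x%:~R /\
  (k <> 0%N -> x = 2 * k%:Z + 1) /\ (k = 0%N -> x = if s then -1 else 1).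
Proof.
move=> km; have [a pa ra] := ranked_wt_idx km; exists (std_height s a).
by have := std_height_spec s a; have := idx_wt_ranked a; rewrite pa ra -height_wt_idx_wt => -> [x [-> e1 e2]].
Qed.

Lemma simple_ranked_wt x : x \in sr ->
  (exists2 k, (k.+1 < m + n)%N & x = ranked_wt k.+1 - ranked_wt k) \/ x = ranked_wt 1 + ranked_wt 0.
Proof.
rewrite /simple_roots !mem_cat; case/orP=> [/mapP [i]|/orP[|/orP[/mapP [i]|/orP[/mapP [i]|]]]].
- rewrite mem_iota => li ->; left; exists (n + i.-1)%N; first by lia.
  have q0 : (n + i.-1 < 2 * n)%N = false by lia.
  have q1 : ((n + i.-1).+1 < 2 * n)%N = false by lia.
  by rewrite /ranked_wt q0 q1; congr (epsw _ _ _ _ - epsw _ _ _ _); lia.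
- rewrite inE => /eqP ->; left; exists (2 * n).-1; first by lia.
  have q0 : ((2 * n).-1 < 2 * n)%N by lia.
  have q1 : odd (2 * n).-1 by lia.
  have q2 : ((2 * n).-1./2 = n.-1)%N by lia.
  rewrite /ranked_wt q0 q1 q2 prednK ?ltnn; last by lia.
  by congr (epsw _ _ _ _ - dltw _ _ _ _); lia.
- rewrite mem_iota => li ->; left; exists (2 * i.-1)%N; first by lia.
  have q0 : (2 * i.-1 < 2 * n)%N by lia.
  have q1 : ((2 * i.-1).+1 < 2 * n)%N by lia.
  have q2 : odd (2 * i.-1) = false by lia.
  have q3 : odd (2 * i.-1).+1 by lia.
  have q4 : ((2 * i.-1)./2.+1 = i)%N by lia.
  have q5 : ((2 * i.-1).+1./2.+1 = i)%N by lia.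
  by rewrite /ranked_wt q0 q1 q2 q3 q4 q5.
- rewrite mem_iota => li ->; left; exists (2 * i).-1%N; first by lia.
  have q0 : (2 * i < 2 * n)%N by lia.
  have q1 : ((2 * i).-1 < 2 * n)%N by lia.
  have q2 : odd (2 * i) = false by lia.
  have q3 : odd (2 * i).-1 by lia.
  have q4 : ((2 * i)./2 = i)%N by lia.
  have q5 : ((2 * i).-1./2.+1 = i)%N by lia.
  have q6 : ((2 * i).-1.+1 = 2 * i)%N by lia.
  by rewrite /ranked_wt q1 q3 q5 q6 q0 q2 q4.
- rewrite inE => /eqP ->; right.
  have l0 : (0 < 2 * n)%N by lia.
  have l1 : (1 < 2 * n)%N by lia.
  by rewrite /ranked_wt l0 l1.
Qed.

Lemma height_wtD s x y : hgt s (x + y) = hgt s x + hgt s y :> C.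
Proof. by rewrite -[x]scale1r height_wt_lin mul1r scale1r. Qed.
Lemma height_wtN s x : hgt s (- x) = - hgt s x :> C.
Proof.
have z : hgt s (0 : hw) = 0 :> C.
  by have := height_wt_lin (std_height s) delta_height (-1) (0 : hw) 0; rewrite scaler0 addr0 mulN1r addNr.
by have := height_wt_lin (std_height s) delta_height (-1) x 0; rewrite z scaleN1r !addr0 mulN1r.
Qed.

Lemma height_wt_ranked0 k : (k < m + n)%N -> hgt false (ranked_wt k) = (2 * k + 1)%N%:R :> C.
Proof.
move=> /(height_wt_ranked false) [x [-> [e1 e2]]]; rewrite pmulrn; congr (_%:~R).
by case: (posnP k) => k0; [rewrite e2 // k0 | rewrite e1; lia].
Qed.

Lemma simple_height x : x \in sr -> exists2 p, (0 < p)%N & hgt false x = p%:R.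
Proof.
case/simple_ranked_wt => [[k lk ->]|->].
  exists 2%N; rewrite // height_wtD height_wtN !height_wt_ranked0 //; last by lia.
  by rewrite -natrB; [congr (_%:R); lia|lia].
by exists 4%N; rewrite // height_wtD !height_wt_ranked0 -?natrD //; lia.
Qed.

(** Positivity in [hwvec] refers to combinations of simple roots, whereas the module is built from
    heights. The passage works because each simple root has height 2 or 4. *)
Lemma inQplus_height x : Q x -> x <> 0 -> exists2 p, (0 < p)%N & hgt false x = p%:R.
Proof.
case=> c -> nz.
suff [p ep] : exists p, hgt false (\sum_(i < size sr) (c i)%:R *: sr`_i) = p%:R :> C /\
   (p = 0%N -> forall i : 'I_(size sr), c i = 0%N).
  exists p; last by case: ep.
  rewrite lt0n; apply/eqP => p0; apply: nz; rewrite big1 // => i _.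
  by case: ep => _ /(_ p0 i) ->; rewrite scale0r.
have H (t : seq 'I_(size sr)) : exists p, hgt false (\sum_(i <- t) (c i)%:R *: sr`_i) = p%:R :> C /\
   (p = 0%N -> forall i, i \in t -> c i = 0%N).
  elim: t => [|i t [p [ep cp]]].
    exists 0%N; split=> //; rewrite big_nil.
    by have := height_wtN false 0; rewrite oppr0 => /eqP; rewrite -addr_eq0 -mulr2n mulrn_eq0 => /eqP.
  have [q q0 eq_] : exists2 q, (0 < q)%N & hgt false sr`_i = q%:R.
    by apply: simple_height; apply: mem_nth.
  exists (c i * q + p)%N; split.
    by rewrite big_cons height_wt_lin eq_ ep natrD natrM.
  move/eqP; rewrite addn_eq0 muln_eq0 -[q == 0%N]negbK -lt0n q0 orbF => /andP[/eqP c0 /eqP p0] j.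
  by rewrite inE => /orP[/eqP -> //|]; apply: cp.
have [p [ep cp]] := H (index_enum _); exists p; split=> // p0 i.
by apply: cp => //; rewrite mem_index_enum.
Qed.
End Heights.

(** * Vacuum expectations *)

Section NormalOrdering.
Variables (K : fieldType) (M : lmodType K) (G : Type).
Variables (ga : G -> G -> G) (pr : G -> bool).
Hypothesis gaA : forall g h l, ga g (ga h l) = ga (ga g h) l.
Hypothesis gaC : forall g h, ga g h = ga h g.
Hypothesis prD : forall g h, pr (ga g h) = pr g (+) pr h.

Let letter := (G * M)%type.
Let word := seq letter.

Definition csgn (a b : letter) : K := (-1) ^+ (pr a.1 && pr b.1).

Variable B : G -> G -> M -> M -> M.
Definition cbr (a b : letter) : letter := (ga a.1 b.1, B a.1 b.1 a.2 b.2).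
Hypothesis Blinl : forall g h c x y z, B g h (c *: x + y) z = c *: B g h x z + B g h y z.
Hypothesis Blinr : forall g h c x y z, B g h z (c *: x + y) = c *: B g h z x + B g h z y.

Variable ok : letter -> Prop.
Hypothesis okB : forall a b, ok a -> ok b -> ok (cbr a b).
Hypothesis okD : forall g c x y, ok (g, x) -> ok (g, y) -> ok (g, c *: x + y).

Hypothesis Banti : forall a b, ok a -> ok b ->
  B a.1 b.1 a.2 b.2 = - csgn a b *: B b.1 a.1 b.2 a.2.
Hypothesis Bjac : forall a b c, ok a -> ok b -> ok c ->
  (cbr a (cbr b c)).2 = (cbr (cbr a b) c).2 + csgn a b *: (cbr b (cbr a c)).2.

(** [P] is the projection onto the positive part n_+, so its kernel plays the role of the Cartan
    subalgebra plus n_-. Then [Pminus] says that this kernel is a subalgebra, and [lamminus] that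
    [lam] is a character of it. *)
Variable P : G -> M -> M.
Hypothesis Plin : forall g c x y, P g (c *: x + y) = c *: P g x + P g y.
Definition cplus (a : letter) : letter := (a.1, P a.1 a.2).
Hypothesis okP : forall a, ok a -> ok (cplus a).
Hypothesis PP : forall g x, P g (P g x) = P g x.
Hypothesis Pplus : forall a b, ok a -> ok b -> cplus (cbr (cplus a) (cplus b)) = cbr (cplus a) (cplus b).
Hypothesis Pminus : forall g h x y, ok (g, x) -> ok (h, y) -> P g x = 0 -> P h y = 0 ->
   P (ga g h) (B g h x y) = 0.

Variable lam : G -> M -> K.
Hypothesis lamlin : forall g c x y, lam g (c *: x + y) = c * lam g x + lam g y.
Hypothesis lamP : forall g x, lam g (P g x) = 0.
Hypothesis lamminus : forall g h x y, ok (g, x) -> ok (h, y) -> P g x = 0 -> P h y = 0 ->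
   lam (ga g h) (B g h x y) = 0.
Hypothesis lamodd : forall g x, ok (g, x) -> pr g -> lam g x = 0.

(* The action of the letter [a] on words by the signed Leibniz rule, transposed to
   functionals. *)
Fixpoint coact (f : word -> K) (a : letter) (w : word) : K :=
  if w is b :: w' then f (cbr a b :: w') + csgn a b * coact (fun w1 => f (b :: w1)) a w'
  else 0.

(* The defining recursion is [vev_cons]; the fuel is the length of the word. *)
Fixpoint vev_fuel (n : nat) (w : word) : K :=
  match n, w with
  | n'.+1, a :: w' => lam a.1 a.2 * vev_fuel n' w' + coact (vev_fuel n') (cplus a) w'
  | 0, _ :: _ => 0
  | _, _ => 1
  end.
Definition vev (w : word) : K := vev_fuel (size w) w.

Fixpoint okw (w : word) : Prop := if w is a :: w' then ok a /\ okw w' else True.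

Lemma coact_ext (f g : word -> K) a w : ok a -> okw w ->
  (forall w', okw w' -> size w' = size w -> f w' = g w') -> coact f a w = coact g a w.
Proof.
move=> oa; elim: w f g => //= b w IH f g [ob ow] H; rewrite H ?(IH _ (fun w1 => g (b :: w1))) //=.
  by move=> w' ow' sw; rewrite H //= sw.
by split=> //; apply: okB.
Qed.

Lemma coact_eq (f g : word -> K) a w : f =1 g -> coact f a w = coact g a w.
Proof.
by elim: w f g => //= b w IH f g H; rewrite H (IH _ (fun w1 => g (b :: w1))).
Qed.

Lemma coact_comb c (f g : word -> K) a w :
  coact (fun w => c * f w + g w) a w = c * coact f a w + coact g a w.
Proof. by elim: w f g => [|b w IH] f g /=; [ring|rewrite IH; ring]. Qed.

Lemma coact_ext_size (f g : word -> K) a w :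
  (forall w', size w' = size w -> f w' = g w') -> coact f a w = coact g a w.
Proof.
elim: w f g => //= b w IH f g H; rewrite H // (IH _ (fun w1 => g (b :: w1))) //.
by move=> v sv; rewrite H //= sv.
Qed.

Lemma vev_cons a w : vev (a :: w) = lam a.1 a.2 * vev w + coact vev (cplus a) w.
Proof. by rewrite /vev /=; congr (_ + _); apply: coact_ext_size => v ->. Qed.

Definition slotlin (f : word -> K) := forall u g c x y w,
  f (u ++ (g, c *: x + y) :: w) = c * f (u ++ (g, x) :: w) + f (u ++ (g, y) :: w).

Lemma slotlin_cons f b : slotlin f -> slotlin (fun w => f (b :: w)).
Proof. by move=> fl u g c x y w; apply: (fl (b :: u)). Qed.

Lemma csgn_brl a b c : csgn (cbr a b) c = csgn a c * csgn b c.
Proof. by rewrite /csgn /= prD -signr_addb andb_addl. Qed.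
Lemma csgn_brr a b c : csgn a (cbr b c) = csgn a b * csgn a c.
Proof. by rewrite /csgn /= prD -signr_addb andb_addr. Qed.
Lemma csgnC a b : csgn a b = csgn b a.
Proof. by rewrite /csgn andbC. Qed.
Lemma csgn_sq a b : csgn a b * csgn a b = 1.
Proof. by rewrite /csgn -signr_addb addbb. Qed.

Lemma coact_slot (f : word -> K) a : slotlin f -> slotlin (coact f a).
Proof.
move=> fl u g c x y w; elim: u f fl => [|b u IH] f fl /=.
  rewrite {1}/cbr /= Blinr -[_ :: w]cat0s fl !cat0s.
  have -> : csgn a (g, c *: x + y) = csgn a (g, x) by [].
  have -> : csgn a (g, y) = csgn a (g, x) by [].
  rewrite -[(fun w1 => _)]/(fun w1 => f ((g, c *: x + y) :: w1)).
  have -> : coact (fun w1 => f ((g, c *: x + y) :: w1)) a w =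
            c * coact (fun w1 => f ((g, x) :: w1)) a w + coact (fun w1 => f ((g, y) :: w1)) a w.
    by rewrite -coact_comb; apply: coact_eq => w1; apply: (fl [::]).
  rewrite /cbr /=; ring.
rewrite -!cat_cons fl IH; last exact: slotlin_cons.
ring.
Qed.

Lemma coact_lin (f : word -> K) g c x y w : slotlin f ->
  coact f (g, c *: x + y) w = c * coact f (g, x) w + coact f (g, y) w.
Proof.
move=> fl; elim: w f fl => [|b w IH] f fl /=; first by ring.
rewrite IH; last exact: slotlin_cons.
by rewrite /cbr /= Blinl -[_ :: w]cat0s fl !cat0s /csgn /=; ring.
Qed.

Lemma vev_fuel_lin n : slotlin (vev_fuel n).
Proof.
elim: n => [|n IH] u g c x y w; first by case: u => [|? ?] /=; ring.
case: u => [|b u] /=.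
  by rewrite lamlin /cplus /= Plin coact_lin //; ring.
by rewrite IH (coact_slot _ IH); ring.
Qed.

Lemma vev_lin : slotlin vev.
Proof. by move=> u g c x y w; rewrite /vev !size_cat /= vev_fuel_lin. Qed.

Definition commutes_at n (f : word -> K) := forall u a b w, okw u -> ok a -> ok b -> okw w ->
  (size u + size w)%N = n ->
  f (u ++ a :: b :: w) - csgn a b * f (u ++ b :: a :: w) = f (u ++ cbr a b :: w).

(** The letter [c] acts as a derivation. When it meets [a], [b] or their bracket, the Jacobi
    identity is what is needed; when it acts elsewhere, the relation for [f] is. *)
Lemma coact_rel n f c : slotlin f -> commutes_at n f -> ok c -> commutes_at n (coact f c).
Proof.
move=> fl fr oc u a b w; elim: u n f fl fr => [|d u IH] n f fl fr ou oa ob ow sz.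
  have fr0 x y : ok x -> ok y -> f (x :: y :: w) = f (cbr x y :: w) + csgn x y * f (y :: x :: w).
    by move=> ox oy; rewrite -(fr [::] x y w) //; ring.
  rewrite /= (fr0 (cbr c a) b) ?(fr0 a (cbr c b)) //; try exact: okB.
  have -> : coact (fun w1 => f [:: a, b & w1]) c w =
      coact (fun w1 => csgn a b * f [:: b, a & w1] + f (cbr a b :: w1)) c w.
    apply: coact_ext => // w' ow' sw'.
    by rewrite -(fr [::] a b w') // ?add0n ?sw' //=; ring.
  rewrite coact_comb !csgn_brr !csgn_brl.
  have -> : f (cbr c (cbr a b) :: w) = f (cbr (cbr c a) b :: w) + csgn c a * f (cbr a (cbr c b) :: w).
    have -> : cbr c (cbr a b) = (ga c.1 (ga a.1 b.1),
       csgn c a *: (cbr a (cbr c b)).2 + (cbr (cbr c a) b).2).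
      by rewrite addrC -Bjac.
    rewrite (fl [::]) /= addrC; congr (f (_ :: _) + _ * f (_ :: _)).
      by rewrite gaA.
    by rewrite gaA (gaC c.1) -gaA.
  rewrite (csgnC a c).
  ring: (csgn_sq c a) (csgn_sq c b) (csgn_sq a b).
case: ou => od ou.
rewrite /= -(IH n.-1 (fun w1 => f (d :: w1))) //; first last.
- by rewrite -sz.
- move=> u' a' b' w' ou' oa' ob' ow' sz'; rewrite -!cat_cons; apply: fr => //=.
  by rewrite addSn sz' -sz.
- exact: slotlin_cons.
rewrite -!cat_cons -(fr (cbr c d :: u)) //=; last by split=> //; apply: okB.
ring.
Qed.

(** By the Jacobi identity the Leibniz action on words is a representation. Transposition makes [b]
    act first in [coact (coact f a) b], so the order of the supercommutator is preserved. *)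
Lemma coact_cbr f a b w : slotlin f -> ok a -> ok b -> okw w ->
  coact f (cbr a b) w = coact (coact f a) b w - csgn a b * coact (coact f b) a w.
Proof.
move=> fl oa ob; elim: w f fl => [|c w IH] f fl /=; first by move=> _; ring.
case=> oc ow; rewrite (IH _ (slotlin_cons _ fl)) //.
have E x y : coact (fun w1 => f (cbr x c :: w1) + csgn x c * coact (fun w2 => f (c :: w2)) x w1) y w
   = csgn x c * coact (coact (fun w2 => f (c :: w2)) x) y w + coact (fun w1 => f (cbr x c :: w1)) y w.
  by rewrite -coact_comb; apply: coact_eq => w1; rewrite addrC.
rewrite !E !csgn_brr !csgn_brl.
have -> : f (cbr (cbr a b) c :: w) = f (cbr a (cbr b c) :: w) - csgn a b * f (cbr b (cbr a c) :: w).
  have -> : cbr (cbr a b) c = (ga (ga a.1 b.1) c.1,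
       (- csgn a b) *: (cbr b (cbr a c)).2 + (cbr a (cbr b c)).2).
    by rewrite (Bjac oa ob oc) addrCA scaleNr addNr addr0.
  rewrite (fl [::]) /= addrC mulNr; congr (f (_ :: _) - _ * f (_ :: _)).
    by rewrite /cbr /= gaA.
  by rewrite /cbr /= (gaC a.1 b.1) -gaA.
rewrite (csgnC b a).
ring: (csgn_sq a b).
Qed.

Lemma coact_zero f g w : slotlin f -> coact f (g, 0) w = 0.
Proof.
move=> fl; have := @coact_lin f g (-1) 0 0 w fl.
by rewrite scaler0 addr0 mulN1r => /eqP; rewrite addNr => /eqP.
Qed.

Lemma proj_sub0 g x : P g (x - P g x) = 0.
Proof. by rewrite -scaleN1r addrC Plin PP scaleN1r addNr. Qed.

Lemma ok_sub g x : ok (g, x) -> ok (g, x - P g x).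
Proof. by move=> o; rewrite addrC -scaleN1r; apply: okD => //; apply: (okP o). Qed.

(* The bracket along [a = a_+ + a_-, b = b_+ + b_-], where a_0 counts as part of
   a_-. *)
Lemma br_triangular a b : ok a -> ok b -> B a.1 b.1 a.2 b.2 =
  (- csgn a b) *: B b.1 a.1 (P b.1 b.2) a.2
  + (1 *: B a.1 b.1 (P a.1 a.2) b.2 + ((-1) *: B a.1 b.1 (P a.1 a.2) (P b.1 b.2)
  + B a.1 b.1 (a.2 - P a.1 a.2) (b.2 - P b.1 b.2))).
Proof.
move=> oa ob.
have <- : B a.1 b.1 a.2 (P b.1 b.2) = - csgn a b *: B b.1 a.1 (P b.1 b.2) a.2.
  exact: (Banti oa (okP ob)).
have -> z : a.2 - z = (-1) *: z + a.2 by rewrite scaleN1r addrC.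
have -> z : b.2 - z = (-1) *: z + b.2 by rewrite scaleN1r addrC.
rewrite Blinl !Blinr !scaleN1r !scale1r opprD opprK.
set x := B _ _ _ _; set y := B _ _ _ _; set z := B _ _ _ _; set t := B _ _ _ _.
by rewrite -(addrA t) addKr addNKr addNKr.
Qed.

(** Both words are expanded at their first two letters. The terms with one action match the
    decomposition [br_triangular], those with two actions combine by [coact_cbr] for the positive
    parts, and the purely scalar terms cancel. *)
Lemma vev_rel0 a b w : ok a -> ok b -> okw w ->
  vev (a :: b :: w) - csgn a b * vev (b :: a :: w) = vev (cbr a b :: w).
Proof.
move=> oa ob ow.
have E x y : vev (x :: y :: w) = lam x.1 x.2 * (lam y.1 y.2 * vev w + coact vev (cplus y) w)
   + (lam (ga x.1 y.1) (B x.1 y.1 (P x.1 x.2) y.2) * vev w + coact vev (cplus (cbr (cplus x) y)) w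
   + csgn x y * (lam y.1 y.2 * coact vev (cplus x) w + coact (coact vev (cplus y)) (cplus x) w)).
  rewrite !vev_cons; congr (_ + _) => /=; congr (_ + _); first by rewrite vev_cons.
  by congr (_ * _); rewrite -coact_comb; apply: coact_eq => v; rewrite vev_cons.
rewrite !E vev_cons (gaC b.1); clear E.
move: a b oa ob => [g x] [h y] oa ob.
have okx := ok_sub oa; have oky := ok_sub ob.
have D := br_triangular oa ob; rewrite /= in D.
have pp : P (ga g h) (B g h (P g x) (P h y)) = B g h (P g x) (P h y).
  by have [] := Pplus oa ob.
have -> : lam (cbr (g, x) (h, y)).1 (cbr (g, x) (h, y)).2 =
   - csgn (g, x) (h, y) * lam (ga g h) (B h g (P h y) x) + lam (ga g h) (B g h (P g x) y).
  rewrite /= D !lamlin (lamminus okx oky) ?proj_sub0 //.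
  by have := lamP (ga g h) (B g h (P g x) (P h y)); rewrite pp => ->; ring.
have -> : coact vev (cplus (cbr (g, x) (h, y))) w =
   - csgn (g, x) (h, y) * coact vev (ga g h, P (ga g h) (B h g (P h y) x)) w
   + coact vev (cplus (cbr (cplus (g, x)) (h, y))) w - coact vev (cbr (cplus (g, x)) (cplus (h, y))) w.
  rewrite {1}/cplus /= D !Plin (Pminus okx oky) ?proj_sub0 // pp !(coact_lin _ _ _ _ _ vev_lin) coact_zero;
    last exact: vev_lin.
  by rewrite /cplus /cbr /=; ring.
rewrite (coact_cbr vev_lin (okP oa) (okP ob) ow).
have -> : cplus (cbr (cplus (h, y)) (g, x)) = (ga g h, P (ga g h) (B h g (P h y) x)).
  by rewrite /cplus /cbr /= gaC.
have -> : csgn (h, y) (g, x) = csgn (g, x) (h, y) by exact: csgnC.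
have -> : csgn (cplus (g, x)) (cplus (h, y)) = csgn (g, x) (h, y) by [].
(* The scalar terms fail to cancel by symmetry only for two odd letters, and [lam] vanishes on
   those. *)
have L0 : (1 - csgn (g, x) (h, y)) * (lam g x * lam h y) = 0.
  rewrite /csgn /=; case pg : (pr g); last by rewrite expr0; ring.
  by rewrite (lamodd oa pg); ring.
rewrite -[RHS]addr0 -[X in _ = _ + X](mul0r (vev w)) -L0 /=.
ring: (csgn_sq (g, x) (h, y)).
Qed.

Lemma vev_rel n : commutes_at n vev.
Proof.
elim: n => [|n IH] [|c u] a b w // ou oa ob ow sz; try exact: vev_rel0.
move: ou sz => [oc ou] [sz]; rewrite /= !vev_cons -(IH u a b w) //.
rewrite -(coact_rel vev_lin IH (okP oc)) //.
ring.
Qed.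

(** The hypothesis on [x] says that bracketing n_+ with [x] stays in n_+; it holds for positive and
    for Cartan letters. An action that reaches the last letter then leaves a positive letter there,
    and by induction such a word has value 0. *)
Lemma vev_rcons w x : ok x -> okw w ->
  (forall a, ok a -> cplus (cbr (cplus a) x) = cbr (cplus a) x) ->
  vev (rcons w x) = lam x.1 x.2 * vev w.
Proof.
move=> ox ow; move: {2}(size w) (leqnn (size w)) => n.
elim: n w x ox ow => [|n IH] [|a w] x ox ow // sz nx.
- by rewrite /vev /=; ring.
- by rewrite /vev /=; ring.
case: ow => oa ow; rewrite rcons_cons !vev_cons IH //.
have -> : coact vev (cplus a) (rcons w x) = lam x.1 x.2 * coact vev (cplus a) w; last by ring.
(* The Leibniz rule separates the action on the last letter, which picks up the signs of all letters
   passed. *)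
have H f v : okw v -> coact f (cplus a) (rcons v x) = coact (fun u => f (rcons u x)) (cplus a) v +
   (\prod_(b <- v) csgn (cplus a) b) * f (rcons v (cbr (cplus a) x)).
  elim: v f => [|b v IHv] f /=; first by move=> _; rewrite big_nil; ring.
  by case=> ob ov; rewrite IHv // big_cons; ring.
rewrite H // [in X in _ + X]IH //.
- have -> : lam (cbr (cplus a) x).1 (cbr (cplus a) x).2 = 0.
    by rewrite -(nx a oa) /cplus lamP.
  rewrite mul0r mulr0 addr0.
  have Z : coact (fun=> 0) (cplus a) w = 0 by elim: (w) => //= b v ->; ring.
  rewrite -[lam x.1 x.2 * _]addr0 -[X in _ = _ + X]Z -coact_comb; apply: coact_ext => // [|v ov sv]; first exact: okP.
  by rewrite IH ?addr0 // sv.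
- by apply: okB => //; apply: okP.
- move=> b ob; rewrite -(nx a oa); apply: Pplus => //.
  by apply: okB => //; apply: okP.
Qed.

Lemma vev_central x : pr x.1 = false -> P x.1 x.2 = 0 -> (forall a, (cbr a x).2 = 0) ->
  forall u w, vev (u ++ x :: w) = lam x.1 x.2 * vev (u ++ w).
Proof.
move=> px Px Bx u w; move: {2}(_ + _)%N (leqnn (size u + size w)%N) => N.
elim: N u w => [|N IH] [|c u] w //= sz; rewrite ?[vev (x :: w)]vev_cons /cplus ?Px ?coact_zero ?addr0 //;
  try exact: vev_lin.
rewrite !vev_cons IH //.
have H f v : slotlin f ->
    (forall v' w', (size v' + size w')%N = (size v + size w)%N ->
       f (v' ++ x :: w') = lam x.1 x.2 * f (v' ++ w')) ->
    coact f (cplus c) (v ++ x :: w) = lam x.1 x.2 * coact f (cplus c) (v ++ w).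
  elim: v f => [|b v IHv] f fl H /=.
    have -> : f (cbr (cplus c) x :: w) = 0.
      have -> : cbr (cplus c) x = ((cbr (cplus c) x).1, (-1) *: 0 + 0) by rewrite scaler0 addr0 -(Bx (cplus c)).
      rewrite (fl [::]) /=; ring.
    rewrite add0r /csgn px andbF expr0 mul1r.
    have Z : coact (fun=> 0) (cplus c) w = 0 by elim: (w) => //= b v ->; ring.
    rewrite -[RHS]addr0 -[X in _ = _ + X]Z -coact_comb; apply: coact_ext_size => v sv.
    by rewrite (H [::]) ?sv //= addr0.
  have -> : coact (fun w1 => f (b :: w1)) (cplus c) (v ++ x :: w) =
      lam x.1 x.2 * coact (fun w1 => f (b :: w1)) (cplus c) (v ++ w).
    apply: IHv; first exact: slotlin_cons.
    by move=> v' w' sv; apply: (H (b :: v')); rewrite /= addSn sv.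
  rewrite -!cat_cons (H (_ :: v)) //=; ring.
rewrite -/(cplus c) H; [ring|exact: vev_lin|move=> v' w' sv; apply: IH].
by rewrite sv; move: sz; rewrite addSn ltnS.
Qed.

Variable dg : G -> int.
Hypothesis dgD : forall g h, dg (ga g h) = dg g + dg h.
Hypothesis lamdg : forall g x, ok (g, x) -> dg g != 0 -> lam g x = 0.

Lemma vev_deg w : okw w -> \sum_(a <- w) dg a.1 != 0 -> vev w = 0.
Proof.
move: {2}(size w) (erefl (size w)) => N; elim: N w => [|N IH] [|a w] //.
  by move=> _ _; rewrite big_nil eqxx.
case=> sz [oa ow]; rewrite big_cons => ne; rewrite vev_cons.
have H f b v : ok b -> okw v ->
    (forall v', okw v' -> size v' = size v ->
        \sum_(c <- v') dg c.1 = dg b.1 + \sum_(c <- v) dg c.1 -> f v' = 0) -> coact f b v = 0.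
  move=> ob; elim: v f => //= c v IHv f [oc ov] H.
  rewrite H ?add0r ?(IHv (fun w1 => f (c :: w1))) ?mulr0 //; first last.
  - by rewrite !big_cons /= dgD addrA.
  - by split=> //; apply: okB.
  - move=> v' ov' sv ev; apply: H => //=; first by rewrite sv.
    by rewrite !big_cons ev addrCA.
rewrite H ?addr0 //; [|exact: okP|].
  have [a0|a0] := eqVneq (dg a.1) 0; last by rewrite (@lamdg a.1 a.2) ?mul0r //; case: (a) oa.
  by rewrite IH ?mulr0 //; move: ne; rewrite a0 add0r.
by move=> v ov sv ev; apply: IH => //; rewrite ?sv // ev.
Qed.
End NormalOrdering.

(** * Central extension of the loop superalgebra of gl(2m|2n) and its triangular decomposition *)

Section AffineAlgebra.
Variables (C : numClosedFieldType) (m n : nat).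
Hypotheses (nm : (n + 2 < m)%N) (n1 : (1 <= n)%N).
Local Notation I := 'I_(Nd m n).
Local Notation Mat := 'M[C]_(Nd m n).
Local Notation hw := (hw C m n).
Local Notation rtmx := (@rootmx C m n).
Local Notation hh := (@std_height m n false).
Variable L : hw.
Let k : C := wc L (m + n).

(* [((r, p), (X, z))] stands for X t^r + z K, of parity p. *)
Definition glhat_elt := (Mat * C^o)%type.
Definition glhat_tag := (int * bool)%type.
Definition tag_add (g h : glhat_tag) : glhat_tag := (g.1 + h.1, g.2 (+) h.2).
Definition tag_par (g : glhat_tag) := g.2.
Definition glhat_br (g h : glhat_tag) (x y : glhat_elt) : glhat_elt :=
  (sbr g.2 h.2 x.1 y.1, (g.1%:~R * mform x.1 y.1) *+ (g.1 + h.1 == 0)).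
(** A central component is homogeneous only in degree 0 and even parity. *)
Definition glhat_hom (a : glhat_tag * glhat_elt) :=
  is_hom a.1.2 a.2.1 /\ (a.1.2 || (a.1.1 != 0) -> a.2.2 = 0).
Definition pos_entry (r : int) (a b : I) := (0 < r) || ((r == 0) && (hh b < hh a)).
Definition glhat_pos (g : glhat_tag) (x : glhat_elt) : glhat_elt :=
  (\matrix_(a, b) (if pos_entry g.1 a b then x.1 a b else 0), 0).
(* Each Cartan coordinate appears twice, at [a] and at [dual a], whence the 1/2. *)
Definition glhat_char (g : glhat_tag) (x : glhat_elt) : C :=
  k * x.2 + (if g.1 == 0 then \sum_a (idx_coord L a / 2) * x.1 a a else 0).

Lemma tag_addA g h l : tag_add g (tag_add h l) = tag_add (tag_add g h) l.
Proof. by rewrite /tag_add /= addrA addbA. Qed.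
Lemma tag_addC g h : tag_add g h = tag_add h g.
Proof. by rewrite /tag_add addrC addbC. Qed.
Lemma tag_parD g h : tag_par (tag_add g h) = tag_par g (+) tag_par h. Proof. by []. Qed.

Lemma glhat_elt_eq (u v : glhat_elt) : u.1 = v.1 -> u.2 = v.2 -> u = v.
Proof. by case: u v => [? ?] [? ?] /= -> ->. Qed.

Lemma glhat_br_linl g h c x y z : glhat_br g h (c *: x + y) z = c *: glhat_br g h x z + glhat_br g h y z.
Proof.
rewrite /glhat_br /=; congr pair; first by rewrite sbr_linl.
rewrite mform_linl; case: eqP => _; rewrite ?mulr1n ?mulr0n /=; last by rewrite scaler0 addr0.
rewrite -[_ *: _]/(c * _); ring.
Qed.
Lemma glhat_br_linr g h c x y z : glhat_br g h z (c *: x + y) = c *: glhat_br g h z x + glhat_br g h z y.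
Proof.
rewrite /glhat_br /=; congr pair; first by rewrite sbr_linr.
rewrite mform_linr; case: eqP => _; rewrite ?mulr1n ?mulr0n /=; last by rewrite scaler0 addr0.
rewrite -[_ *: _]/(c * _); ring.
Qed.

Local Notation gbr := (cbr tag_add glhat_br).
Local Notation gsgn := (@csgn C glhat_elt glhat_tag tag_par).

Lemma glhat_homB a b : glhat_hom a -> glhat_hom b -> glhat_hom (gbr a b).
Proof.
move=> [ha za] [hb dsignb]; split; first exact: sbr_hom.
by case/orP => /= [od|/negPf ->]; rewrite ?(mform_odd ha hb od) ?mulr0 ?mul0rn ?mulr0n.
Qed.
Lemma glhat_homD g c x y : glhat_hom (g, x) -> glhat_hom (g, y) -> glhat_hom (g, c *: x + y).
Proof.
move=> [hx zx] [hy zy]; split=> /=.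
  by move=> a b ne; rewrite !mxE hx // hy // mulr0 addr0.
by move=> od; rewrite zx // zy // scaler0 addr0.
Qed.

Lemma glhat_br_anti a b : glhat_hom a -> glhat_hom b ->
  glhat_br a.1 b.1 a.2 b.2 = - gsgn a b *: glhat_br b.1 a.1 b.2 a.2.
Proof.
move=> [ha za] [hb dsignb]; rewrite /glhat_br /gsgn /tag_par; congr pair => /=; first by rewrite sbrC.
rewrite -[_ *: _]/(- _ * _) [b.1.1 + _]addrC (mformC ha hb).
case: eqP => [e|_]; rewrite ?mulr0n ?mulr0 // !mulr1n.
have -> : b.1.1 = - a.1.1 by apply/eqP; rewrite -addr_eq0 addrC e.
by rewrite rmorphN /=; ring.
Qed.

Lemma glhat_br_jacobi a b c : glhat_hom a -> glhat_hom b -> glhat_hom c ->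
  (gbr a (gbr b c)).2 = (gbr (gbr a b) c).2 + gsgn a b *: (gbr b (gbr a c)).2.
Proof.
move=> [ha za] [hb dsignb] [hc zc]; apply: glhat_elt_eq; first exact: sbr_jacobi.
rewrite /cbr /csgn /glhat_br /tag_par /=.
rewrite -[_ *: _]/(_ * _) (mform_inv ha hb hc) (mform_inv hb ha hc).
have -> : mform (sbr b.1.2 a.1.2 b.2.1 a.2.1) c.2.1 =
   - (-1) ^+ (a.1.2 && b.1.2) * mform (sbr a.1.2 b.1.2 a.2.1 b.2.1) c.2.1.
  rewrite sbrC andbC; have := mform_linl (- (-1) ^+ (a.1.2 && b.1.2)) (sbr a.1.2 b.1.2 a.2.1 b.2.1) 0 c.2.1.
  rewrite addr0 => ->.
  by rewrite [mform 0 _]mformE mul0mx /str big1 ?mulr0 ?addr0 // => x _; rewrite mxE mulr0.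
have s2 : (-1) ^+ (a.1.2 && b.1.2) * (-1) ^+ (a.1.2 && b.1.2) = 1 :> C by rewrite -signr_addb addbb.
rewrite addrA [b.1.1 + (_ + _)]addrA [b.1.1 + a.1.1]addrC.
case: eqP => _; rewrite ?mulr0n ?mulr0 ?addr0 // !mulr1n rmorphD /=.
ring: s2.
Qed.

Lemma glhat_pos_lin g c x y : glhat_pos g (c *: x + y) = c *: glhat_pos g x + glhat_pos g y.
Proof.
rewrite /glhat_pos; congr pair => /=; last by rewrite scaler0 addr0.
by apply/matrixP => a b; rewrite !mxE; case: ifP => _ //; rewrite mulr0 addr0.
Qed.

Local Notation gplus := (cplus glhat_pos).

Lemma glhat_hom_pos a : glhat_hom a -> glhat_hom (gplus a).
Proof. by move=> [ha za]; split=> //= x y ne; rewrite mxE ha //; case: ifP. Qed.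

Lemma glhat_pos_idem g x : glhat_pos g (glhat_pos g x) = glhat_pos g x.
Proof.
by apply: glhat_elt_eq => //; apply/matrixP => a b; rewrite /glhat_pos !mxE; case: (pos_entry _ _ _).
Qed.

Lemma pos_entryD r s a b c : pos_entry r a c -> pos_entry s c b -> pos_entry (r + s) a b.
Proof. rewrite /pos_entry; move: (hh a) (hh b) (hh c) => x y z; lia. Qed.

Lemma pos_entryN r s a b c : ~~ pos_entry r a c -> ~~ pos_entry s c b -> ~~ pos_entry (r + s) a b.
Proof. rewrite /pos_entry; move: (hh a) (hh b) (hh c) => x y z; lia. Qed.

Lemma glhat_pos_nz g x a b : (glhat_pos g x).1 a b != 0 -> pos_entry g.1 a b.
Proof. by rewrite mxE; case: ifP => //; rewrite eqxx. Qed.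

Lemma glhat_pos0_nz g x a b : glhat_pos g x = 0 -> x.1 a b != 0 -> ~~ pos_entry g.1 a b.
Proof.
move=> /(congr1 fst) /= /matrixP /(_ a b); rewrite !mxE; case: ifP => // _ ->.
by rewrite eqxx.
Qed.

Lemma glhat_pos_subalg a b : glhat_hom a -> glhat_hom b -> gplus (gbr (gplus a) (gplus b)) = gbr (gplus a) (gplus b).
Proof.
move=> _ _; rewrite /cplus /cbr /=; congr pair; rewrite {1}/glhat_pos; congr pair.
  apply/matrixP => x y; rewrite mxE; case: ifP => // np.
  apply/esym/eqP; apply: contraFT np; case/sbr_nz => z [] [] /glhat_pos_nz p1 /glhat_pos_nz p2 /=.
    exact: pos_entryD p1 p2.
  by rewrite addrC; apply: pos_entryD p1 p2.
rewrite /glhat_br /=; case: eqP => [e|_]; last by rewrite mulr0n.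
rewrite mulr1n mformE /str.
have [->|nr] := eqVneq a.1.1 0; first by rewrite mul0r.
rewrite big1 ?mulr0 // => x _; rewrite mxE big1 ?mulr0 // => y _.
apply/eqP; apply: contraT; rewrite mulf_eq0 negb_or => /andP[/glhat_pos_nz p1 /glhat_pos_nz p2].
exfalso; move: p1 p2; rewrite /pos_entry; move: (hh x) (hh y) nr e => u v; lia.
Qed.

Lemma glhat_neg_subalg g h x y : glhat_hom (g, x) -> glhat_hom (h, y) -> glhat_pos g x = 0 -> glhat_pos h y = 0 ->
   glhat_pos (tag_add g h) (glhat_br g h x y) = 0.
Proof.
move=> _ _ gx hy; rewrite /glhat_pos; congr pair; apply/matrixP => a b; rewrite mxE [RHS]mxE.
case: ifP => // ps; apply/eqP; apply: contraTT ps; case/sbr_nz => z [] [].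
  by move=> /(glhat_pos0_nz gx) p1 /(glhat_pos0_nz hy) p2; apply: pos_entryN p1 p2.
by move=> /(glhat_pos0_nz hy) p1 /(glhat_pos0_nz gx) p2; rewrite /= addrC; apply: pos_entryN p1 p2.
Qed.

Lemma glhat_char_lin g c x y : glhat_char g (c *: x + y) = c * glhat_char g x + glhat_char g y.
Proof.
rewrite /glhat_char /=; have -> : \sum_a idx_coord L a / 2 * (c *: x.1 + y.1) a a =
  c * \sum_a idx_coord L a / 2 * x.1 a a + \sum_a idx_coord L a / 2 * y.1 a a.
  by rewrite mulr_sumr -big_split; apply: eq_bigr => a _; rewrite !mxE /=; ring.
by rewrite -[c *: _]/(c * _); case: ifP => _; ring.
Qed.

Lemma glhat_char_pos g x : glhat_char g (glhat_pos g x) = 0.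
Proof.
rewrite /glhat_char /= mulr0 add0r; case: eqP => // e; rewrite big1 // => a _.
by rewrite mxE /pos_entry e !ltxx andbF mulr0.
Qed.

(** If the degrees are opposite and nonzero, one of them is positive, and the corresponding matrix
    is zero. In degree 0 both matrices are triangular for the order by height, so the diagonal of a
    product is the product of the diagonals and cancels in the bracket. *)
Lemma glhat_char_neg g h x y : glhat_hom (g, x) -> glhat_hom (h, y) -> glhat_pos g x = 0 -> glhat_pos h y = 0 ->
   glhat_char (tag_add g h) (glhat_br g h x y) = 0.
Proof.
move=> [hx zx] [hy zy] gx gy; rewrite /glhat_char /=; case: eqP => [e|_]; last by rewrite mulr0 addr0.
rewrite mulr1n.
have [rs|rs] := eqVneq g.1 0; last first.
  have x0y0 : x.1 = 0 \/ y.1 = 0.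
    have [rp|rn] := ltrP 0 g.1; [left|right]; apply/matrixP => a b; apply/eqP; rewrite mxE; apply: contraT.
      by move/(glhat_pos0_nz gx); rewrite /pos_entry rp.
    by move/(glhat_pos0_nz gy); rewrite /pos_entry; move: rs e rn; lia.
  have m0 : mform x.1 y.1 = 0.
    by rewrite mformE; case: x0y0 => ->; rewrite ?mul0mx ?mulmx0 /str big1 ?mulr0 // => a _; rewrite mxE mulr0.
  rewrite m0 mulr0 mulr0 add0r big1 // => a _.
  by rewrite /sbr; case: x0y0 => ->; rewrite ?mul0mx ?mulmx0 scaler0 subrr mxE mulr0.
rewrite rs mul0r mulr0 add0r big1 // => a _.
have hs0 : h.1 = 0 by move: e; rewrite rs add0r.
have D (u v : glhat_elt) (p q : glhat_tag) : p.1 = 0 -> q.1 = 0 -> glhat_pos p u = 0 -> glhat_pos q v = 0 ->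
    (u.1 *m v.1) a a = u.1 a a * v.1 a a.
  move=> p0 q0 pu qv; rewrite mxE (bigD1 a) //= big1 ?addr0 // => c ca.
  apply/eqP; apply: contraT; rewrite mulf_eq0 negb_or => /andP[/(glhat_pos0_nz pu) + /(glhat_pos0_nz qv)].
  rewrite /pos_entry p0 q0 ltxx eqxx /= -!leNgt => l1 l2.
  by case/eqP: ca; apply: (std_height_inj nm n1 (s := false)); apply/eqP; rewrite eq_le l1 l2.
rewrite /sbr mxE (D x y g h) // mxE mxE (D y x h g) //.
case eg : g.2; first by rewrite [x.1 a a]hx ?addbb /= ?eg // !(mulr0, mul0r) oppr0 addr0 mulr0.
by rewrite expr0 mul1r [y.1 a a * _]mulrC subrr mulr0.
Qed.

Lemma glhat_char_odd g x : glhat_hom (g, x) -> tag_par g -> glhat_char g x = 0.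
Proof.
rewrite /tag_par => -[hx zx] og; rewrite /glhat_char zx ?og // mulr0 add0r; case: ifP => // _.
by rewrite big1 // => a _; rewrite hx ?addbb /= ?og // mulr0.
Qed.

Lemma glhat_char_diag p (a : I) : glhat_char (0, p) (rtmx a a, 0) = idx_coord L a.
Proof.
rewrite /glhat_char /= mulr0 add0r.
rewrite (bigD1 a) //= (bigD1 (dual a)) ?dual_neq //= big1 ?addr0.
  rewrite !rootmxE !eqxx dsign_diag !dual_neq eq_sym dual_neq idx_coord_dual /=.
  by rewrite !(mulr0n, mulr1n); field.
move=> x /andP[xa xd]; rewrite rootmxE (negPf xa) (negPf xd) /=.
by rewrite mulr0n mulr0 subr0 mulr0.
Qed.

Definition glhat_vev := @vev C glhat_elt glhat_tag tag_add tag_par glhat_br glhat_pos glhat_char.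

Lemma glhat_char_deg g x : glhat_hom (g, x) -> g.1 != 0 -> glhat_char g x = 0.
Proof. by move=> [_ z] /= ne; rewrite /glhat_char z ?ne ?orbT // (negPf ne) mulr0 addr0. Qed.

Lemma glhat_vev_rel u a b w : okw glhat_hom u -> glhat_hom a -> glhat_hom b -> okw glhat_hom w ->
  glhat_vev (u ++ a :: b :: w) - gsgn a b * glhat_vev (u ++ b :: a :: w) = glhat_vev (u ++ gbr a b :: w).
Proof.
move=> ou oa ob ow.
exact: (vev_rel tag_addA tag_addC tag_parD glhat_br_linl glhat_br_linr glhat_homB glhat_homD glhat_br_anti
  glhat_br_jacobi glhat_pos_lin glhat_hom_pos glhat_pos_idem glhat_pos_subalg glhat_neg_subalg
  glhat_char_lin glhat_char_pos glhat_char_neg glhat_char_odd).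
Qed.

Lemma glhat_vev_lin : slotlin glhat_vev.
Proof. apply: vev_lin; [exact: glhat_br_linl|exact: glhat_br_linr|exact: glhat_pos_lin|exact: glhat_char_lin]. Qed.

Lemma glhat_vev_rcons w x : glhat_hom x -> okw glhat_hom w ->
  (forall a, glhat_hom a -> gplus (gbr (gplus a) x) = gbr (gplus a) x) ->
  glhat_vev (rcons w x) = glhat_char x.1 x.2 * glhat_vev w.
Proof.
move=> ox ow H.
by apply: vev_rcons; [exact: glhat_homB|exact: glhat_hom_pos|exact: glhat_pos_subalg|exact: glhat_char_pos|exact:
  ox|exact: ow|exact: H].
Qed.

Lemma glhat_vev_deg w : okw glhat_hom w -> \sum_(a <- w) a.1.1 != 0 -> glhat_vev w = 0.
Proof.
move=> ow ne; apply: (@vev_deg C glhat_elt glhat_tag tag_add tag_par glhat_br glhat_hom glhat_homB glhat_pos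
  glhat_hom_pos glhat_char fst) => //.
exact: glhat_char_deg.
Qed.

Lemma glhat_vev_K u w z r : glhat_vev (u ++ ((r, false), (0, z)) :: w) = k * z * glhat_vev (u ++ w).
Proof.
rewrite /glhat_vev (@vev_central C glhat_elt glhat_tag tag_add tag_par glhat_br glhat_br_linl glhat_br_linr
  glhat_pos glhat_pos_lin glhat_char glhat_char_lin ((r, false), (0, z))) //.
- by rewrite /glhat_char /= big1 ?if_same ?addr0 // => a _; rewrite mxE mulr0.
- by apply: glhat_elt_eq => //; apply/matrixP => a b; rewrite !mxE if_same.
- move=> a; apply: glhat_elt_eq => /=; first by rewrite /sbr mulmx0 mul0mx scaler0 subr0.
  by rewrite mformE mulmx0 /str big1 ?mulr0 ?mul0rn // => x _; rewrite mxE mulr0.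
Qed.

(** Root and Cartan vectors suffice as letters: K will act by the level, and d will be read off the
    degrees of words. *)
Definition root_letter := (int * I * I)%type.
Definition letter_of (l : root_letter) : glhat_tag * glhat_elt := ((l.1.1, par l.1.2 (+) par l.2), (rtmx l.1.2 l.2, 0)).
Definition word_vev (w : seq root_letter) : C := glhat_vev (map letter_of w).

Lemma letter_of_hom l : glhat_hom (letter_of l).
Proof. by split=> //=; apply: rootmx_hom. Qed.
Lemma letters_hom w : okw glhat_hom (map letter_of w).
Proof. by elim: w => //= l w IH; split=> //; apply: letter_of_hom. Qed.

Definition pair_sgn (a b c d : I) : C := (-1) ^+ ((par a (+) par b) && (par c (+) par d)).

Definition respects_brackets (f : seq root_letter -> C) :=
  (forall w x r a b, f (w ++ (r, dual b, dual a) :: x) = - dsign C a b * f (w ++ (r, a, b) :: x)) /\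
  (forall w x r a b s c d, f (w ++ (r, a, b) :: (s, c, d) :: x)
      - pair_sgn a b c d * f (w ++ (s, c, d) :: (r, a, b) :: x) =
   \sum_e \sum_g (sbr (par a (+) par b) (par c (+) par d) (rtmx a b) (rtmx c d) e g / 2)
       * f (w ++ (r + s, e, g) :: x)
   + ((r%:~R * mform (rtmx a b) (rtmx c d)) *+ (r + s == 0)) * k * f (w ++ x)).

Lemma glhat_vev_slot0 u g w : glhat_vev (u ++ (g, 0) :: w) = 0.
Proof.
have := glhat_vev_lin u g (-1) 0 0 w; rewrite scaler0 addr0 mulN1r => /eqP.
by rewrite addNr => /eqP.
Qed.
Lemma glhat_vev_slotZ u g c x w : glhat_vev (u ++ (g, c *: x) :: w) = c * glhat_vev (u ++ (g, x) :: w).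
Proof. by have := glhat_vev_lin u g c x 0 w; rewrite glhat_vev_slot0 !addr0. Qed.
Lemma glhat_vev_slotsum (T : Type) (s : seq T) (x : T -> glhat_elt) u g w :
  glhat_vev (u ++ (g, \sum_(t <- s) x t) :: w) = \sum_(t <- s) glhat_vev (u ++ (g, x t) :: w).
Proof.
elim: s => [|t s IH]; first by rewrite !big_nil glhat_vev_slot0.
by rewrite !big_cons -IH -[x t]scale1r glhat_vev_lin mul1r scale1r.
Qed.

Lemma glhat_vev_X u g X w : osp X -> is_hom g.2 X -> glhat_vev (u ++ (g, (X, 0)) :: w) =
  \sum_a \sum_b (X a b / 2) * glhat_vev (u ++ ((g.1, par a (+) par b), (rtmx a b, 0)) :: w).
Proof.
move=> oX hX.
have -> : ((X, 0) : glhat_elt) = \sum_a \sum_b (X a b / 2) *: ((rtmx a b, 0) : glhat_elt).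
  apply: glhat_elt_eq.
    rewrite [LHS](osp_expand oX) raddf_sum /=; apply: eq_bigr => a _.
    by rewrite raddf_sum /=; apply: eq_bigr => b _.
  rewrite raddf_sum /= big1 // => a _; rewrite raddf_sum /= big1 // => b _; exact: scaler0.
rewrite glhat_vev_slotsum; apply: eq_bigr => a _; rewrite glhat_vev_slotsum; apply: eq_bigr => b _.
rewrite glhat_vev_slotZ; have [->|nz] := eqVneq (X a b) 0; first by rewrite !mul0r.
have e : par a (+) par b = g.2 by apply/eqP; apply: contraNT nz => ne; rewrite hX.
by rewrite e -surjective_pairing.
Qed.

Lemma word_vev_brackets : respects_brackets word_vev.
Proof.
split.
  move=> w x r a b; rewrite /word_vev !map_cat /= /letter_of /= !par_dual rootmx_dual addbC.
  rewrite -[X in glhat_vev (_ ++ (_, X) :: _)]/((- dsign C a b *: rtmx a b, 0) : glhat_elt).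
  have -> : (- dsign C a b *: rtmx a b, 0) = - dsign C a b *: ((rtmx a b, 0) : glhat_elt).
    by apply: glhat_elt_eq => //=; rewrite scaler0.
  exact: glhat_vev_slotZ.
move=> w x r a b s c d; rewrite /word_vev !map_cat /= -[pair_sgn a b c d]/(gsgn (letter_of (r,a,b)) (letter_of
  (s,c,d))).
rewrite glhat_vev_rel; try exact: letters_hom; try exact: letter_of_hom.
set p := par a (+) par b; set q := par c (+) par d.
have hX : is_hom p (rtmx a b) by apply: rootmx_hom.
have hY : is_hom q (rtmx c d) by apply: rootmx_hom.
set X := sbr p q (rtmx a b) (rtmx c d); set z := (r%:~R * _) *+ _.
have -> : gbr (letter_of (r, a, b)) (letter_of (s, c, d)) = ((r + s, p (+) q), 1 *: ((X, 0) : glhat_elt) + ((0,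
  z) : glhat_elt)).
  by congr pair; rewrite scale1r; apply: glhat_elt_eq; rewrite /= ?addr0 ?add0r.
rewrite glhat_vev_lin mul1r glhat_vev_X; last 2 first.
- by apply: osp_sbr => //; apply: rootmx_osp.
- exact: sbr_hom.
congr (_ + _).
  by apply: eq_bigr => e _; apply: eq_bigr => g _; rewrite map_cat.
(* The central term carries the parity of the bracket. An odd bracket has no central term, so the
   rule for K is needed in even parity only. *)
case epq : (p (+) q); last by rewrite glhat_vev_K [k * z]mulrC.
have -> : z = 0 by rewrite /z (mform_odd hX hY epq) mulr0 mul0rn.
by rewrite glhat_vev_slot0 !mul0r.
Qed.
End AffineAlgebra.

(** * Construction of L(Lambda) *)

Section IrreducibleModule.
Variables (C : numClosedFieldType) (m n : nat).
Local Notation I := 'I_(Nd m n).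
Local Notation Mat := 'M[C]_(Nd m n).
Local Notation hw := (hw C m n).
Local Notation rtmx := (@rootmx C m n).
Variable L : hw.
Local Notation L3 := (root_letter m n).

(* A vector [v] is represented by the functional sending a word [w] to the vacuum
   component of [w v], so that letters act by insertion at the end of words. *)
Definition wfun := (seq L3 -> C^o).
Definition translate (l : L3) (f : wfun) : wfun := fun w => f (rcons w l).

Inductive translate_span : wfun -> Prop :=
| translate_span_base : translate_span (word_vev L)
| translate_span_lin c f g : translate_span f -> translate_span g -> translate_span (c *: f + g)
| translate_span_tr l f : translate_span f -> translate_span (translate l f).

Definition translate_pred : {pred wfun} := fun f => `[< translate_span f >].
Lemma translate_predP f : reflect (translate_span f) (f \in translate_pred).
Proof. exact: asboolP. Qed.

Lemma translate_pred_closed : submod_closed translate_pred.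
Proof.
split.
  apply/translate_predP; have := translate_span_lin (-1) translate_span_base translate_span_base;
    by rewrite scaleN1r addNr.
by move=> c f g /translate_predP hf /translate_predP hg; apply/translate_predP/translate_span_lin.
Qed.

HB.instance Definition _ := GRing.isSubmodClosed.Build C wfun translate_pred translate_pred_closed.

Definition irr_mod := {f : wfun | f \in translate_pred}.
HB.instance Definition _ := SubChoice.on irr_mod.
HB.instance Definition _ := [SubChoice_isSubLmodule of irr_mod by <:].

Lemma irr_mod_ext (u v : irr_mod) : (forall w, val u w = val v w) -> u = v.
Proof. by move=> H; apply: val_inj; apply/funext. Qed.

Lemma val_lin a (u v : irr_mod) w : val (a *: u + v) w = a * val u w + val v w.
Proof. by rewrite linearP. Qed.

Lemma val_scale a (u : irr_mod) w : val (a *: u) w = a * val u w.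
Proof. by rewrite linearZ. Qed.

Lemma translate_span_0 : translate_span 0.
Proof. by have := translate_span_lin (-1) translate_span_base translate_span_base; rewrite scaleN1r addNr. Qed.
Lemma translate_span_Z c f : translate_span f -> translate_span (c *: f).
Proof. by move=> hf; rewrite -[_ *: _]addr0; apply: translate_span_lin => //; apply: translate_span_0. Qed.
Lemma translate_span_sum (T : Type) (s : seq T) (g : T -> wfun) :
  (forall t, translate_span (g t)) -> translate_span (\sum_(t <- s) g t).
Proof.
move=> H; elim: s => [|t s IH]; first by rewrite big_nil; apply: translate_span_0.
by rewrite big_cons -[g t]scale1r; apply: translate_span_lin.
Qed.

Definition act_fun (r : int) (X : Mat) (f : wfun) : wfun :=
  \sum_a \sum_b (X a b / 2) *: translate (r, a, b) f.

Lemma act_funE r X f w : act_fun r X f w = \sum_a \sum_b (X a b / 2) * f (rcons w (r, a, b)).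
Proof.
rewrite /act_fun fct_sumE; apply: eq_bigr => a _; rewrite fct_sumE; exact: eq_bigr.
Qed.

Lemma translate_span_pi r X f : translate_span f -> translate_span (act_fun r X f).
Proof. by move=> hf; apply: translate_span_sum => a; apply: translate_span_sum => b;
  apply/translate_span_Z/translate_span_tr. Qed.

Definition word_deg (w : seq L3) : int := \sum_(l <- w) l.1.1.

Lemma word_deg_rcons w l : word_deg (rcons w l) = word_deg w + l.1.1.
Proof. by rewrite /word_deg big_rcons. Qed.

(** The word [w] detects only the component of the vector whose degree is opposite to that of [w]
    relative to the vacuum; d acts there by its value on the highest weight minus [word_deg w]. *)
Definition deg_fun (f : wfun) : wfun := fun w => (wc L (m + n).+1 - (word_deg w)%:~R) * f w.

Section WithHyps.
Hypotheses (nm : (n + 2 < m)%N) (n1 : (1 <= n)%N).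
Local Notation hh := (@std_height m n false).
Local Notation h0 := (delta_height m n).

Lemma word_vev_deg w : word_deg w != 0 -> word_vev L w = 0.
Proof.
move=> ne; apply: glhat_vev_deg; first exact: letters_hom.
by rewrite big_map.
Qed.

Lemma translate_span_d f : translate_span f -> translate_span (deg_fun f).
Proof.
elim=> {f} [|c f g _ IHf _ IHg|l f hf IH].
- have -> : deg_fun (word_vev L) = wc L (m + n).+1 *: (word_vev L : wfun).
    apply/funext => w; rewrite /deg_fun -[RHS]/(_ * _).
    have [e|/word_vev_deg ->] := eqVneq (word_deg w) 0; last by rewrite !mulr0.
    by rewrite e subr0.
  exact/translate_span_Z/translate_span_base.
- have -> : deg_fun (c *: f + g) = c *: deg_fun f + deg_fun g.
    by apply/funext => w; rewrite /deg_fun -[LHS]/(_ * (c * f w + g w)) -[RHS]/(c * (_ * _) + _ * _); ring.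
  exact: translate_span_lin.
- have -> : deg_fun (translate l f) = l.1.1%:~R *: translate l f + translate l (deg_fun f).
    apply/funext => w; rewrite /deg_fun /translate -[RHS]/(_ * f (rcons w l) + _ * f (rcons w l)).
    by rewrite word_deg_rcons rmorphD /=; ring.
  by apply: translate_span_lin => //; apply: translate_span_tr.
Qed.

Lemma translate_span_brackets f : translate_span f -> respects_brackets L f.
Proof.
elim=> {f} [|c f g _ [f1 f2] _ [g1 g2]|l f hf [f1 f2]].
- exact: word_vev_brackets.
- split.
    move=> w x r a b; rewrite -[LHS]/(c * f _ + g _) f1 g1 -[RHS]/(_ * (c * f _ + g _)); ring.
  move=> w x r a b s e d.
  rewrite -[LHS]/(c * f _ + g _ - _ * (c * f _ + g _)).
  have -> : c * f (w ++ [:: (r, a, b), (s, e, d) & x]) + g (w ++ [:: (r, a, b), (s, e, d) & x]) -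
     pair_sgn C a b e d * (c * f (w ++ [:: (s, e, d), (r, a, b) & x]) + g (w ++ [:: (s, e, d), (r, a, b) & x]))
   = c * (f (w ++ [:: (r, a, b), (s, e, d) & x]) - pair_sgn C a b e d * f (w ++ [:: (s, e, d), (r, a, b) & x]))
   + (g (w ++ [:: (r, a, b), (s, e, d) & x]) - pair_sgn C a b e d * g (w ++ [:: (s, e, d), (r, a, b) & x])) by ring.
  rewrite f2 g2.
  have E (Y : Mat) : \sum_e0 \sum_g0 Y e0 g0 / 2 * (c *: f + g) (w ++ (r + s, e0, g0) :: x) =
     c * (\sum_e0 \sum_g0 Y e0 g0 / 2 * f (w ++ (r + s, e0, g0) :: x)) +
     \sum_e0 \sum_g0 Y e0 g0 / 2 * g (w ++ (r + s, e0, g0) :: x).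
    rewrite mulr_sumr -big_split; apply: eq_bigr => i _; rewrite mulr_sumr -big_split.
    by apply: eq_bigr => j _; rewrite -[(c *: f + g) _]/(c * f _ + g _) /=; ring.
  rewrite E -[(c *: f + g) _]/(c * f _ + g _); ring.
- split.
    by move=> w x r a b; rewrite /translate !rcons_cat !rcons_cons f1.
  move=> w x r a b s e d; rewrite /translate !rcons_cat !rcons_cons f2.
  by congr (_ + _); apply: eq_bigr => i _; apply: eq_bigr => j _; rewrite rcons_cat.
Qed.

Lemma val_span (v : irr_mod) : translate_span (val v). Proof. exact/translate_predP/valP. Qed.

Definition irr_pi r X (v : irr_mod) : irr_mod := Sub (act_fun r X (val v)) (introT (translate_predP _)
  (translate_span_pi r X (val_span v))).
Definition irr_d (v : irr_mod) : irr_mod := Sub (deg_fun (val v)) (introT (translate_predP _) (translate_span_d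
  (val_span v))).
Definition irr_k (v : irr_mod) : irr_mod := wc L (m + n) *: v.
Definition irr_rep : hrep m n irr_mod := HRep irr_pi irr_k irr_d.

Lemma irr_piE r X v w : val (irr_pi r X v) w = \sum_a \sum_b (X a b / 2) * val v (rcons w (r, a, b)).
Proof. by rewrite -act_funE. Qed.
Lemma irr_dE v w : val (irr_d v) w = (wc L (m + n).+1 - (word_deg w)%:~R) * val v w.
Proof. by []. Qed.
Lemma irr_kE v w : val (irr_k v) w = wc L (m + n) * val v w.
Proof. exact: val_scale. Qed.

Lemma lin_expand (vev : Mat -> C) (X : Mat) :
  (forall c Y Z, vev (c *: Y + Z) = c * vev Y + vev Z) -> osp X ->
  vev X = \sum_a \sum_b (X a b / 2) * vev (rtmx a b).
Proof.
move=> pl oX; have p0 : vev 0 = 0.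
  by have := pl (-1) 0 0; rewrite scaler0 addr0 mulN1r addNr.
have ps (T : Type) (t : seq T) (g : T -> Mat) : vev (\sum_(i <- t) g i) = \sum_(i <- t) vev (g i).
  elim: t => [|i t IH]; first by rewrite !big_nil.
  by rewrite !big_cons -IH -[g i]scale1r pl mul1r scale1r.
rewrite {1}(osp_expand oX) ps; apply: eq_bigr => a _; rewrite ps; apply: eq_bigr => b _.
by rewrite -[_ *: _]addr0 pl p0 addr0.
Qed.

Lemma exchange_weighted_sums (x y : I -> I -> C) (g : I -> I -> I -> I -> C) :
  \sum_c \sum_d y c d * (\sum_a \sum_b x a b * g a b c d) =
  \sum_a \sum_b x a b * (\sum_c \sum_d y c d * g a b c d).
Proof.
rewrite !pair_bigA /=.
under eq_bigr => p _ do rewrite pair_bigA mulr_sumr.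
rewrite exchange_big; apply: eq_bigr => q _ /=.
rewrite pair_bigA mulr_sumr; apply: eq_bigr => p _ /=; ring.
Qed.

Lemma irr_rep_rep : is_rep irr_rep.
Proof.
split.
  move=> r X a v1 v2; apply: irr_mod_ext => w; rewrite val_lin !irr_piE mulr_sumr -big_split.
  apply: eq_bigr => i _; rewrite mulr_sumr -big_split; apply: eq_bigr => j _.
  by rewrite val_lin /=; ring.
split.
  move=> r X Y a v _ _; apply: irr_mod_ext => w; rewrite val_lin !irr_piE mulr_sumr -big_split.
  apply: eq_bigr => i _; rewrite mulr_sumr -big_split; apply: eq_bigr => j _.
  by rewrite !mxE /=; ring.
split; first by move=> a v1 v2; apply: irr_mod_ext => w; rewrite val_lin !irr_kE val_lin; ring.
split; first by move=> a v1 v2; apply: irr_mod_ext => w; rewrite val_lin !irr_dE val_lin; ring.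
split; last first.
  split; first by move=> r X v _; apply: irr_mod_ext => w; rewrite irr_kE !irr_piE mulr_sumr;
    apply: eq_bigr => i _; rewrite mulr_sumr; apply: eq_bigr => j _; rewrite irr_kE; ring.
  split; first by move=> v; apply: irr_mod_ext => w; rewrite irr_kE !irr_dE irr_kE; ring.
  move=> r X v _; apply: irr_mod_ext => w.
  rewrite -scaleN1r addrC val_lin val_scale irr_dE !irr_piE !mulr_sumr -big_split.
  apply: eq_bigr => i _; rewrite !mulr_sumr -big_split; apply: eq_bigr => j _.
  by rewrite irr_dE word_deg_rcons rmorphD /=; ring.
move=> p q X Y r s v hX hY oX oY; apply: irr_mod_ext => w.
set f := val v; set k := wc L (m + n).
(* Both sides are bilinear in the two matrices. Expanding them in root vectors reduces the relation
   to [translate_span_brackets] at the end of the word [w]. *)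
pose be (Z W : Mat) : C := \sum_e \sum_g (sbr p q Z W e g / 2) * f (rcons w (r + s, e, g))
   + ((r%:~R * mform Z W) *+ (r + s == 0)) * (k * f w).
have -> : val (irr_pi (r + s) (sbr p q X Y) v + (r%:~R * mform X Y *+ (r + s == 0)) *: irr_k v) w = be X Y.
  by rewrite addrC val_lin irr_kE irr_piE addrC.
have S2 (Z W Z' : Mat) c : \sum_e \sum_g ((c *: Z + W) e g / 2) * f (rcons w (r + s, e, g)) =
    c * (\sum_e \sum_g (Z e g / 2) * f (rcons w (r + s, e, g))) +
    \sum_e \sum_g (W e g / 2) * f (rcons w (r + s, e, g)).
  rewrite mulr_sumr -big_split; apply: eq_bigr => i _; rewrite mulr_sumr -big_split.
  by apply: eq_bigr => j _; rewrite !mxE /=; ring.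
have bel c Z W T : be (c *: Z + W) T = c * be Z T + be W T.
  rewrite /be sbr_linl S2 // mform_linl.
  by case: eqP => _; rewrite ?mulr0n ?mulr1n; ring.
have ber c Z W T : be T (c *: Z + W) = c * be T Z + be T W.
  rewrite /be sbr_linr S2 // mform_linr.
  by case: eqP => _; rewrite ?mulr0n ?mulr1n; ring.
rewrite -scaleN1r addrC val_lin val_scale !irr_piE.
under [X in _ * (_ * X)]eq_bigr => c _ do under eq_bigr => d _ do rewrite irr_piE.
under [X in _ + X]eq_bigr => a _ do under eq_bigr => b _ do rewrite irr_piE.
rewrite (exchange_weighted_sums (fun a b => X a b / 2) (fun c d => Y c d / 2)
   (fun a b c d => f (rcons (rcons w (s, c, d)) (r, a, b)))).
rewrite (lin_expand (vev := fun Z => be Z Y)) //.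
rewrite mulrA mulN1r mulr_sumr -big_split; apply: eq_bigr => a _ /=.
rewrite mulr_sumr -big_split; apply: eq_bigr => b _ /=.
have [->|Xn] := eqVneq (X a b) 0; first by rewrite !mul0r mulr0 addr0.
rewrite mulrCA -mulrDr; congr (_ * _).
rewrite (lin_expand (vev := be (rtmx a b))) //.
rewrite mulr_sumr -big_split; apply: eq_bigr => c _ /=.
rewrite mulr_sumr -big_split; apply: eq_bigr => d _ /=.
have [->|Yn] := eqVneq (Y c d) 0; first by rewrite !mul0r mulr0 addr0.
rewrite mulrCA -mulrDr; congr (_ * _).
have ep : par a (+) par b = p by apply/eqP; apply: contraNT Xn => ne; rewrite hX.
have eq_ : par c (+) par d = q by apply/eqP; apply: contraNT Yn => ne; rewrite hY.
have [_ /(_ w [::] r a b s c d)] := translate_span_brackets (val_span v).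
rewrite /pair_sgn ep eq_ cats0 -/f -!cats1 -!catA /= mulNr addrC => ->; congr (_ + _).
  by apply: eq_bigr => i _; apply: eq_bigr => j _; rewrite -cats1.
by rewrite -mulrA.
Qed.

Definition irr_hwv : irr_mod := Sub (word_vev L : wfun) (introT (translate_predP _) translate_span_base).

Lemma word_vev_pos w r a b : pos_entry r a b -> word_vev L (rcons w (r, a, b)) = 0.
Proof.
move=> ps; have e : cplus (@glhat_pos C m n) (letter_of C (r, a, b)) = letter_of C (r, a, b).
  rewrite /cplus /glhat_pos; congr pair; apply: glhat_elt_eq => //; apply/matrixP => x y; rewrite mxE /=.
  case: ifP => // np; apply/esym/eqP; apply: contraFT np.
  case/rootmx_supp => [[-> ->] //|[-> ->]]; move: ps; rewrite /pos_entry !(std_height_dual false).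
  by case: (0 < r) => //=; case: (r == 0) => //=; rewrite ltrN2.
rewrite /word_vev map_rcons glhat_vev_rcons //; first last.
- move=> c oc; rewrite -e; apply: glhat_pos_subalg => //; exact: letter_of_hom.
- exact: letters_hom.
- exact: letter_of_hom.
by rewrite -e glhat_char_pos mul0r.
Qed.

Lemma word_vev_diag w a : word_vev L (rcons w (0, a, a)) = idx_coord L a * word_vev L w.
Proof.
rewrite /word_vev map_rcons glhat_vev_rcons //; first last.
- move=> [[r p] [X z]] oc; rewrite /cplus /cbr /=; congr pair; apply: glhat_elt_eq => /=; last first.
    rewrite addr0; case: eqP => [->|_]; last by rewrite mulr0n.
    by rewrite mul0r mul0rn.
  apply/matrixP => x y; rewrite mxE; case: ifP => //= np; apply/esym/eqP; apply: contraFT np.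
  have dg x' y' : rtmx a a x' y' != 0 -> x' = y' by case/rootmx_supp => -[-> ->].
  rewrite addr0; case/sbr_nz => t [] [].
    by move=> /(@glhat_pos_nz C m n (r, p) (X, z)) /= ps /dg <-.
  by move=> /dg -> /(@glhat_pos_nz C m n (r, p) (X, z)) /= ps.
- exact: letters_hom.
- exact: letter_of_hom.
by congr (_ * _); exact: glhat_char_diag.
Qed.

Lemma irr_pi_hwv r X w : val (irr_pi r X irr_hwv) w = \sum_a \sum_b (X a b / 2) * word_vev L (rcons w (r, a, b)).
Proof. exact: irr_piE. Qed.

Lemma irr_hwv_hw : hwvec irr_rep L irr_hwv.
Proof.
split.
  by move=> /(congr1 (fun v : irr_mod => val v [::])); rewrite /= => /eqP; rewrite oner_eq0.
split.
  move=> H hH; apply: irr_mod_ext => w; rewrite [LHS]irr_pi_hwv val_scale.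
  have dH : forall a b, a != b -> H a b = 0 by case: hH.
  have -> : \sum_a \sum_b H a b / 2 * word_vev L (rcons w (0, a, b)) =
      (\sum_a H a a / 2 * idx_coord L a) * word_vev L w.
    rewrite mulr_suml; apply: eq_bigr => a _; rewrite (bigD1 a) //= big1 ?addr0.
      by rewrite word_vev_diag mulrA.
    by move=> b ba; rewrite dH ?mul0r // eq_sym.
  congr (_ * _); have -> : lamH L H = \sum_a \sum_b H a b / 2 * lamH L (rtmx a b).
    apply: lin_expand; last by case: hH.
    by move=> c Y Z; rewrite lamH_linr.
  apply: eq_bigr => a _; rewrite (bigD1 a) //= big1 ?addr0 ?lamH_rootmx //.
  by move=> b ba; rewrite dH ?mul0r // eq_sym.
split; first by [].
split.
  apply: irr_mod_ext => w; rewrite [LHS]irr_dE val_scale /=.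
  have [e|/word_vev_deg ->] := eqVneq (word_deg w) 0; last by rewrite !mulr0.
  by rewrite e subr0.
split.
  move=> al X [[fal [aln _]] Qal] rX; apply: irr_mod_ext => w; rewrite [LHS]irr_pi_hwv.
  rewrite big1 // => a _; rewrite big1 // => b _.
  have [->|nz] := eqVneq (X a b) 0; first by rewrite !mul0r.
  rewrite word_vev_pos ?mulr0 // /pos_entry ltxx eqxx /=.
  have ea := rootspace_supp nm n1 fal rX nz.
  have [p p0] := inQplus_height nm n1 Qal aln; rewrite -ea height_wtD height_wtN !height_wt_idx_wt //.
  rewrite -rmorphB /= pmulrn => /intr_inj e.
  by rewrite -subr_gt0 e ltz_nat.
move=> r X rp oX; apply: irr_mod_ext => w; rewrite [LHS]irr_pi_hwv.
by rewrite big1 // => a _; rewrite big1 // => b _; rewrite word_vev_pos ?mulr0 // /pos_entry rp.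
Qed.

Lemma sum_rootmx (G : I -> I -> C) a b :
  \sum_x \sum_y (rtmx a b x y / 2) * G x y = (G a b - dsign C a b * G (dual b) (dual a)) / 2.
Proof.
have D (x0 y0 : I) : \sum_x \sum_y ((x == x0) && (y == y0))%:R * G x y = G x0 y0.
  rewrite (bigD1 x0) //= [X in _ + X]big1 ?addr0; last first.
    by move=> x /negPf nx; rewrite big1 // => y _; rewrite nx mul0r.
  rewrite (bigD1 y0) //= big1 ?addr0 ?eqxx ?mul1r // => y /negPf ny.
  by rewrite ny andbF mul0r.
rewrite -{1}(D a b) -(D (dual b) (dual a)) mulr_sumr -sumrB mulr_suml.
apply: eq_bigr => x _; rewrite mulr_sumr -sumrB mulr_suml; apply: eq_bigr => y _.
by rewrite rootmxE; ring.
Qed.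

(** A root vector has two entries in the expansion defining the action; their contributions agree by
    the first half of [respects_brackets], which compensates the 1/2. *)
Lemma irr_pi_rootmx r a b v w : val (irr_pi r (rtmx a b) v) w = val v (rcons w (r, a, b)).
Proof.
rewrite irr_piE (sum_rootmx (fun x y => val v (rcons w (r, x, y)))).
have [/(_ w [::] r a b) + _] := translate_span_brackets (val_span v); rewrite !cats1 => ->.
have z2 := dsign2 C a b.
by rewrite mulNr mulrN opprK mulrA z2 mul1r; field.
Qed.

Lemma irr_hwv_singular : hsingular irr_rep hh h0 irr_hwv.
Proof. exact: (hw_singular nm n1 irr_hwv_hw). Qed.

Lemma lower_span_irr_hwv v : lower_span irr_rep hh h0 irr_hwv v.
Proof.
have hH := std_height_is_height nm n1 false.
have [_ [_ [_ [G _]]]] := lower_span_submodule irr_rep_rep hH irr_hwv_singular (hw_wvec irr_hwv_hw).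
suff H f : translate_span f -> forall v : irr_mod, val v = f -> lower_span irr_rep hh h0 irr_hwv v.
  exact: (H _ (val_span v)).
elim=> {f v} [|c f g hf IHf hg IHg|[[r a] b] f hf IH] v ev.
- have -> : v = irr_hwv by apply: val_inj.
  exact: lower_span_base.
- pose u1 : irr_mod := Sub f (introT (translate_predP _) hf); pose u2 :
  irr_mod := Sub g (introT (translate_predP _) hg).
  have -> : v = c *: u1 + u2 by apply: irr_mod_ext => w; rewrite val_lin ev.
  by apply: lower_span_lin; [apply: IHf | apply: IHg].
- pose u1 : irr_mod := Sub f (introT (translate_predP _) hf).
  have -> : v = irr_pi r (rtmx a b) u1 by apply: irr_mod_ext => w; rewrite irr_pi_rootmx ev.
  by apply: G; [exact: rootmx_osp | exact: IH].
Qed.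

(** A Cartan letter at the front acts last, and the functional sees only the vacuum component of the
    result, where the letter is a scalar. Right translations do not disturb the front of the
    word. *)
Lemma translate_span_left f a w : translate_span f -> f ((0, a, a) :: w) = idx_coord L a * f w.
Proof.
move=> hf; elim: hf w => {f} [|c f g _ IHf _ IHg|l f hf IH] w.
- rewrite /word_vev /= /glhat_vev vev_cons.
  have -> : cplus (@glhat_pos C m n) (letter_of C (0, a, a)) = ((0, par a (+) par a), 0).
    congr pair; apply: glhat_elt_eq => //; apply/matrixP => x y; rewrite mxE [RHS]mxE /pos_entry ltxx eqxx /=.
    case: ifP => // lx; apply/eqP; apply: contraTT lx => /rootmx_supp.
    by case=> -[-> ->]; rewrite ltxx.
  rewrite coact_zero ?addr0; first last.
  + exact: glhat_vev_lin.
  + exact: glhat_br_linl.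
  by congr (_ * _); exact: glhat_char_diag.
- by rewrite -[LHS]/(c * f _ + g _) IHf IHg -[(c *: f + g) w]/(c * f w + g w); ring.
- by rewrite /translate rcons_cons IH.
Qed.

Local Notation T := (height_op irr_rep hh h0).
Local Notation PT := (height_poly irr_rep hh h0).
Local Notation dL := (height_wt hh h0 L).

Lemma height_op_nil v : val (T v) [::] = dL * val v [::].
Proof.
have -> : T v = h0%:~R *: irr_d v + irr_pi 0 (height_mx C hh) v by rewrite /height_op addrC.
rewrite val_lin irr_dE /word_deg big_nil subr0 irr_piE.
rewrite /height_wt mulrDl [RHS]addrC mulrA; congr (_ + _).
have hH := std_height_is_height nm n1 false.
have [oH dH] := height_mx_hmat C hH.
rewrite (lin_expand (vev := lamH L) _ oH); last by move=> c Y Z; apply: lamH_linr.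
rewrite mulr_suml; apply: eq_bigr => a _.
rewrite (bigD1 a) //= big1 ?addr0; last by move=> b ba; rewrite dH ?mul0r // eq_sym.
rewrite (bigD1 a) //= big1 ?addr0; last by move=> b ba; rewrite dH ?mul0r // eq_sym.
by rewrite lamH_rootmx (translate_span_left _ _ (val_span v)) mulrA.
Qed.

(** The value at the empty word is the vacuum component, on which each factor acts by its own index
    [j]. For indices at least 1 it is multiplied by a nonzero number. *)
Lemma height_poly_nil s v : val (PT dL s v) [::] = (\prod_(j <- s) j%:R) * val v [::].
Proof.
elim: s v => [|j s IH] v /=; first by rewrite big_nil mul1r.
rewrite IH big_cons -scaleNr addrC val_lin height_op_nil -[sval v]/(val v); ring.
Qed.

Lemma irr_rep_irr : irreducible irr_rep.
Proof.
split; first by exists irr_hwv; case: irr_hwv_hw.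
move=> W [W0 [WD [WZ [WX [WK Wd]]]]].
have [[f [Wf fn]]|H] := pselect (exists f, W f /\ f <> 0); last first.
  by left=> f Wf; apply/eqP; apply: contraT => /eqP fn; case: H; exists f.
right=> v.
have hH := std_height_is_height nm n1 false.
suff Wv : W irr_hwv.
  elim: (lower_span_irr_hwv v) => {v} [|c x y _ Wx _ Wy|r a b x _ _ Wx] //.
    by apply: WD => //; apply: WZ.
  by apply: WX => //; apply: rootmx_osp.
have [w fw] : exists w, val f w <> 0.
  have [//|H] := pselect (exists w, val f w <> 0); case: fn.
  apply: irr_mod_ext => w; apply/eqP; apply: contraT => /eqP fw; case: H; exists w.
  by rewrite linear0 in fw.
(* Applying the letters of [w] moves the nonzero value of [f] at [w] to the empty word. *)
have [g [Wg gn]] : exists g, W g /\ val g [::] <> 0.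
  elim/last_ind: w f Wf fw {fn} => [|w [[r a] b] IH] f Wf fw; first by exists f.
  by apply: (IH (irr_pi r (rtmx a b) f)); [apply: WX => //; exact: rootmx_osp | rewrite irr_pi_rootmx].
have [s [a [sp es]]] := lower_span_poly irr_rep_rep hH (hw_wvec irr_hwv_hw) (lower_span_irr_hwv g).
have pn : \prod_(j <- s) j%:R != 0 :> C.
  rewrite prodf_seq_neq0; apply/allP => j js; rewrite /= pnatr_eq0 -lt0n; exact: (allP sp).
have ea : a <> 0.
  move=> a0; move: es; rewrite a0 scale0r subr0 => /(congr1 (fun v => val v [::])).
  by rewrite height_poly_nil linear0 => /eqP; rewrite mulf_eq0 (negPf pn) => /eqP.
have WP t x : W x -> W (PT dL t x).
  elim: t x => //= j t IH x Wx; apply: IH; apply: (WD); last by rewrite -scaleNr; apply: (WZ).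
  apply: (WD); [apply: (WX) => //; exact: (proj1 (height_mx_hmat C hH)) | apply: (WZ); exact: Wd].
(* The annihilating product removes from [g] all but its top component [a *: irr_hwv], which it
   multiplies by a nonzero scalar; hence the submodule contains the highest weight vector. *)
have := WP s g Wg; rewrite -[g](subrK (a *: irr_hwv)) (linD (height_poly_lin irr_rep_rep _ _ _ _)) es add0r.
rewrite (height_poly_Z irr_rep_rep) (height_poly_w irr_rep_rep hH _ _ (hw_wvec irr_hwv_hw)) scalerA.
under eq_bigr => j _ do rewrite subrr add0r.
move=> /(WZ (a * \prod_(j <- s) j%:R)^-1); rewrite scalerA mulVf ?scale1r //.
by rewrite mulf_neq0 //; apply/eqP.
Qed.

Lemma irr_rep_L : is_L irr_rep L.
Proof. by split; [exact: irr_rep_rep | split; [exact: irr_rep_irr | exists irr_hwv; exact: irr_hwv_hw]]. Qed.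
End WithHyps.
End IrreducibleModule.

(** * Reflections of the set of weights *)

Section Weyl.
Variables (C : numClosedFieldType) (m n : nat).
Hypotheses (nm : (n + 2 < m)%N) (n1 : (1 <= n)%N).
Local Notation I := 'I_(Nd m n).
Local Notation hw := (hw C m n).
Variables (V : lmodType C) (rho : hrep m n V).
Hypothesis R : is_rep rho.

Definition is_weight (mu : hw) := exists w, w <> 0 /\ weight_vec rho mu w.
Definition refl_stable (be : hw) := forall mu, is_weight mu -> is_weight (mu - wform mu be *: be).

Lemma wformDr (la mu nu : hw) : wform la (mu + nu) = wform la mu + wform la nu.
Proof. by rewrite -[mu]scale1r wform_lin mul1r scale1r. Qed.
Lemma wformZr c (la mu : hw) : wform la (c *: mu) = c * wform la mu.
Proof.
have z : wform la 0 = 0.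
  by have := wform_lin (-1) 0 0 la; rewrite scaler0 addr0 mulN1r addNr.
by rewrite -[_ *: _]addr0 wform_lin z addr0.
Qed.
Lemma wformNr (la mu : hw) : wform la (- mu) = - wform la mu.
Proof. by rewrite -scaleN1r wformZr mulN1r. Qed.

Lemma refl_stableN be : refl_stable be -> refl_stable (- be).
Proof. by move=> H mu /H; rewrite wformNr scalerN scaleNr opprK. Qed.

(** The reflection in [be + ga] is the product of the reflections in [be], [ga] and again [be]. *)
Lemma refl_stableD be ga : wform be be = 2 -> wform be ga = -1 -> refl_stable be -> refl_stable ga ->
  refl_stable (be + ga).
Proof.
move=> bb bg Hb Hg mu /Hb/Hg/Hb; set x := wform mu be.
have e1 : wform (mu - x *: be) ga = x + wform mu ga.
  by rewrite wformC wformDr wformNr wformZr ![wform ga _]wformC bg; ring.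
have e2 : wform (mu - x *: be - (x + wform mu ga) *: ga) be = wform mu ga.
  rewrite wformC !wformDr !wformNr !wformZr bb bg [wform be mu]wformC -/x; ring.
rewrite e1 e2 wformDr -/x; congr is_weight.
set y := wform mu ga; move: y => y.
by rewrite scalerDr [(x + _) *: be]scalerDl !opprD !addrA addrAC.
Qed.

Definition aff_refl_stable r (a b : I) := refl_stable (aff_root C r a b).

Lemma idx_rank_neq (a b : I) : idx_rank a != idx_rank b -> a != b /\ b != dual a.
Proof.
by move=> ne; split; apply: contra ne => /eqP ->; rewrite ?idx_rank_dual.
Qed.

Lemma idx_rank_eq (a b : I) : idx_rank a = idx_rank b -> b = a \/ b = dual a.
Proof.
move=> e; case: (eqVneq (idx_pos a) (idx_pos b)) => [e2|ne]; [left|right]; apply: (idx_rank_inj nm n1) => //.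
  by rewrite idx_rank_dual.
by rewrite idx_pos_dual; move: ne; case: (idx_pos a); case: (idx_pos b).
Qed.

Lemma wform_aff_root r s (a b c d : I) : ~~ par c -> ~~ par d ->
  wform (aff_root C r a b) (aff_root C s c d) = idx_coord (aff_root C r a b) c - idx_coord (aff_root C r a b) d.
Proof.
move=> /negPf pc /negPf pd; have := coroot_wform (aff_root C r a b) s c d.
by rewrite /coroot pc pd /= !expr0 aff_root_lev mulr0 addr0 !mul1r => <-.
Qed.

Lemma idx_rank_eqF (a b : I) : idx_rank a != idx_rank b -> (a == b) = false /\ (a == dual b) = false.
Proof.
by move=> ne; split; apply: negbTE; apply: contra ne => /eqP ->; rewrite ?idx_rank_dual.
Qed.

(** The roots add up along the common index [b], and distinct ranks make their product equal to
    -1. *)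
Lemma aff_refl_stable_chain r s a b c : ~~ par a -> ~~ par b -> ~~ par c ->
  idx_rank a != idx_rank b -> idx_rank b != idx_rank c -> idx_rank a != idx_rank c -> aff_refl_stable r a b ->
    aff_refl_stable s b c -> aff_refl_stable (r + s) a c.
Proof.
move=> pa pb pc ab bc ac H1 H2.
have [f1 f2] := idx_rank_eqF ab; have [f3 f4] := idx_rank_eqF bc; have [f5 f6] := idx_rank_eqF ac.
rewrite eq_sym in ab; have [f7 f8] := idx_rank_eqF ab.
have dd x : (x == dual x) = false by rewrite eq_sym dual_neq.
rewrite /aff_refl_stable; have -> : aff_root C (r + s) a c = aff_root C r a b + aff_root C s b c.
  by rewrite /aff_root rmorphD scalerDl [RHS]addrACA; congr (_ + _); rewrite addrA subrK.
apply: refl_stableD => //; rewrite wform_aff_root // !idx_coord_aff_root ?eqxx ?dd ?f1 ?f2 ?f3 ?f4 ?f5 ?f6 ?f7 ?f8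
 !(mulr0n, mulr1n); ring.
Qed.

Lemma aff_refl_stable_dual r a b : aff_refl_stable r a b -> aff_refl_stable r (dual b) (dual a).
Proof. by rewrite /aff_refl_stable /aff_root !idx_wt_dual opprK [- _ + _]addrC. Qed.
Lemma aff_refl_stable_neg r a b : aff_refl_stable r a b -> aff_refl_stable (- r) b a.
Proof. by rewrite /aff_refl_stable aff_rootN; apply: refl_stableN. Qed.

Definition eps_idx (i : nat) (h : (i < m)%N) : I := ep n (Ordinal h).

Lemma eps_idx_rk i (h : (i < m)%N) : idx_rank (eps_idx h) = eps_rank n i.
Proof. by rewrite /idx_rank /eps_idx idxE. Qed.
Lemma eps_idx_par i (h : (i < m)%N) : par (eps_idx h) = false.
Proof. by rewrite /eps_idx parE. Qed.
Lemma eps_rank_inj i j : eps_rank n i = eps_rank n j -> i = j.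
Proof. by clear nm n1; rewrite /eps_rank; case: ifP; case: ifP; lia. Qed.
Lemma eps_rank_eq i j : (eps_rank n i == eps_rank n j) = (i == j).
Proof. by apply/eqP/eqP => [/eps_rank_inj|->]. Qed.

Lemma par_eps_idx (a : I) : ~~ par a -> exists i (h : (i < m)%N), a = eps_idx h \/ a = dual (eps_idx h).
Proof.
case: (idxP a) => i; rewrite parE // => _; exists i, (ltn_ord i); [left|right].
  by rewrite /eps_idx; congr ep; apply: val_inj.
by rewrite /eps_idx /dual idxE; congr em; apply: val_inj.
Qed.

(** Supplies the intermediate index for chains; one of eps_1, eps_2, eps_3 always differs in rank
    from both [a] and [b]. *)
Lemma third_rank (a b : I) : exists e : I, [/\ ~~ par e, idx_rank a != idx_rank e & idx_rank b != idx_rank e].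
Proof.
have [l0 [l1 l2]] : (0 < m)%N /\ (1 < m)%N /\ (2 < m)%N by split; [|split]; lia.
have ne i j : i != j -> (eps_rank n i != eps_rank n j) by rewrite eps_rank_eq.
have c01 := ne 0%N 1%N isT; have c02 := ne 0%N 2%N isT; have c12 := ne 1%N 2%N isT.
have [e0|/norP [x0 y0]] := boolP ((idx_rank a == eps_rank n 0) || (idx_rank b == eps_rank n 0)); last first.
  by exists (eps_idx l0); rewrite eps_idx_rk eps_idx_par.
have [e1|/norP [x0 y0]] := boolP ((idx_rank a == eps_rank n 1) || (idx_rank b == eps_rank n 1)); last first.
  by exists (eps_idx l1); rewrite eps_idx_rk eps_idx_par.
exists (eps_idx l2); rewrite eps_idx_rk eps_idx_par.
case/orP: e0 => /eqP e0; case/orP: e1 => /eqP e1; try by rewrite e0 e1.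
  by rewrite e0 in e1; rewrite e1 eqxx in c01.
by rewrite e0 in e1; rewrite e1 eqxx in c01.
Qed.

(** * From the simple roots to all real roots of affine so(2m) *)

Section Closure.
Hypothesis Bstep : forall i (h : (i < m)%N) (h' : (i.+1 < m)%N), aff_refl_stable 0 (eps_idx h') (eps_idx h).
Hypothesis Bfork : forall (h : (0 < m)%N) (h' : (1 < m)%N), aff_refl_stable 0 (eps_idx h') (dual (eps_idx h)).
Hypothesis Baff : forall (h : (m.-1 < m)%N) (h' : (m.-2 < m)%N), aff_refl_stable 1 (dual (eps_idx h)) (eps_idx h').

Lemma aff_refl_stable_lt i j (hi : (i < m)%N) (hj : (j < m)%N) : (i < j)%N ->
  aff_refl_stable 0 (eps_idx hj) (eps_idx hi).
Proof.
elim: j hj => // j IH hj; rewrite ltnS leq_eqVlt => /orP[/eqP e|ij].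
  by subst j; apply: Bstep.
have hj' : (j < m)%N by lia.
rewrite -[0]addr0; apply: (@aff_refl_stable_chain 0 0 _ (eps_idx hj'));
  rewrite ?eps_idx_par ?eps_idx_rk ?eps_rank_eq //; try lia.
exact: IH.
Qed.

Lemma aff_refl_stable_pp i j (hi : (i < m)%N) (hj : (j < m)%N) : i != j -> aff_refl_stable 0 (eps_idx hj) (eps_idx hi).
Proof.
rewrite neq_ltn => /orP[|ji]; first exact: aff_refl_stable_lt.
by rewrite -oppr0; apply/aff_refl_stable_neg/aff_refl_stable_lt.
Qed.

Lemma aff_refl_stable_pq0 j (h0 : (0 < m)%N) (hj : (j < m)%N) : (0 < j)%N ->
  aff_refl_stable 0 (eps_idx hj) (dual (eps_idx h0)).
Proof.
move=> j0; have h1 : (1 < m)%N by lia.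
case: (eqVneq j 1%N) => [e|ne]; first by subst j; apply: Bfork.
rewrite -[0]addr0; apply: (@aff_refl_stable_chain 0 0 _ (eps_idx h1));
  rewrite ?par_dual ?eps_idx_par ?idx_rank_dual ?eps_idx_rk ?eps_rank_eq //; try lia.
by apply: aff_refl_stable_pp; rewrite eq_sym.
Qed.

Lemma aff_refl_stable_pq i j (hi : (i < m)%N) (hj : (j < m)%N) : i != j ->
  aff_refl_stable 0 (eps_idx hj) (dual (eps_idx hi)).
Proof.
have h0 : (0 < m)%N by lia.
move=> ij; case: (posnP i) => i0; first by subst i; apply: aff_refl_stable_pq0; lia.
case: (posnP j) => j0.
  by subst j; rewrite -[eps_idx hj]dualK; apply: aff_refl_stable_dual; apply: aff_refl_stable_pq0.
rewrite -[0]addr0; apply: (@aff_refl_stable_chain 0 0 _ (dual (eps_idx h0)));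
  rewrite ?par_dual ?eps_idx_par ?idx_rank_dual ?eps_idx_rk ?eps_rank_eq //; try lia.
  exact: aff_refl_stable_pq0.
by apply: aff_refl_stable_dual; apply: aff_refl_stable_pp; lia.
Qed.

Lemma aff_refl_stable_0 a b : ~~ par a -> ~~ par b -> idx_rank a != idx_rank b -> aff_refl_stable 0 a b.
Proof.
move=> /par_eps_idx [i [hi ea]] /par_eps_idx [j [hj eb]] ab.
have ji : j != i.
  by apply: contra ab => /eqP e; subst j; case: ea => ->; case: eb => ->; rewrite ?idx_rank_dual !eps_idx_rk.
case: ea => ->; case: eb => ->.
- exact: aff_refl_stable_pp.
- exact: aff_refl_stable_pq.
- by rewrite -oppr0; apply/aff_refl_stable_neg/aff_refl_stable_pq; rewrite eq_sym.
- by apply/aff_refl_stable_dual/aff_refl_stable_pp; rewrite eq_sym.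
Qed.

(** The single root provided by [Baff] is spread by adding roots of degree 0: [A] changes its first
    index, [B] its second. When the index wanted has the rank of the one to be replaced, a third
    index serves as a detour. *)
Lemma aff_refl_stable_1 c d : ~~ par c -> ~~ par d -> idx_rank c != idx_rank d -> aff_refl_stable 1 c d.
Proof.
have h1 : (m.-1 < m)%N by lia.
have h2 : (m.-2 < m)%N by lia.
set a0 := dual (eps_idx h1); set b0 := eps_idx h2; have B0 : aff_refl_stable 1 a0 b0 by apply: Baff.
have pa0 : ~~ par a0 by rewrite par_dual eps_idx_par.
have pb0 : ~~ par b0 by rewrite eps_idx_par.
have ab0 : idx_rank a0 != idx_rank b0 by rewrite idx_rank_dual !eps_idx_rk eps_rank_eq; lia.
have A x : ~~ par x -> idx_rank x != idx_rank b0 -> aff_refl_stable 1 x b0.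
  have A1 y : ~~ par y -> idx_rank y != idx_rank b0 -> idx_rank y != idx_rank a0 -> aff_refl_stable 1 y b0.
    move=> py yb ya; rewrite -[1]add0r; apply: (@aff_refl_stable_chain 0 1 y a0 b0) => //.
    exact: aff_refl_stable_0.
  move=> px xb; have [/esym/idx_rank_eq [->//|ex]|] := eqVneq (idx_rank x) (idx_rank a0); last exact: A1.
  have [e [pe ae be]] := third_rank a0 b0; rewrite eq_sym in be; rewrite eq_sym in ae.
  rewrite -[1]add0r; apply: (@aff_refl_stable_chain 0 1 x e b0) => //.
  - by rewrite ex idx_rank_dual eq_sym.
  - by apply: aff_refl_stable_0 => //; rewrite ex idx_rank_dual eq_sym.
  - exact: A1.
have B x y : ~~ par x -> ~~ par y -> idx_rank x != idx_rank y -> idx_rank x != idx_rank b0 -> aff_refl_stable 1 x y.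
  have B1 u w : ~~ par u -> ~~ par w -> idx_rank u != idx_rank w -> idx_rank u != idx_rank b0 ->
    idx_rank b0 != idx_rank w -> aff_refl_stable 1 u w.
    move=> pu pw uw ub bw; rewrite -[1]addr0; apply: (@aff_refl_stable_chain 1 0 u b0 w) => //; first exact: A.
    exact: aff_refl_stable_0.
  move=> px py xy xb; have [/idx_rank_eq [->//|ey]|] := eqVneq (idx_rank b0) (idx_rank y); first exact: A;
    last exact: B1.
  have [e [pe xe be]] := third_rank x b0.
  have ey' : idx_rank e != idx_rank y by rewrite ey idx_rank_dual eq_sym.
  rewrite -[1]addr0; apply: (@aff_refl_stable_chain 1 0 x e y) => //; first exact: B1.
  exact: aff_refl_stable_0.
move=> pc pd cd; have [e|] := eqVneq (idx_rank c) (idx_rank b0); last exact: B.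
(* The case left over has [c] of the rank of [b0]. Passing to the dual pair puts [d], whose rank
   differs, in front. *)
rewrite -[c]dualK -[d]dualK; apply: aff_refl_stable_dual; apply: B; rewrite ?par_dual ?idx_rank_dual //.
  by rewrite eq_sym.
by rewrite -e eq_sym.
Qed.

Lemma aff_refl_stable_all (r : nat) a b : ~~ par a -> ~~ par b -> idx_rank a != idx_rank b -> aff_refl_stable r%:Z a b.
Proof.
elim: r a b => [|r IH] a b pa pb ab; first exact: aff_refl_stable_0.
case: (posnP r) => [->|_]; first exact: aff_refl_stable_1.
have [e [pe ae be]] := third_rank a b; rewrite eq_sym in be.
rewrite -addn1 PoszD; apply: (@aff_refl_stable_chain r%:Z 1 a e b) => //; first exact: IH.
exact: aff_refl_stable_1.
Qed.
End Closure.
End Weyl.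

(** * Integrability and dominance *)

Section Integrability.
Variables (C : numClosedFieldType) (m n : nat).
Hypotheses (nm : (n + 2 < m)%N) (n1 : (1 <= n)%N).
Local Notation I := 'I_(Nd m n).
Local Notation hw := (hw C m n).
Local Notation h0 := (delta_height m n).
Variables (V : lmodType C) (rho : hrep m n V) (L : hw) (v : V).
Hypothesis R : is_rep rho.
Hypothesis irr : irreducible rho.
Hypothesis Hv : hwvec rho L v.
Local Notation opF := (rootop rho).
Local Notation hgt := (height_wt (std_height false) h0).
Local Notation ahgt := (aff_height (std_height false) h0).

Let vn : v <> 0. Proof. by case: Hv. Qed.
Let vw : weight_vec rho L v. Proof. exact: (hw_wvec Hv). Qed.
Let vs s : hsingular rho (std_height s) h0 v. Proof. exact: (hw_singular nm n1 Hv). Qed.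

Lemma rank_root_pair (a b : I) : idx_rank a != idx_rank b -> root_pair a b.
Proof. by move=> /idx_rank_neq[_ ne]; rewrite /root_pair ne. Qed.

Lemma loc_nil_rootop r (a b : I) x : ~~ par a -> ~~ par b -> idx_rank a != idx_rank b -> x <> 0 ->
  loc_nil (opF r a b) x -> forall w, loc_nil (opF r a b) w.
Proof.
move=> /negPf pa /negPf pb /idx_rank_neq [ab bda] xn lx.
apply: (loc_nil_all R irr) xn lx; first exact: rootmx_osp.
  by have := @rootmx_hom C m n a b; rewrite pa pb.
exact: rootmx_sq.
Qed.

Lemma simple_refl_stable r (a b : I) x : ~~ par a -> ~~ par b -> idx_rank a != idx_rank b ->
  0 < ahgt r a b -> x <> 0 -> loc_nil (opF (- r) b a) x -> aff_refl_stable rho r a b.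
Proof.
move=> pa pb ab pos xn lx mu [w [wn ww]].
have [nab bda] := idx_rank_neq ab.
have ba : idx_rank b != idx_rank a by rewrite eq_sym.
have fn := loc_nil_rootop pb pa ba xn lx.
have en : forall y, loc_nil (opF r a b) y.
  apply: (loc_nil_rootop pa pb ab vn); exists 1%N => /=.
  by apply: (@vs false) => //; exact: rank_root_pair.
have := refl_weight R nab bda pa pb ww wn fn en.
by rewrite (coroot_wform mu) (negPf pa) expr0 mul1r.
Qed.

(* If [f_be ^ N v <> 0] for all [N], reflecting its weight in [be] gives, for
   large [N], weights whose height exceeds that of [L]. *)
Lemma real_nil r (a b : I) : ~~ par a -> ~~ par b -> idx_rank a != idx_rank b ->
  0 < ahgt r a b -> aff_refl_stable rho r a b -> loc_nil (opF (- r) b a) v.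
Proof.
move=> pa pb ab pos B.
have hH := std_height_is_height nm n1 false.
have [//|H] := pselect (loc_nil (opF (- r) b a) v); exfalso.
set be := aff_root C r a b in B.
have bb : wform be be = 2.
  have [nab bda] := idx_rank_neq ab; have := coroot_aff_root C r nab bda pa pb.
  by rewrite coroot_wform (negPf pa) expr0 mul1r.
set x := wform L be.
have [d ed] : exists d : nat, ahgt r a b = d%:Z by exists `|ahgt r a b|%N; lia.
have K N : exists j : nat, hgt L - x * d%:R + N%:R * d%:R = hgt L - j%:R :> C.
  have wN := wvec_iter R (- r) b a N vw.
  have nN : iter N (opF (- r) b a) v <> 0 by move=> e; apply: H; exists N.
  have [w [wn ww]] := B _ (ex_intro _ _ (conj nN wN)).
  have [j ej] := hw_height_wt R hH irr (@vs false) vw vn ww wn.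
  exists j; rewrite -ej aff_rootN -/be scalerN -scaleNr wformC wformDr wformZr bb wformC -/x.
  have E c (mu : hw) : hgt (mu + c *: be) = hgt mu + c * d%:R :> C.
    by rewrite addrC height_wt_lin height_wt_aff_root // ed addrC pmulrn.
  by rewrite -scaleNr !E; ring.
(* With [N = 0] this gives [x * d = j0]; with [N = j0 + 1] it then gives [j1 + (j0 + 1) * d = j0],
   which is absurd because [d] is positive. *)
have [j0 e0] := K 0%N; have [j1 e1] := K j0.+1.
have : (j1 + j0.+1 * d)%N%:R = j0%:R :> C.
  apply: (@addrI _ (hgt L - x * d%:R - j1%:R - j0%:R)).
  move: e0 e1; rewrite mul0r addr0 natrD natrM => e0 e1.
  have -> : x * d%:R = j0%:R by rewrite -[LHS](subKr (hgt L)) e0; ring.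
  move: e1; have -> : x * d%:R = j0%:R by rewrite -[LHS](subKr (hgt L)) e0; ring.
  move=> e1; have -> : j0.+1%:R * d%:R = - j1%:R + j0%:R :> C.
    by rewrite -[LHS](addKr (hgt L - j0%:R)) e1; ring.
  ring.
by move/eqP; rewrite eqr_nat => /eqP; nia.
Qed.

(** Accounts for the decrease by one of the coroot value when an odd reflection shifts the highest
    weight. *)
Lemma coroot_odd_shift (a b c : I) : par a -> ~~ par b -> ~~ par c -> idx_rank c != idx_rank b ->
  coroot (aff_root C (- 0) b a) 0 c b = -1.
Proof.
move=> pa pb pc cb.
have N (x : I) : ~~ par x -> idx_rank a != idx_rank x.
  by move=> px; apply/eqP => /(idx_rank_eq nm n1) [e|e]; move: px; rewrite e ?par_dual pa.
rewrite eq_sym in cb; have [f1 f2] := idx_rank_eqF (N c pc); have [f3 f4] := idx_rank_eqF cb.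
have [f5 f6] := idx_rank_eqF (N b pb).
rewrite /coroot !idx_coord_aff_root aff_root_lev (negPf pc) (negPf pb) /= f1 f2 f3 f4 f5 f6 eqxx eq_sym dual_neq.
by rewrite expr0 !(mulr0n, mulr1n); ring.
Qed.

Definition isNatC (x : C) := exists p : nat, x = p%:R.

Lemma even_simple s r (a b : I) : ~~ par a -> ~~ par b -> idx_rank a != idx_rank b ->
  aff_height (std_height s) h0 r a b = 2 -> isNatC (coroot L r a b) -> exists2 x, x <> 0 & loc_nil (opF (- r) b a) x.
Proof.
move=> pa pb /idx_rank_neq [ab bda] d2 [p ep]; exists v => //; exists p.+1.
exact: (even_vanish R irr (std_height_is_height nm n1 s) ab bda d2 pa pb vw (@vs s) vn).
Qed.

(** The vectors [b], [a], [c] have the adjacent values [u], [u + 2], [u + 4]. The odd reflection in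
    the root of [(a, b)] exchanges the first two values, after which the even root of [(c, b)] has
    height 2. The two hypotheses on coroots are the two possible effects of that reflection on the
    highest weight. *)
Lemma odd_simple s (a b c : I) (u := std_height s b) : par a -> ~~ par b -> ~~ par c -> idx_rank c != idx_rank b ->
  0 < u -> u + 4 < max_height m n -> std_height s a = u + 2 -> std_height s c = u + 4 ->
  (coroot L 0 a b = 0 -> isNatC (coroot L 0 c b)) ->
  (coroot L 0 a b <> 0 -> isNatC (coroot L 0 c b - 1)) ->
  exists2 x, x <> 0 & loc_nil (opF 0 b c) x.
Proof.
move=> pa pb pc cb up um ea ec H0 H1.
have [ncb bdc] := idx_rank_neq cb.
have nab : a != b by apply: contraTneq pa => ->.
have bda : b != dual a by apply: contraNneq pb => ->; rewrite par_dual.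
have d2 : aff_height (std_height s) h0 0 a b = 2 by rewrite /aff_height ea -/u; lia.
have pab : par a (+) par b by rewrite pa (negPf pb).
have uo : exists k, u = 2 * k + 1 := std_height_odd s b.
have um2 : u + 2 < max_height m n by lia.
have hH := std_height_is_height nm n1 s.
have hH' := refl_height_is_height nm n1 s up uo um2.
have Href := refl_height_pos nm n1 up uo um2 ea (erefl : std_height s b = u).
have d2' : aff_height (refl_height s u) h0 0 c b = 2.
  rewrite /aff_height /refl_height ec -/u mul0r addr0.
  have -> : swap_height u u = u + 2 by rewrite /swap_height eqxx.
  have t1 : (u + 4 == u) = false by lia.
  have t2 : (u + 4 == u + 2) = false by lia.
  have t3 : (u + 4 == - u) = false by lia.
  have t4 : (u + 4 == - (u + 2)) = false by lia.
  by rewrite /swap_height t1 t2 t3 t4; ring.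
have [e0|ne] := eqVneq (coroot L 0 a b) 0.
  have fv := odd_vanish R irr hH nab bda d2 vw (@vs s) vn e0.
  have sv := singular_refl R erefl Href (@vs s) fv.
  have [p ep] := H0 e0; exists v => //; exists p.+1.
  have := even_vanish R irr hH' ncb bdc d2' pc pb vw sv vn ep.
  by rewrite oppr0.
have su := singular_refl_f R hH nab bda d2 erefl pab Href (@vs s).
have wu := wvec_rootop R (- 0) b a vw.
have un : opF (- 0) b a v <> 0.
  move=> e; have := odd_ef R nab bda d2 vw (@vs s).
  rewrite e (rootop0 R) => /esym/eqP; rewrite scaler_eq0 (negPf ne) /= => /eqP; exact: vn.
have [p ep] := H1 (elimN eqP ne); exists (opF (- 0) b a v) => //; exists p.+1.
have := even_vanish R irr hH' ncb bdc d2' pc pb wu su un; rewrite oppr0; apply.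
by rewrite addrC -[aff_root _ _ _ _]scale1r coroot_lin mul1r coroot_odd_shift // -ep [RHS]addrC.
Qed.
End Integrability.

(** * Dominance conditions and their equivalence with integrability *)

Section Conditions.
Variables (C : numClosedFieldType) (m n : nat).
Hypotheses (nm : (n + 2 < m)%N) (n1 : (1 <= n)%N).
Local Notation I := 'I_(Nd m n).
Local Notation hw := (hw C m n).
Local Notation rtmx := (@rootmx C m n).
Local Notation h0 := (delta_height m n).
Variables (primed : bool) (L : hw).
Hypothesis ortho : orthoT primed L.
Local Notation po := (@eps_idx m n).
Local Notation ahgt := (aff_height (std_height false) h0).

(* k_1 of the theorem: eps_1 occurs with coefficient [k_1], resp. [- k_1]. *)
Definition kappa : C := if primed then - wc L 0 else wc L 0.

(* The coordinate of eps_i is [wc L i.-1]. *)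
Definition dominance :=
  [/\ forall i, (1 <= i)%N -> (i.+1 < m)%N -> isNatC (wc L i.+1 - wc L i),
      isNatC (wc L 1 - kappa), isNatC (wc L 1 + kappa),
      kappa <> 0 -> isNatC (wc L 1 + kappa - 1) & isNatC (level L - wc L m.-1 - wc L m.-2)].

Lemma idx_coord_po i (h : (i < m)%N) : idx_coord L (po h) = wc L i.
Proof. by rewrite /idx_coord /po idxE. Qed.

Lemma std_height_po s i (h : (i < m)%N) :
  std_height s (po h) = if s && (i == 0%N) then -1 else 2 * (eps_rank n i)%:Z + 1.
Proof.
rewrite /std_height eps_idx_rk /idx_pos /po idxE mul1r; congr (if _ && _ then _ else _).
by rewrite -(eps_rank_eq n i 0) [eps_rank n 0]/eps_rank n1.
Qed.

Lemma std_height_fp s (i : 'I_n) : std_height s (fp m i) = 4 * i%:Z + 3.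
Proof. by rewrite /std_height /idx_pos /idx_rank !idxE andbF mul1r; lia. Qed.

Lemma coroot_pp i j (hi : (i < m)%N) (hj : (j < m)%N) : coroot L 0 (po hi) (po hj) = wc L i - wc L j.
Proof. by rewrite /coroot !eps_idx_par !idx_coord_po /= expr0 !mul0r addr0 mul1r. Qed.
Lemma coroot_pq i j (hi : (i < m)%N) (hj : (j < m)%N) : coroot L 0 (po hi) (dual (po hj)) = wc L i + wc L j.
Proof. by rewrite /coroot par_dual !eps_idx_par idx_coord_dual !idx_coord_po /= expr0 !mul0r addr0 mul1r opprK. Qed.
Lemma coroot_aff i j (hi : (i < m)%N) (hj : (j < m)%N) :
  coroot L 1 (dual (po hi)) (po hj) = level L - wc L i - wc L j.
Proof. by rewrite /coroot par_dual !eps_idx_par idx_coord_dual !idx_coord_po /= expr0 !mul1r /level; ring. Qed.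

Lemma ortho_mu i (h : (i < n)%N) : wc L (m + i) = if primed && (i == 0%N) then wc L i else - wc L i.
Proof.
have hm : (i < m)%N by lia.
have := ortho (i := i.+1); rewrite /betaP eqSS => /(_ _) e.
have {}e : wform L (if primed && (i == 0%N) then dltw C m n 1 + epsw C m n 1
   else dltw C m n i.+1 - epsw C m n i.+1) = 0 by apply: e; lia.
have w1 : idx_wt C (fp m (Ordinal h) : I) = dltw C m n i.+1 by rewrite /idx_wt idxE.
have w2 : idx_wt C (po hm) = epsw C m n i.+1 by rewrite /idx_wt /eps_idx idxE.
have c1 : idx_coord L (fp m (Ordinal h) : I) = wc L (m + i) by rewrite /idx_coord idxE.
case: ifP e => [/andP[_ /eqP i0]|_].
  subst i; rewrite -w1 -w2 wformDr !wform_idx_wt parE eps_idx_par expr1 expr0 idx_coord_po c1.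
  by rewrite mulN1r mul1r addrC => /eqP; rewrite subr_eq0 => /eqP.
rewrite -w1 -w2 wformDr wformNr !wform_idx_wt parE eps_idx_par expr1 expr0 idx_coord_po c1.
by rewrite mulN1r mul1r => /eqP; rewrite -opprD oppr_eq0 addr_eq0 => /eqP.
Qed.

Lemma coroot_odd_p i (h : (i < n)%N) (hm : (i < m)%N) :
  coroot L 0 (fp m (Ordinal h)) (po hm) = wc L (m + i) + wc L i.
Proof.
have c1 : idx_coord L (fp m (Ordinal h) : I) = wc L (m + i) by rewrite /idx_coord idxE.
by rewrite /coroot parE eps_idx_par c1 idx_coord_po /= expr1 !mul0r addr0; ring.
Qed.
Lemma coroot_odd_q i (h : (i < n)%N) (hm : (i < m)%N) :
  coroot L 0 (fp m (Ordinal h)) (dual (po hm)) = wc L (m + i) - wc L i.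
Proof.
have c1 : idx_coord L (fp m (Ordinal h) : I) = wc L (m + i) by rewrite /idx_coord idxE.
by rewrite /coroot parE par_dual eps_idx_par c1 idx_coord_dual idx_coord_po /= expr1 !mul0r addr0; ring.
Qed.

Lemma so0root_idx (g : hw) : so0root g -> exists a b : I,
  [/\ ~~ par a, ~~ par b, idx_rank a != idx_rank b & g = idx_wt C a - idx_wt C b].
Proof.
move=> [i [j [hi [hj [ij e]]]]].
have li : (i.-1 < m)%N by lia.
have lj : (j.-1 < m)%N by lia.
have ri : eps_rank n i.-1 != eps_rank n j.-1 by rewrite eps_rank_eq; apply/eqP; lia.
have wi : idx_wt C (po li) = epsw C m n i by rewrite /idx_wt /eps_idx idxE /= prednK //; case/andP: hi.
have wj : idx_wt C (po lj) = epsw C m n j by rewrite /idx_wt /eps_idx idxE /= prednK //; case/andP: hj.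
case: e => [->|[->|->]].
- by exists (po li), (po lj); rewrite !eps_idx_par !eps_idx_rk wi wj.
- by exists (po li), (dual (po lj)); rewrite par_dual !eps_idx_par idx_rank_dual !eps_idx_rk idx_wt_dual wi wj opprK.
- by exists (dual (po li)), (po lj); rewrite par_dual !eps_idx_par idx_rank_dual !eps_idx_rk idx_wt_dual wi wj opprD.
Qed.

Lemma rootmx_so0 (a b : I) : ~~ par a -> ~~ par b -> idx_rank a != idx_rank b -> so0root (idx_wt C a - idx_wt C b).
Proof.
move=> /(@par_eps_idx m n) [i [hi ea]] /(@par_eps_idx m n) [j [hj eb]] ab.
have ne : i.+1 <> j.+1.
  move=> [e]; subst j; move/eqP: ab; apply.
  by case: ea => ->; case: eb => ->; rewrite ?idx_rank_dual !eps_idx_rk.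
have wp x (hx : (x < m)%N) : idx_wt C (po hx) = epsw C m n x.+1 by rewrite /idx_wt /eps_idx idxE.
case: ea => ->; case: eb => ->; rewrite ?idx_wt_dual !wp.
- by exists i.+1, j.+1; do 3 split=> //; left.
- by exists i.+1, j.+1; do 3 split=> //; right; left; rewrite opprK.
- by exists i.+1, j.+1; do 3 split=> //; right; right; rewrite opprD.
- exists j.+1, i.+1; do 3 split=> //; first by move=> e; apply: ne.
  by left; rewrite opprK addrC.
Qed.

Section Representations.
Variables (V : lmodType C) (rho : hrep m n V).
Hypothesis R : is_rep rho.
Local Notation opF := (rootop rho).

Lemma locnil_rootop r (a b : I) : idx_rank a != idx_rank b -> (forall w, loc_nil (opF r b a) w) ->
  locnil rho r (- (idx_wt C a - idx_wt C b)).
Proof.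
rewrite opprB eq_sym => /idx_rank_neq [ab bda] H X rX w.
rewrite (rootspace_rootmx nm n1 ab bda rX); have [N eN] := H w; exists N.
set c := X b a.
suff -> : iter N (rpi rho r (c *: rtmx b a)) w = c ^+ N *: iter N (opF r b a) w.
  by rewrite eN scaler0.
elim: N {eN} => [|N IH]; first by rewrite expr0 scale1r.
rewrite iterS IH (rep_XZ R) ?(rep_Z R) ?scalerA ?exprS //; exact: rootmx_osp.
Qed.
End Representations.

Lemma dominance_integrable : dominance -> L_integrable L.
Proof.
move=> [D1 D2 D3 D4 D5] V rho [R [irr [v Hv]]].
have vn : v <> 0 by case: Hv.
have k0 : kappa = 0 \/ kappa <> 0 by case: (eqVneq kappa 0) => [->|/eqP]; [left|right].
have B1 i (h : (i < m)%N) (h' : (i.+1 < m)%N) : aff_refl_stable rho 0 (po h') (po h).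
  have ph := eps_idx_par n h; have ph' := eps_idx_par n h'.
  have rr : idx_rank (po h') != idx_rank (po h) by rewrite !eps_idx_rk eps_rank_eq; lia.
  have pos : 0 < ahgt 0 (po h') (po h).
    by rewrite /aff_height !std_height_po /= mul0r addr0 /eps_rank; case: ifP; case: ifP; lia.
  suff [x xn lx] : exists2 x, x <> 0 & loc_nil (rootop rho (-0) (po h) (po h')) x.
    by apply: (simple_refl_stable nm n1 R irr Hv) xn lx; rewrite ?ph ?ph'.
  have Dd : (0 < i)%N -> isNatC (wc L i.+1 - wc L i) by move=> i0; apply: D1.
  have [ni|ni] := leqP n i.
    apply: (even_simple nm n1 R irr Hv (s := false)); rewrite ?ph ?ph' //.
      rewrite /aff_height !std_height_po /= mul0r addr0 /eps_rank (ltnNge i) ni (ltnNge i.+1) (leqW ni) /=; lia.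
    by rewrite coroot_pp; apply: Dd; lia.
  rewrite oppr0; pose a : I := fp m (Ordinal ni).
  have hb : std_height false (po h) = 4 * i%:Z + 1 by rewrite std_height_po /= /eps_rank ni; lia.
  apply: (odd_simple nm n1 R irr Hv (s := false) (a := a)); rewrite ?ph ?ph' ?hb /a ?parE //.
  - lia.
  - by rewrite /max_height; lia.
  - by rewrite std_height_fp /=; lia.
  - by rewrite std_height_po /= /eps_rank; case: ifP; lia.
  (* The odd root here is delta_(i+1) - eps_(i+1), which lies outside the orthogonal set only for
     [i = 0] in the primed case. There its orthogonality means that the coordinate of eps_1 is zero,
     so the sign in [kappa] does not matter. *)
  - rewrite coroot_odd_p coroot_pp ortho_mu //; case: (posnP i) => [i0|ip]; last by move=> _; apply: Dd.
    subst i; rewrite ?eqxx ?andbT; move: D2; rewrite /kappa; case: primed => // D2 e.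
    have z : wc L 0 = 0 by move/eqP: e; rewrite -mulr2n mulrn_eq0 => /eqP.
    by move: D2; rewrite z !oppr0.
  - rewrite coroot_odd_p coroot_pp ortho_mu //; case: (posnP i) => [i0|ip]; last first.
      by rewrite ?(gtn_eqF ip) andbF addNr.
    subst i; rewrite ?eqxx ?andbT; move: D4; rewrite /kappa; case: primed; last by rewrite addNr.
    move=> D4 e; apply: D4 => z; apply: e; move/eqP: z; rewrite oppr_eq0 => /eqP ->; exact: addr0.
have B2 (h : (0 < m)%N) (h' : (1 < m)%N) : aff_refl_stable rho 0 (po h') (dual (po h)).
  have ph : par (dual (po h)) = false by rewrite par_dual eps_idx_par.
  have ph' := eps_idx_par n h'.
  have rr : idx_rank (po h') != idx_rank (dual (po h)) by rewrite idx_rank_dual !eps_idx_rk eps_rank_eq.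
  have pos : 0 < ahgt 0 (po h') (dual (po h)).
    by rewrite /aff_height std_height_dual !std_height_po /= mul0r addr0 /eps_rank; case: ifP; case: ifP; lia.
  suff [x xn lx] : exists2 x, x <> 0 & loc_nil (rootop rho (-0) (dual (po h)) (po h')) x.
    by apply: (simple_refl_stable nm n1 R irr Hv) xn lx; rewrite ?ph ?ph'.
  (* For [std_height true] the weights -eps_1, delta_1 and eps_2 have heights 1, 3 and 5. So
     [odd_simple] applies to eps_2 + eps_1, with the odd root delta_1 + eps_1. *)
  rewrite oppr0; pose a : I := fp m (Ordinal n1).
  have hb : std_height true (dual (po h)) = 1 by rewrite std_height_dual std_height_po /= opprK.
  apply: (odd_simple nm n1 R irr Hv (s := true) (a := a)); rewrite ?ph ?ph' ?hb /a ?parE //.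
  - by rewrite /max_height; lia.
  - by rewrite std_height_fp /=; lia.
  - by rewrite std_height_po /= /eps_rank; case: ifP; lia.
  - by rewrite coroot_pq => _; move: D2 D3; rewrite /kappa; case: primed; rewrite ?opprK.
  - rewrite coroot_odd_q coroot_pq ortho_mu // ?eqxx andbT; move: D4; rewrite /kappa; case: primed.
      by rewrite subrr.
    by move=> D4 e; apply: D4 => z; apply: e; rewrite z oppr0 addr0.
have B3 (h : (m.-1 < m)%N) (h' : (m.-2 < m)%N) : aff_refl_stable rho 1 (dual (po h)) (po h').
  have ph : par (dual (po h)) = false by rewrite par_dual eps_idx_par.
  have ph' := eps_idx_par n h'.
  have rr : idx_rank (dual (po h)) != idx_rank (po h') by rewrite idx_rank_dual !eps_idx_rk eps_rank_eq; lia.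
  (* The root delta - eps_m - eps_(m-1) is simple already, so no odd reflection intervenes. *)
  have d2 : ahgt 1 (dual (po h)) (po h') = 2.
    rewrite /aff_height std_height_dual !std_height_po /= mul1r /delta_height /max_height /eps_rank.
    have -> : (m.-1 < n)%N = false by lia.
    have -> : (m.-2 < n)%N = false by lia.
    lia.
  suff [x xn lx] : exists2 x, x <> 0 & loc_nil (rootop rho (-1) (po h') (dual (po h))) x.
    by apply: (simple_refl_stable nm n1 R irr Hv) xn lx; rewrite ?ph ?ph' ?d2.
  apply: (even_simple nm n1 R irr Hv (s := false)); rewrite ?ph ?ph' //.
  by rewrite coroot_aff.
have BB := aff_refl_stable_all nm n1 B1 B2 B3.
have A (r : nat) (a b : I) : ~~ par a -> ~~ par b -> idx_rank a != idx_rank b -> 0 < ahgt r%:Z a b ->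
    locnil rho (- r%:Z) (- (idx_wt C a - idx_wt C b)).
  move=> pa pb ab pos; apply: (locnil_rootop R) => //.
  have ba : idx_rank b != idx_rank a by rewrite eq_sym.
  apply: (loc_nil_rootop R irr pb pa ba vn).
  by apply: (real_nil nm n1 R irr Hv) => //; apply: BB.
split.
  move=> g /so0root_idx [a [b [pa pb ab eg]]] [[_ [gn _]] gQ].
  have := A 0%N a b pa pb ab; rewrite oppr0 -eg; apply.
  have [p p0] := inQplus_height nm n1 gQ gn; rewrite eg height_wtD height_wtN !height_wt_idx_wt // -rmorphB /=
    pmulrn => /intr_inj e.
  by rewrite /aff_height mul0r addr0 e ltz_nat.
move=> al r /so0root_idx [a [b [pa pb ab ->]]] r0; apply: A => //.
have /andP[b1 b2] := h_bound (std_height_is_height nm n1 false) (rank_root_pair ab).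
by rewrite /aff_height; nia.
Qed.

(** Most conditions are read off the highest weight vector. For nonzero [kappa], the sharper bound
    comes from its image under an odd reflection, again a vector killed by the raising operator in
    question but with shifted weight. *)
Lemma integrable_dominance : L_integrable L -> dominance.
Proof.
move=> /(_ _ _ (irr_rep_L L nm n1)) [I1 I2].
have [R [irr [v Hv]]] := irr_rep_L L nm n1; set rho := irr_rep L in R irr v Hv I1 I2.
have vn : v <> 0 by case: Hv.
have vw := hw_wvec Hv.
have vs s := hw_singular nm n1 (s := s) Hv.
have N0 (a b : I) u mu : ~~ par a -> ~~ par b -> idx_rank a != idx_rank b -> std_height false b < std_height false a ->
    u <> 0 -> weight_vec rho mu u -> rootop rho 0 a b u = 0 -> isNatC (coroot mu 0 a b).
  move=> pa pb ab lt un wu eu; have [nab bda] := idx_rank_neq ab.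
  have so := rootmx_so0 pa pb ab.
  have pr := pos_root C nm n1 (rank_root_pair ab) lt.
  have := I1 _ so pr; rewrite opprB => /(_ _ (rootmx_root C b a) u) [N eN].
  by apply: (coroot_nat R nab bda pa pb wu un eu (N := N)); rewrite oppr0.
have h0' : (0 < m)%N by lia.
have h1' : (1 < m)%N by lia.
have l0 : eps_rank n 0 = 0%N by rewrite /eps_rank n1.
have l1 : (0 < eps_rank n 1)%N by rewrite /eps_rank; case: ifP; lia.
have up (a b : I) : root_pair a b -> std_height false b < std_height false a -> rootop rho 0 a b v = 0.
  by move=> nz lt; apply: (vs false) => //; rewrite /aff_height mul0r addr0; lia.
have S i (h : (i < m)%N) (h' : (i.+1 < m)%N) : isNatC (wc L i.+1 - wc L i).
  rewrite -(coroot_pp h' h).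
  have rr : idx_rank (po h') != idx_rank (po h) by rewrite !eps_idx_rk eps_rank_eq; lia.
  have lt : std_height false (po h) < std_height false (po h').
    by rewrite !std_height_po /= /eps_rank; case: ifP; case: ifP; lia.
  by apply: (N0 _ _ v) => //; rewrite ?eps_idx_par //; apply: up => //; exact: rank_root_pair.
have T : isNatC (wc L 1 + wc L 0).
  rewrite -(coroot_pq h1' h0').
  have rr : idx_rank (po h1') != idx_rank (dual (po h0')) by rewrite idx_rank_dual !eps_idx_rk eps_rank_eq.
  have lt : std_height false (dual (po h0')) < std_height false (po h1').
    by rewrite std_height_dual !std_height_po /=; lia.
  by apply: (N0 _ _ v) => //; rewrite ?par_dual ?eps_idx_par //; apply: up => //; exact: rank_root_pair.
split.
- move=> i i1 im; have h : (i < m)%N by lia.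
  exact: (S i h im).
- by rewrite /kappa; case: primed; rewrite ?opprK //; apply: S.
- by rewrite /kappa; case: primed => //; apply: S.
- move=> kn.
  (* The pair [(a, b)] gives the one among delta_1 - eps_1 and delta_1 + eps_1 that is not assumed
     orthogonal to [L]; [s] selects the heights for which this root has height 2. *)
  pose s := ~~ primed; pose b : I := if primed then po h0' else dual (po h0').
  pose a : I := fp m (Ordinal n1).
  have cb : idx_coord L b = - kappa.
    by rewrite /b /kappa; case: primed; rewrite ?idx_coord_dual idx_coord_po ?opprK.
  have pb : ~~ par b by rewrite /b; case: primed; rewrite ?par_dual eps_idx_par.
  have pa : par a by rewrite /a parE.
  have rb : idx_rank b = 0%N by rewrite /b; case: primed; rewrite ?idx_rank_dual eps_idx_rk.
  have hb : std_height s b = 1 by rewrite /s /b; case: primed; rewrite ?std_height_dual std_height_po /= ?l0.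
  have ha : std_height s a = 3 by rewrite std_height_fp.
  have ca : idx_coord L a = - kappa.
    rewrite /a /idx_coord idxE ortho_mu // /kappa ?eqxx andbT.
    by case: primed; rewrite ?opprK.
  have ra : idx_rank a = 1%N by rewrite /a /idx_rank idxE.
  have [nab bda] : a != b /\ b != dual a by apply: idx_rank_neq; rewrite ra rb.
  have d2 : aff_height (std_height s) h0 0 a b = 2 by rewrite /aff_height ha hb mul0r addr0.
  have e0 : coroot L 0 a b = - (2 * kappa).
    by rewrite /coroot ca cb pa (negPf pb) /= expr1 !mul0r addr0; ring.
  set u := rootop rho (- 0) b a v.
  have eu : rootop rho 0 a b u = coroot L 0 a b *: v by apply: (odd_ef R nab bda d2 vw (vs s)).
  have un : u <> 0.
    move=> z; move: eu; rewrite z (rootop0 R) e0 => /esym/eqP.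
    rewrite scaler_eq0 oppr_eq0 mulf_eq0 pnatr_eq0 /= => /orP[/eqP //|/eqP //].
  have wu := wvec_rootop R (- 0) b a vw.
  have pc : ~~ par (po h1') by rewrite eps_idx_par.
  have rc : idx_rank (po h1') != idx_rank b by rewrite eps_idx_rk rb; lia.
  (* The even root is positive and differs from the simple odd root, so [simple_kill] applies to the
     single lowering step that produced [u]. *)
  have cu : rootop rho 0 (po h1') b u = 0.
    apply: (simple_kill R (std_height_is_height nm n1 s) nab bda d2 1%N (u := v)) => //.
    - exact: rank_root_pair.
    - by rewrite /aff_height hb std_height_po andbF mul0r addr0; lia.
    - by move=> [_ [[e _]|[e _]]]; [move: pc; rewrite e pa | move: rc; rewrite e idx_rank_dual eqxx].
  have lt : std_height false b < std_height false (po h1').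
    rewrite /b; case: primed; rewrite ?std_height_dual !std_height_po /=; lia.
  have := N0 _ _ _ _ pc pb rc lt un wu cu.
  have -> : coroot (L + aff_root C (- 0) b a) 0 (po h1') b = wc L 1 + kappa - 1 => //.
  rewrite addrC -[aff_root _ _ _ _]scale1r coroot_lin mul1r.
  by rewrite coroot_odd_shift // /coroot cb idx_coord_po (negPf pb) (negPf pc) /= expr0 !mul0r addr0 mul1r opprK; ring.
- have h1 : (m.-1 < m)%N by lia.
  have h2 : (m.-2 < m)%N by lia.
  rewrite -(coroot_aff h1 h2).
  set a := dual (po h1); set b := po h2.
  have pa : ~~ par a by rewrite par_dual eps_idx_par.
  have pb : ~~ par b by rewrite eps_idx_par.
  have ab : idx_rank a != idx_rank b by rewrite idx_rank_dual !eps_idx_rk eps_rank_eq; lia.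
  have [nab bda] := idx_rank_neq ab.
  have /andP[b1 b2] := h_bound (std_height_is_height nm n1 false) (rank_root_pair ab).
  have pos : 0 < ahgt 1 a b by rewrite /aff_height; lia.
  have eu : rootop rho 1 a b v = 0 by apply: (vs false) => //; exact: rank_root_pair.
  have := I2 _ 1%N (rootmx_so0 pa pb ab) isT; rewrite opprB => /(_ _ (rootmx_root C b a) v) [N eN].
  exact: (coroot_nat R nab bda pa pb vw vn eu eN).
Qed.
End Conditions.

(** * Coordinates of the weights in the theorem *)

Section Form.
Variables (C : numClosedFieldType) (m n : nat).
Hypotheses (nm : (n + 2 < m)%N) (n1 : (1 <= n)%N).
Local Notation hw := (hw C m n).

Lemma wc_sum (a b : nat) (f : nat -> hw) x :
  wc (\sum_(a <= i < b) f i) x = \sum_(a <= i < b) wc (f i) x.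
Proof.
elim/big_ind2: _ => [|u x1 w x2 <- <-|//]; first exact: wc0.
exact: wcD.
Qed.

Lemma sum_delta (a b y : nat) (f : nat -> C) :
  \sum_(a <= i < b) f i * (y == i)%:R = if (a <= y < b)%N then f y else 0.
Proof.
rewrite -mem_index_iota -(big_mkcond (fun=> true)) /=.
case: ifP => [yi|yi].
  rewrite (bigD1_seq y) ?iota_uniq //= eqxx mulr1 big1 ?addr0 // => i.
  by rewrite eq_sym => /negPf ->; rewrite mulr0.
rewrite big_seq big1 // => i ii; case: eqP => [e|_]; last by rewrite mulr0.
by rewrite e ii in yi.
Qed.

Definition std_form (primed : bool) (k c : C) (kk : nat -> C) : hw :=
  k *: L0w C m n - \sum_(1 <= i < n.+1) kk i *: betaP C m n primed i
        + \sum_(n.+1 <= i < m.+1) kk i *: epsw C m n i + c *: deltaw C m n.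

(** The sign with which k_1 multiplies eps_1 once the sum over the [betaP] is expanded; the index is
    that of the coordinate, so eps_1 has index 0. *)
Definition ksign (primed : bool) (i : nat) : C := if primed && (i == 0%N) then -1 else 1.

Lemma wc_beta primed i x : (1 <= i)%N -> (i <= n)%N -> (x < (m + n).+2)%N ->
  wc (betaP C m n primed i) x = (x.+1 == m + i)%N%:R - ksign primed x * (x.+1 == i)%:R.
Proof.
move=> i1 i_n lx; rewrite /betaP -[i](prednK i1) addnS !eqSS /ksign.
set j := i.-1; have jn : (j < n)%N by lia.
have jm : (j < m)%N by lia.
case: ifP => [/andP[-> /eqP j0]|pj].
  rewrite wcD wc_dlt ?wc_eps //; try lia; rewrite j0 addn0.
  case: (x =P 0%N) => [->|_]; rewrite ?mulr0n ?mulr1n /=; ring.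
rewrite wcB wc_dlt // wc_eps //.
have -> : (if primed && (x == 0%N) then -1 else 1) * (x == j)%:R = (x == j)%:R :> C.
  by case: (x =P j) => [->|_]; rewrite ?pj ?mul1r ?mulr0n ?mulr0.
by [].
Qed.

Lemma wc_std_form primed k c kk x : (x < (m + n).+2)%N -> wc (std_form primed k c kk) x =
  if (x < m)%N then ksign primed x * kk x.+1
  else if (x < m + n)%N then - kk (x - m).+1 else if (x == m + n)%N then k else c.
Proof.
move=> lx; rewrite /std_form wcD wcD wcB !wcZ wc_L0 // wc_del // !wc_sum.
have -> : \sum_(1 <= i < n.+1) wc (kk i *: betaP C m n primed i) x =
   \sum_(1 <= i < n.+1) (if (m <= x)%N then kk i else 0) * ((x - m).+1 == i)%:R
   - ksign primed x * \sum_(1 <= i < n.+1) kk i * (x.+1 == i)%:R.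
  rewrite mulr_sumr -sumrB; apply: eq_big_nat => i /andP[i1 i_n].
  rewrite wcZ wc_beta //.
  case: leqP => mx.
    have -> : (x.+1 == m + i)%N = ((x - m).+1 == i) by apply/idP/idP => /eqP e; apply/eqP; lia.
    ring.
  have -> : (x.+1 == m + i)%N = false by apply/eqP; lia.
  rewrite mulr0n; ring.
have -> : \sum_(n.+1 <= i < m.+1) wc (kk i *: epsw C m n i) x =
   \sum_(n.+1 <= i < m.+1) kk i * (x.+1 == i)%:R.
  apply: eq_big_nat => i /andP[i1 i_n]; rewrite wcZ -[i](prednK (_ : (0 < i)%N)) ?wc_eps ?eqSS //; lia.
rewrite !sum_delta.
have sg1 : (n <= x)%N -> ksign primed x = 1.
  by rewrite /ksign; case: (x =P 0%N) => [->|_]; rewrite ?andbF //; lia.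
have [xm|mx] := ltnP x m.
  have -> : (x == m + n)%N = false by apply/eqP; lia.
  have -> : (x == (m + n).+1)%N = false by apply/eqP; lia.
  rewrite if_same !ltnS xm !(ltn0Sn, andbT) mulr0n.
  have [xn|xn] := ltnP x n; rewrite ?andbF ?andbT /=; first by ring.
  by rewrite sg1 //; ring.
have -> : (x.+1 < n.+1)%N = false by lia.
have -> : (x.+1 < m.+1)%N = false by lia.
rewrite !andbF mulr0 subr0 addr0 /=.
have [xn|xn] := ltnP x (m + n).
  have -> : ((x - m).+1 < n.+1)%N by lia.
  have -> : (x == m + n)%N = false by apply/eqP; lia.
  have -> : (x == (m + n).+1)%N = false by apply/eqP; lia.
  by rewrite mulr0n; ring.
have -> : ((x - m).+1 < n.+1)%N = false by lia.
have [->|ne] := eqVneq x (m + n)%N.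
  by rewrite (ltn_eqF (ltnSn _)) mulr0n mulr1n; ring.
have -> : (x == (m + n).+1)%N by apply/eqP; move: ne => /eqP; lia.
by rewrite mulr0n mulr1n; ring.
Qed.
End Form.

Lemma isNatC_int (C : numClosedFieldType) (x : C) : isIntC x -> 0 <= x -> isNatC x.
Proof.
move=> [z ->]; rewrite ler0z => z0; exists `|z|%N.
by rewrite pmulrn gez0_abs.
Qed.
Lemma isIntD (C : numClosedFieldType) (x y : C) : isIntC x -> isIntC y -> isIntC (x + y).
Proof. by move=> [a ->] [b ->]; exists (a + b); rewrite rmorphD. Qed.
Lemma isIntN (C : numClosedFieldType) (x : C) : isIntC x -> isIntC (- x).
Proof. by move=> [a ->]; exists (- a); rewrite rmorphN. Qed.
Lemma isNatC_isInt (C : numClosedFieldType) (x : C) : isNatC x -> isIntC x.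
Proof. by move=> [p ->]; exists p%:Z; rewrite pmulrn. Qed.
Lemma isNatC_ge0 (C : numClosedFieldType) (x : C) : isNatC x -> 0 <= x.
Proof. by move=> [p ->]; apply: ler0n. Qed.

Lemma int_form_dominance (C : numClosedFieldType) (m n : nat) (primed : bool) (L : hw C m n) k :
  (n + 2 < m)%N -> (1 <= n)%N -> level L = k -> int_form primed k L -> dominance primed L.
Proof.
move=> nm n1 lev [c [kk [eL [ik [k0 [[z ez] [H1 [H2 [H3 [H4 H5]]]]]]]]]].
rewrite -/(std_form m n primed k c kk) in eL.
have W i : (1 <= i)%N -> (i < m)%N -> wc L i = kk i.+1.
  move=> i1 im; rewrite eL wc_std_form //; last by lia.
  by rewrite im /ksign (gtn_eqF i1) andbF mul1r.
have W0 : kappa primed L = kk 1%N.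
  rewrite /kappa eL wc_std_form // (_ : (0 < m)%N) /ksign ?eqxx ?andbT; last by lia.
  by case: primed {eL}; rewrite ?mul1r ?mulN1r ?opprK.
have two : (2 : C) != 0 by rewrite pnatr_eq0.
have z1 : kk 1%N + kk 1%N = z%:~R by rewrite ez; field.
(* The order on [C] is partial, and the bound on the norm splits into two inequalities only for a
   real number. *)
have r1 : kk 1%N \is Num.real by rewrite ez rpred_div // ?realz ?realn.
have /andP[a1 a2] : - kk 2%N <= kk 1%N <= kk 2%N by rewrite -real_ler_norml.
have i2 : isIntC (kk 2%N - kk 1%N) by apply: H1; lia.
have ip : isIntC (kk 2%N + kk 1%N).
  have -> : kk 2%N + kk 1%N = (kk 2%N - kk 1%N) + (kk 1%N + kk 1%N) by ring.
  by apply: isIntD => //; exists z.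
have p2 : isNatC (kk 2%N + kk 1%N) by apply: isNatC_int => //; rewrite -lerBlDr sub0r lerNl.
split.
- move=> i i1 im; rewrite !W //; last by lia.
  apply: isNatC_int; last by rewrite subr_ge0; apply: H2; lia.
  have -> : kk i.+2 - kk i.+1 = (kk i.+2 - kk 1%N) - (kk i.+1 - kk 1%N) by ring.
  by apply: isIntD; [|apply: isIntN]; apply: H1; lia.
- by rewrite W0 W //; [apply: isNatC_int => //; rewrite subr_ge0|lia].
- by rewrite W0 W //; lia.
- rewrite W0 W //; last by lia.
  (* The natural number k_2 + k_1 is positive: if it were 0, the last clause of [int_form] would
     make k_1 vanish. *)
  move=> ne; case: p2 => [[|p] ep]; last by exists p; rewrite ep -natr1 addrK.
  have e2 : kk 2%N = - kk 1%N by apply/eqP; rewrite -addr_eq0 ep.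
  by have [] := H5 e2.
- rewrite lev !W //; try lia.
  rewrite !prednK //; try lia.
  apply: isNatC_int; last by rewrite -addrA -opprD subr_ge0.
  rewrite -addrA -opprD; apply: isIntD => //; apply: isIntN.
  have -> : kk m + kk m.-1 = (kk m - kk 1%N) + (kk m.-1 - kk 1%N) + (kk 1%N + kk 1%N) by ring.
  by apply: isIntD; [apply: isIntD; apply: H1; lia | exists z].
Qed.

Lemma dominance_int_form (C : numClosedFieldType) (m n : nat) (primed : bool) (L : hw C m n) k :
  (n + 2 < m)%N -> (1 <= n)%N -> level L = k -> k != 0 -> orthoT primed L ->
  dominance primed L -> int_form primed k L.
Proof.
move=> nm n1 lev kn ortho [D1 D2 D3 D4 D5].
pose kk i := ksign C primed i.-1 * wc L i.-1.
have W i : (1 < i)%N -> kk i = wc L i.-1.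
  by move=> i1; rewrite /kk /ksign (_ : (i.-1 == 0%N) = false) ?andbF ?mul1r //; lia.
have W0 : kk 1%N = kappa primed L.
  by rewrite /kk /ksign /kappa eqxx andbT; case: primed {ortho D2 D3 D4 kk W}; rewrite ?mul1r ?mulN1r.
rewrite -W0 in D2 D3 D4; rewrite -[wc L 1](W 2%N) // in D2 D3 D4.
have D1' i : (2 <= i)%N -> (i < m)%N -> isNatC (kk i.+1 - kk i).
  move=> i2 im; rewrite !W //; last by lia.
  by rewrite -[i.+1.-1](prednK (_ : (0 < i)%N)); [apply: D1; lia|lia].
have two : (2 : C) != 0 by rewrite pnatr_eq0.
have I1 i : (2 <= i)%N -> (i <= m)%N -> isIntC (kk i - kk 1%N) /\ kk 2%N <= kk i.
  elim: i => // i IH; rewrite leq_eqVlt => /orP[/eqP <- _|i2 im].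
    by split; [apply: isNatC_isInt|].
  have [a b] := IH i2 (ltnW im).
  have N := D1' i i2 im; split.
    have -> : kk i.+1 - kk 1%N = (kk i.+1 - kk i) + (kk i - kk 1%N) by ring.
    by apply: isIntD => //; apply: isNatC_isInt.
  by apply: le_trans b _; rewrite -subr_ge0; apply: isNatC_ge0.
have [p2 e2] := D2; have [p3 e3] := D3.
(* Half the difference of the natural numbers k_2 + k_1 and k_2 - k_1; this is where half-integers
   enter. *)
have k1 : kk 1%N = (p3%:Z - p2%:Z)%:~R / 2.
  by rewrite rmorphB /= -!pmulrn -e2 -e3; field.
have r1 : kk 1%N \is Num.real by rewrite k1 rpred_div // ?realz ?realn.
have n2 : `|kk 1%N| <= kk 2%N.
  rewrite real_ler_norml //; apply/andP; split; rewrite -subr_ge0 ?opprK; last exact: isNatC_ge0.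
  by rewrite addrC; apply: isNatC_ge0.
have k2 : 0 <= kk 2%N by apply: le_trans n2; apply: normr_ge0.
have em : wc L m.-1 = kk m by rewrite W //; lia.
have em' : wc L m.-2 = kk m.-1 by rewrite W //; lia.
rewrite lev em em' in D5.
have km2 : (2 <= m.-1)%N by lia.
have [im lm] := I1 m (leq_trans km2 (leq_pred m)) (leqnn m).
have [im' lm'] := I1 m.-1 km2 (leq_pred m).
have kge : kk m + kk m.-1 <= k by rewrite -subr_ge0 opprD addrA; apply: isNatC_ge0.
exists (wc L (m + n).+1), kk; rewrite -/(std_form m n primed k (wc L (m + n).+1) kk).
split.
  apply: wc_ext => x lx; rewrite wc_std_form //.
  case: ltnP => xm.
    rewrite /kk /= mulrA (_ : ksign C primed x * ksign C primed x = 1) ?mul1r //.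
    by rewrite /ksign; case: ifP => _; ring.
  case: ltnP => xn.
    have h : (x - m < n)%N by lia.
    rewrite -{1}(subnKC xm) (ortho_mu nm n1 ortho h) /kk /ksign /=.
    by case: ifP => _; ring.
  case: eqP => [->|ne]; first exact: lev.
  by congr (wc L _); lia.
split.
  have -> : k = (k - kk m - kk m.-1) + ((kk m - kk 1%N) + (kk m.-1 - kk 1%N) + (kk 1%N + kk 1%N)) by ring.
  apply: isIntD; first exact: isNatC_isInt.
  apply: isIntD; first exact: isIntD.
  by exists (p3%:Z - p2%:Z); rewrite k1; field.
split.
  (* Dominance gives [0 <= k], and the inequality is strict because the level is nonzero. *)
  rewrite lt_def kn /=; apply: le_trans kge; apply: addr_ge0; exact: le_trans k2 _.
split; first by exists (p3%:Z - p2%:Z).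
split; first by move=> i /andP[i2 im0]; case: (I1 i i2 im0).
split; first by move=> i /andP[i2 im0]; rewrite -subr_ge0; apply: isNatC_ge0; apply: D1'.
split; first exact: n2.
split; first exact: kge.
(* For nonzero k_1, the equality k_2 = - k_1 would turn the shifted condition into the claim that -1
   is a natural number. *)
move=> e; have [z|/eqP nz] := eqVneq (kk 1%N) 0; first by rewrite e z oppr0.
have := D4 nz; rewrite e addNr sub0r => -[p ep].
have : (0 : C) <= -1 by rewrite ep ler0n.
by rewrite oppr_ge0 ler10.
Qed.

Theorem theorem6p1 (C : numClosedFieldType) (m n : nat) :
  (n + 2 < m)%N -> (1 <= n)%N ->
  forall (primed : bool) (L : hw C m n) (k : C),
    level L = k -> k != 0 -> orthoT primed L ->
    (L_integrable L <-> int_form primed k L).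
Proof.
move=> nm n1 primed L k lev kn ortho; split.
  by move=> /(integrable_dominance nm n1 ortho); apply: dominance_int_form.
by move=> /(int_form_dominance nm n1 lev); apply: dominance_integrable.
Qed.
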